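(* Let $0<p\le r\le\infty$ and $0<q\le u\le\infty$. For $b,d,k\in\mathbb{N}$ put $$e_k := e_k\big(\mathrm{id}:\ell_p^b(\ell_q^d)\to \ell_r^b(\ell_u^d)\big).$$ Then the following two-sided estimates hold, with constants depending only on $p,q,r,u$ (not on $k,b,d$). First, $$e_k\simeq \begin{cases} 1 &: 1\le k\le \log(bd),\\ b^{-(1/p-1/r)}\,d^{-(1/q-1/u)}\,2^{-\frac{k-1}{bd}} &: k\ge bd.\end{cases}$$ Second, for $\log(bd)\le k\le bd$ (a restriction in force in all ranges listed below), the following case distinctions hold. (i) Let $1/p-1/r>1/q-1/u\ge 0$. (i.a) In the special case $q=u$, $$e_k\simeq\begin{cases}1 &: \log(bd)\le k\le d,\\ \left(\frac{\log(eb/k)+d}{k}\right)^{1/p-1/r} &: d\le k\le bd.\end{cases}$$ (i.b) If $q<u$ and $b\le d$, then $$e_k\simeq\begin{cases}\left(\frac{\log(ed/k)}{k}\right)^{1/q-1/u} &: \log(bd)\le k\le d,\\ \left(\frac{d}{k}\right)^{1/p-1/r}d^{1/u-1/q} &: d\le k\le bd.\end{cases}$$ (i.c) If $q<u$ and $d\le b$, then $$e_k\simeq\begin{cases}\max\left\{\left(\frac{\log(eb/k)}{k}\right)^{1/p-1/r},\left(\frac{\log(ed/k)}{k}\right)^{1/q-1/u}\right\} &: \log(bd)\le k\le d,\\ \max\left\{\left(\frac{\log(eb/k)}{k}\right)^{1/p-1/r},\left(\frac{d}{k}\right)^{1/p-1/r}d^{1/u-1/q}\right\} &: d\le k\le b,\\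 \left(\frac{d}{k}\right)^{1/p-1/r}d^{1/u-1/q} &: b\le k\le bd.\end{cases}$$ (ii) Let $1/q-1/u\ge 1/p-1/r\ge 0$. Then $$e_k\simeq\begin{cases}\left(\frac{\log(ebd/k)}{k}\right)^{1/p-1/r} &: \log(bd)\le k\le b\log(d),\\ b^{1/r-1/p}\left(\frac{b\log(ebd/k)}{k}\right)^{1/q-1/u} &: b\log(d)\le k\le bd.\end{cases}$$
   Context: Here $\log$ is the natural logarithm, $e$ inside logarithms is Euler's number, and $1/\infty=0$. For $b,d\in\mathbb{N}$ and $0<p,q\le\infty$, $\ell_p^b(\ell_q^d)$ is the space of real matrices $x\in\mathbb{R}^{b\times d}$ with the quasi-norm $\|x\|_{p,q}=\big(\sum_{i=1}^b(\sum_{j=1}^d|x_{ij}|^q)^{p/q}\big)^{1/p}$, a sum being replaced by a maximum when $p=\infty$ or $q=\infty$. For quasi-Banach spaces $X,Y$ with unit balls $B_X,B_Y$ and a compact operator $T:X\to Y$, the $k$-th entropy number ($k\in\mathbb{N}$) is $$e_k(T:X\to Y)=\inf\Big\{\varepsilon>0:\ \exists\, y_1,\dots,y_{2^{k-1}}\in Y \text{ with } T(B_X)\subset\bigcup_{\ell=1}^{2^{k-1}}(y_\ell+\varepsilon B_Y)\Big\}.$$ $\mathrm{id}$ denotes the identity map. For non-negative quantities, $a\simeq b$ means $c_1 a\le b\le c_2 a$ with positive constants $c_1,c_2$.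
   Formalization: In (ii), the second estimate (b log(d) ≤ k ≤ bd) is asserted only for d ≥ 2 or 1/p-1/r = 1/q-1/u; for d = 1 and 1/q-1/u > 1/p-1/r it is false, since for k near log(b) the formula exceeds the true order of e_k by a factor unbounded in b. *)

(* Defs.v *)
From mathcomp Require Import all_boot all_order all_algebra.
From mathcomp Require Import all_classical all_reals all_analysis.
Set Implicit Arguments.
Unset Strict Implicit.
Unset Printing Implicit Defensive.
Import Order.TTheory GRing.Theory Num.Theory.

Local Open Scope classical_set_scope.
Local Open Scope ring_scope.

(* 1 / p for an exponent 0 < p <= +oo, with 1 / +oo = 0. *)
Definition recip (R : realType) (p : \bar R) : R := fine (p^-1)%E.

(* Only 0 < p <= +oo is meaningful; the value at p = -oo is a dummy. *)
Definition lnorm (R : realType) (p : \bar R) (n : nat) (v : 'I_n -> R) : R :=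
  match p with
  | s%:E => (\sum_(i < n) `|v i| `^ s) `^ s^-1
  | +oo%E => \big[Num.max/0]_(i < n) `|v i|
  | -oo%E => 0
  end.

Definition mixed_norm (R : realType) (p q : \bar R) (b d : nat)
    (x : 'M[R]_(b, d)) : R :=
  lnorm p (fun i : 'I_b => lnorm q (fun j : 'I_d => x i j)).

Definition unit_ball (R : realType) (X : lmodType R) (N : X -> R) : set X :=
  [set x | N x <= 1].

(* The quasi-norms NX, NY are explicit arguments because the same vector space
   carries several of them. For bounded T the set below is nonempty and bounded
   below by 0, so inf is the genuine infimum. *)
Definition entropy_number (R : realType) (X Y : lmodType R)
    (NX : X -> R) (NY : Y -> R) (k : nat) (T : {linear X -> Y}) : R :=
  inf [set eps : R | 0 < eps /\
    exists y : 'I_(2 ^ (k - 1)) -> Y,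
      T @` unit_ball NX `<=`
      \bigcup_(l in [set: 'I_(2 ^ (k - 1))])
        [set y l + eps *: z | z in unit_ball NY]].

Definition entropy_id (R : realType) (p q r u : \bar R) (b d k : nat) : R :=
  entropy_number (@mixed_norm R p q b d) (@mixed_norm R r u b d) k
    (idfun : {linear 'M[R]_(b, d) -> 'M[R]_(b, d)}).

Definition equiv_with (R : realType) (c1 c2 a a' : R) : Prop :=
  c1 * a <= a' /\ a' <= c2 * a.

(* Main.v *)
Require Import Defs.
From mathcomp Require Import all_boot all_order all_algebra.
From mathcomp Require Import all_classical all_reals all_analysis.
From mathcomp Require Import ring lra zify.
Import Order.TTheory GRing.Theory Num.Theory.
Local Open Scope ring_scope.

(** Only counting is used, no volumes.

    Covering.  Rounding the entries of a vector toward zero to a multiple of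
    [h] costs a number of points that exponential weights bound, and yields all
    row coverings.  A matrix of the unit ball is covered row by row: the level
    [floor (N * (norm of the row) ^ p)] of every row is recorded first, which
    needs only about [N ln (e + e b / N)] nats because the levels add up to at
    most [N]; a row of level [v >= 1] then gets a net of relative radius
    proportional to [((v + 1) / N) ^ - alpha], so that all levels contribute to
    the error equally, and a row of level [0] is replaced by zero.  The sizes of
    the row nets are chosen so that their logarithms add up to [O(k)].

    Packing.  If a finite family in the unit ball has at most [V] members within
    distance [delta] of any one of them and more than [2 ^ (k - 1) * V] members
    altogether, then [e_k >= c * delta].  Lattice points of a cube give the
    volumetric bound.  Words at large Hamming distance, encoded as 0-1 matrices
    with [N] nonzero rows of [m] ones each, give the logarithmic bounds; all of
    them are cases of one bound in terms of [y = k / ln (e b d / k)]. *)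

Set Implicit Arguments.
Unset Strict Implicit.
Unset Printing Implicit Defensive.

(* [lra] and [nra] reify every hypothesis, which is slow in large contexts; the
   tactics below first try them on a pruned context. *)
Ltac shares_variable_with_goal H :=
  match goal with
  | |- context [?x] => is_var x;
      let T := type of x in
      lazymatch T with realType => fail | _ => idtac end;
      match type of H with context [x] => idtac end
  end.
Ltac drop_unusable_hyps := repeat match goal with
  | H : forall _, _ |- _ => clear H
  | H : context [leq] |- _ => clear H
  end.
Ltac drop_unrelated_hyps := repeat match goal with
  | H : is_true (@Order.le ring_display _ _ _) |- _ =>
      tryif shares_variable_with_goal H then fail else clear H
  | H : is_true (@Order.lt ring_display _ _ _) |- _ =>
      tryif shares_variable_with_goal H then fail else clear H
  end.
Ltac drop_transcendental_hyps := repeat match goal with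
  | H : context [powR] |- _ => clear H
  | H : context [@ln] |- _ => clear H
  | H : context [expR] |- _ => clear H
  end.
Ltac qlra := first
  [ solve [drop_unusable_hyps; drop_transcendental_hyps; drop_unrelated_hyps; lra]
  | solve [drop_unusable_hyps; drop_transcendental_hyps; lra]
  | drop_unusable_hyps; lra ].
Ltac qnra := first
  [ solve [drop_unusable_hyps; drop_transcendental_hyps; nra]
  | drop_unusable_hyps; nra ].

(** The split between (i) and (ii) comes from the row nets. A row of level [v] needs a radius
    proportional to [((v + 1) / N) ^ - alpha], while a sparse net with parameter [m] has radius
    [m ^ - beta]. If [alpha <= beta], an [m] proportional to [v + 1] is enough and the costs are
    linear in the levels. If [beta < alpha], [m] grows like the power [alpha / beta > 1] of the
    relative level; the excess over 1 absorbs the logarithm, so the cost is again linear because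
    relative levels are at most 2. The common radius then has a floor set by the row nets, which
    produces the maxima in (i).

    Infinite exponents and exponents below 1 need no separate treatment in the counts: a finite [s]
    below both exponents is chosen, and a bound on the mixed norm is weakened to one on the sum of
    the [s]-th powers of all entries. Only constants are lost, because the bound is of the size
    attained by matrices with entries of modulus 1.

    The lower bounds in (i) need no new family: they are those of one row, of one column and of a
    block with about [k] entries. *)

Section Powers.
Context {R : realType}.
Implicit Types a x y : R.

Lemma powRE a x : 0 < a -> a `^ x = expR (x * ln a).
Proof. by move=> a0; rewrite /powR gt_eqF. Qed.

Lemma ler_powR_l (a b x : R) : 0 <= x -> 0 <= a -> a <= b -> a `^ x <= b `^ x.
Proof.
move=> x0 a0 ab; apply: ge0_ler_powR => //; rewrite nnegrE //; exact: le_trans ab.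
Qed.

Lemma powR_le1 (a x : R) : 0 <= x -> 0 <= a -> a <= 1 -> a `^ x <= 1.
Proof. by move=> x0 a0 a1; have := ler_powR_l x0 a0 a1; rewrite powR1. Qed.

Lemma powR_ge1 (a x : R) : 0 <= x -> 1 <= a -> 1 <= a `^ x.
Proof. by move=> x0 a1; have := ler_powR_l x0 ler01 a1; rewrite powR1. Qed.

Lemma powRK (a x : R) : 0 <= a -> x != 0 -> (a `^ x) `^ x^-1 = a.
Proof. by move=> a0 x0; rewrite -powRrM mulfV // powRr1. Qed.

Lemma powRVK (a x : R) : 0 <= a -> x != 0 -> (a `^ x^-1) `^ x = a.
Proof. by move=> a0 x0; rewrite -powRrM mulVf // powRr1. Qed.

Lemma powRDg a x y : 0 < a -> a `^ (x + y) = a `^ x * a `^ y.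
Proof. by move=> a0; rewrite !powRE // mulrDl expRD. Qed.

Lemma powRN_inv (a x : R) : 0 <= a -> a `^ (- x) = a^-1 `^ x.
Proof. by move=> a0; rewrite -mulN1r powRrM powR_inv1. Qed.

End Powers.

Section Exponents.
Context {R : realType}.
Implicit Types p q : \bar R.

Lemma recip_fin (s : R) : recip s%:E = s^-1.
Proof. by rewrite /recip fine_invr. Qed.

Lemma recip_pinfty : recip (+oo%E : \bar R) = 0.
Proof. by rewrite /recip invey. Qed.

Lemma exponentP p : (0 < p)%E ->
  (p = +oo%E /\ recip p = 0) \/ exists2 s : R, 0 < s & p = s%:E /\ recip p = s^-1.
Proof.
case: p => [s||] //= p0; last by left; rewrite recip_pinfty.
by right; exists s => //; rewrite recip_fin.
Qed.

Lemma recip_ge0 p : (0 < p)%E -> 0 <= recip p.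
Proof.
by case/exponentP => [[_ ->]|[s s0 [_ ->]]] //; rewrite invr_ge0 ltW.
Qed.

Lemma recip_le p q : (0 < p)%E -> (p <= q)%E -> recip q <= recip p.
Proof.
move=> p0 pq; have q0 := lt_le_trans p0 pq.
case: (exponentP q0) => [[_ ->]|[t t0 [eq ->]]]; first exact: recip_ge0.
case: (exponentP p0) => [[ep _]|[s s0 [ep ->]]]; first by move: pq; rewrite ep eq.
by rewrite lef_pV2 ?posrE //; move: pq; rewrite ep eq lee_fin.
Qed.

Lemma recip_lt p q : (0 < p)%E -> (p < q)%E -> recip q < recip p.
Proof.
move=> p0 pq; have q0 := lt_trans p0 pq.
case: (exponentP p0) => [[ep _]|[s s0 [ep ->]]].
  by move: pq; rewrite ep => /lt_le_trans/(_ (leey _)); rewrite ltxx.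
case: (exponentP q0) => [[_ ->]|[t t0 [eq ->]]]; first by rewrite invr_gt0.
by rewrite ltf_pV2 ?posrE //; move: pq; rewrite ep eq lte_fin.
Qed.

Lemma recip_gt0_fin p : (0 < p)%E -> 0 < recip p ->
  exists2 s : R, 0 < s & p = s%:E /\ recip p = s^-1.
Proof. by case/exponentP => [[_ ->]|//]; rewrite ltxx. Qed.

End Exponents.

(** * Quasi-norms *)

Section Lnorm.
Context {R : realType}.
Implicit Types p q : \bar R.

Lemma lnorm_ge0 p n (v : 'I_n -> R) : 0 <= lnorm p v.
Proof.
case: p => [s||] //=; first exact: powR_ge0.
by elim/big_ind: _ => // x y x0 y0; rewrite le_max x0.
Qed.

Lemma lnorm_fin_le (s : R) n (v : 'I_n -> R) (A : R) : 0 < s ->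
  lnorm s%:E v <= A -> \sum_(i < n) `|v i| `^ s <= A `^ s.
Proof.
move=> s0 /= h.
have S0 : 0 <= \sum_(i < n) `|v i| `^ s by apply: sumr_ge0 => i _; exact: powR_ge0.
by have := ler_powR_l (ltW s0) (powR_ge0 _ _) h; rewrite powRVK ?gt_eqF.
Qed.

Lemma lnorm_entry p n (v : 'I_n -> R) i : (0 < p)%E -> `|v i| <= lnorm p v.
Proof.
case/exponentP => [[-> _]|[s s0 [-> _]]] /=; first exact: le_bigmax.
rewrite -[leLHS](@powRK _ _ s) ?gt_eqF //; apply: ler_powR_l.
- by rewrite invr_ge0 ltW.
- exact: powR_ge0.
- by rewrite (bigD1 i) //= lerDl sumr_ge0 // => j _; exact: powR_ge0.
Qed.

(* The weights [t] distribute the "mass" of the [p]-th powers; for [p = +oo]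
   the factor [t i `^ 0] is [1]. *)
Lemma lnorm_le_weights p n (v t : 'I_n -> R) (eps T : R) : (0 < p)%E ->
  0 <= eps -> (forall i, 0 <= t i) -> \sum_i t i <= T ->
  (forall i, `|v i| <= t i `^ recip p * eps) -> lnorm p v <= T `^ recip p * eps.
Proof.
move=> p0 e0 t0 tT hv; case: (exponentP p0) => [[ep rp]|[s s0 [ep rp]]].
  rewrite rp ep powRr0 mul1r /=; apply/bigmax_leP; split => // i _.
  by have := hv i; rewrite rp powRr0 mul1r.
rewrite rp ep /= -[X in _ * X](@powRK _ _ s) ?gt_eqF //.
have T0 : 0 <= T by apply: le_trans tT; apply: sumr_ge0.
rewrite -powRM ?powR_ge0 //; apply: ler_powR_l.
- by rewrite invr_ge0 ltW.
- by apply: sumr_ge0 => i _; exact: powR_ge0.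
apply: le_trans (ler_wpM2r (powR_ge0 _ _) tT).
rewrite mulr_suml; apply: ler_sum => i _.
have := ler_powR_l (ltW s0) (normr_ge0 _) (hv i).
by rewrite powRM ?powR_ge0 // rp powRVK ?gt_eqF.
Qed.

Lemma lnorm_mono p n (v w : 'I_n -> R) : (0 < p)%E ->
  (forall i, `|v i| <= `|w i|) -> lnorm p v <= lnorm p w.
Proof.
case/exponentP => [[-> _]|[s s0 [-> _]]] h /=; first exact: le_bigmax2.
apply: ler_powR_l; first by rewrite invr_ge0 ltW.
  by apply: sumr_ge0 => i _; exact: powR_ge0.
by apply: ler_sum => i _; apply: ler_powR_l; rewrite // ltW.
Qed.

Lemma lnorm_scale p n (v : 'I_n -> R) (c : R) : (0 < p)%E ->
  lnorm p (fun i => c * v i) = `|c| * lnorm p v.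
Proof.
case/exponentP => [[-> _]|[s s0 [-> _]]] /=.
  elim/big_rec2: _ => [|i x y _ ->]; first by rewrite mulr0.
  by rewrite normrM maxr_pMr.
under eq_bigr do rewrite normrM powRM //.
rewrite -mulr_sumr powRM ?powR_ge0 ?powRK ?gt_eqF //.
by apply: sumr_ge0 => i _; exact: powR_ge0.
Qed.

Lemma lnorm_inj p m n (f : 'I_m -> 'I_n) (v : 'I_n -> R) : (0 < p)%E ->
  injective f -> lnorm p (fun i => v (f i)) <= lnorm p v.
Proof.
case/exponentP => [[-> _]|[s s0 [-> _]]] fi /=.
  apply/bigmax_leP; split; first by rewrite -/(lnorm +oo%E v) lnorm_ge0.
  by move=> i _; exact: le_bigmax.
apply: ler_powR_l; first by rewrite invr_ge0 ltW.
  by apply: sumr_ge0 => i _; exact: powR_ge0.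
rewrite -(big_imset (fun j => `|v j| `^ s) (h := f) (A := predT)) /=; last by move=> x y _ _ /fi.
rewrite [leRHS](bigID [in f @: predT]) /= lerDl.
by apply: sumr_ge0 => i _; exact: powR_ge0.
Qed.

(** The weights [|y i| ^ s + |z i| ^ s] have total at most [2 A ^ s], and the [s]-th root of each
    dominates both [|y i|] and [|z i|]. This avoids Minkowski's inequality and treats [s < 1] and
    [s >= 1] alike. *)
Lemma lnorm_quasi p n (x y z : 'I_n -> R) (A : R) : (0 < p)%E ->
  (forall i, `|x i| <= `|y i| + `|z i|) -> lnorm p y <= A -> lnorm p z <= A ->
  lnorm p x <= 2 `^ (1 + recip p) * A.
Proof.
move=> p0 h hy hz; case: (exponentP p0) => [[ep rp]|[s s0 [ep rp]]].
  rewrite rp addr0 powRr1 //; move: hy hz; rewrite ep /= => hy hz.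
  have A0 : 0 <= A by apply: le_trans hy; rewrite -/(lnorm +oo%E y) lnorm_ge0.
  apply/bigmax_leP; split => [|i _]; first exact: mulr_ge0.
  apply: le_trans (h i) _; rewrite mulr_natl mulr2n; apply: lerD.
    by apply: le_trans hy; exact: le_bigmax.
  by apply: le_trans hz; exact: le_bigmax.
rewrite ep in hy hz.
have A0 : 0 <= A by apply: le_trans hy; exact: lnorm_ge0.
have Hy := lnorm_fin_le s0 hy; have Hz := lnorm_fin_le s0 hz.
set t := fun i => `|y i| `^ s + `|z i| `^ s.
have Ht : \sum_i t i <= 2 * A `^ s.
  by rewrite /t big_split mulr_natl mulr2n lerD.
apply: (@le_trans _ _ ((2 * A `^ s) `^ recip p * 2)); last first.
  rewrite (powRM _ (ler0n _ 2) (powR_ge0 A s)) rp (powRK A0 (lt0r_neq0 s0)).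
  by rewrite (powRDg 1 s^-1 (ltr0n _ 2)) (powRr1 (ler0n _ 2)) mulrC mulrA.
apply: (@lnorm_le_weights p n x t) => // i; first by rewrite addr_ge0 ?powR_ge0.
apply: le_trans (h i) _; rewrite rp.
have t0 : 0 <= t i by rewrite addr_ge0 ?powR_ge0.
have a1 : `|y i| <= t i `^ s^-1.
  rewrite -[leLHS](@powRK _ _ s) ?gt_eqF //; apply: ler_powR_l.
  - by rewrite invr_ge0 ltW.
  - exact: powR_ge0.
  - by rewrite lerDl powR_ge0.
have a2 : `|z i| <= t i `^ s^-1.
  rewrite -[leLHS](@powRK _ _ s) ?gt_eqF //; apply: ler_powR_l.
  - by rewrite invr_ge0 ltW.
  - exact: powR_ge0.
  - by rewrite lerDr powR_ge0.
by rewrite mulr_natr mulr2n lerD.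
Qed.

Lemma lnorm_const_le p n (v : 'I_n -> R) (c : R) : (0 < p)%E -> 0 <= c ->
  (forall i, `|v i| <= c) -> lnorm p v <= n%:R `^ recip p * c.
Proof.
move=> p0 c0 h; apply: (@lnorm_le_weights p n v (fun=> 1)) => //.
  by rewrite sumr_const card_ord.
by move=> i; rewrite powR1 mul1r.
Qed.

(** After division by the [p]-norm the [s]-th powers of the entries, [s = p], are weights of total
    at most 1; an entry [x <= 1] satisfies [x <= (x ^ s) ^ recip q] because [s * recip q <= 1]. *)
Lemma lnorm_nested p q n (v : 'I_n -> R) : (0 < p)%E -> (p <= q)%E ->
  lnorm q v <= lnorm p v.
Proof.
move=> p0 pq; have q0 := lt_le_trans p0 pq.
case: (exponentP p0) => [[ep rp]|[s s0 [ep rp]]].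
  by move: pq; rewrite ep leye_eq => /eqP ->.
set A := lnorm p v; have A0 : 0 <= A by exact: lnorm_ge0.
have hA : lnorm s%:E v <= A by rewrite /A ep.
have [A00|An0] := eqVneq A 0.
  have v0 i : `|v i| <= 0 by rewrite -A00 /A; apply: lnorm_entry.
  have := lnorm_const_le q0 (lexx 0) v0.
  by rewrite mulr0 A00.
have Ap : 0 < A by rewrite lt0r An0.
have := @lnorm_le_weights q n v (fun i => (`|v i| / A) `^ s) A 1 q0 A0.
rewrite powR1 mul1r; apply => [i||i].
- exact: powR_ge0.
- under eq_bigr do rewrite powRM ?invr_ge0 //.
  rewrite -mulr_suml; have := lnorm_fin_le s0 hA.
  have := powR_gt0 s Ap => Aps.
  by rewrite -powR_inv1 // powRAC powR_inv1 ?powR_ge0 // ler_pdivrMr // mul1r.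
- have le1 : `|v i| / A <= 1 by rewrite ler_pdivrMr // mul1r; apply: lnorm_entry.
  have ge0 : 0 <= `|v i| / A by rewrite divr_ge0.
  rewrite -ler_pdivrMr //.
  have [->|n0] := eqVneq (`|v i| / A) 0; first by rewrite powR_ge0.
  have g0 : 0 < `|v i| / A by rewrite lt0r n0.
  rewrite -powRrM; apply: ger1_powR; first by rewrite g0.
  have /= := recip_le p0 pq; rewrite rp => hr.
  by rewrite mulrC -ler_pdivlMr // mul1r.
Qed.

(* A substitute for Hoelder's inequality that loses only a constant factor. *)
Lemma lnorm_sum_powR p n (v : 'I_n -> R) (s tau : R) : 0 < s -> (s%:E <= p)%E ->
  0 <= tau -> lnorm p v <= n%:R `^ recip p * tau ->
  \sum_i `|v i| `^ s <= 2 * n%:R * tau `^ s.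
Proof.
move=> s0 sp tau0; have p0 : (0 < p)%E by apply: lt_le_trans sp.
case: (exponentP p0) => [[ep rp]|[t t0 [ep rp]]] h.
  rewrite rp ep powRr0 mul1r in h.
  have hv i : `|v i| `^ s <= tau `^ s.
    apply: ler_powR_l => //; first exact: ltW.
    by apply: le_trans h; exact: lnorm_entry.
  apply: (le_trans (ler_sum _ (fun i _ => hv i))).
  rewrite sumr_const card_ord -[leLHS]mulr_natl; apply: ler_wpM2r; rewrite ?powR_ge0 //.
  by rewrite ler_peMl // ler1n.
move: h; rewrite ep => /(lnorm_fin_le t0); rewrite -ep rp powRM ?powR_ge0 // powRVK ?gt_eqF // => h.
have [tau00|taun0] := eqVneq tau 0.
  move: h; rewrite tau00 powR0 ?gt_eqF // mulr0 => h.
  rewrite powR0 ?gt_eqF // mulr0; apply: sumr_le0 => i _.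
  have : `|v i| `^ t <= 0.
    by apply: le_trans h; rewrite (bigD1 i) //= lerDl sumr_ge0 // => j _; exact: powR_ge0.
  rewrite le_eqVlt ltNge powR_ge0 orbF powR_eq0 => /andP[/eqP -> _].
  by rewrite powR0 ?gt_eqF.
have taup : 0 < tau by rewrite lt0r taun0.
have st : s <= t by move: sp; rewrite ep lee_fin.
have hv i : `|v i| `^ s <= tau `^ s * (1 + `|v i| `^ t * (tau `^ t)^-1).
  have x0 : 0 <= `|v i| / tau by rewrite divr_ge0.
  have -> : `|v i| = tau * (`|v i| / tau) by field.
  move: (`|v i| / tau) x0 => x x0.
  rewrite !powRM //; apply: ler_wpM2l; first exact: powR_ge0.
  have -> : tau `^ t * x `^ t * (tau `^ t)^-1 = x `^ t.
    by field; rewrite gt_eqF // powR_gt0.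
  case: (lerP x 1) => x1.
    by apply: le_trans (powR_le1 (ltW s0) x0 x1) _; rewrite lerDl powR_ge0.
  by apply: le_trans (ler_powR (ltW x1) st) _; rewrite lerDr.
apply: (le_trans (ler_sum _ (fun i _ => hv i))).
rewrite -mulr_sumr big_split /= sumr_const card_ord -mulr_suml.
rewrite [leRHS]mulrC; apply: ler_wpM2l; first exact: powR_ge0.
rewrite mulr_natl [leRHS]mulr2n lerD2l ler_pdivrMr ?powR_gt0 //.
Qed.

End Lnorm.

Section MixedNorm.
Context {R : realType}.
Implicit Types p q r u : \bar R.

Lemma mixed_norm_scale p q b d (x : 'M[R]_(b, d)) (c : R) : (0 < p)%E -> (0 < q)%E ->
  mixed_norm p q (c *: x) = `|c| * mixed_norm p q x.
Proof.
move=> p0 q0; rewrite /mixed_norm.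
transitivity (lnorm p (fun i => `|c| * lnorm q (fun j => x i j))).
  congr lnorm; apply/funext => i; rewrite -lnorm_scale //.
  by congr lnorm; apply/funext => j; rewrite mxE.
by rewrite lnorm_scale // normr_id.
Qed.

Definition quasi_const p q : R := 2 `^ (1 + recip p) * 2 `^ (1 + recip q).

Lemma quasi_const_ge1 p q : (0 < p)%E -> (0 < q)%E -> 1 <= quasi_const p q.
Proof.
move=> p0 q0; rewrite /quasi_const -[leLHS]mulr1.
have := recip_ge0 p0; have := recip_ge0 q0 => a b.
by apply: ler_pM => //; apply: powR_ge1; rewrite ?addr_ge0 // ler1n.
Qed.

Lemma mixed_norm_quasi p q b d (x y z : 'M[R]_(b, d)) (A : R) : (0 < p)%E -> (0 < q)%E ->
  (forall i j, `|x i j| <= `|y i j| + `|z i j|) ->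
  mixed_norm p q y <= A -> mixed_norm p q z <= A ->
  mixed_norm p q x <= quasi_const p q * A.
Proof.
move=> p0 q0 h hy hz; rewrite /mixed_norm /quasi_const -mulrA.
set c := 2 `^ (1 + recip q).
have c0 : 0 <= c by exact: powR_ge0.
apply: (@lnorm_quasi _ p b _ (fun i => c * lnorm q (fun j => y i j))
                       (fun i => c * lnorm q (fun j => z i j))) => //; last 2 first.
- by rewrite lnorm_scale // ger0_norm // ler_wpM2l.
- by rewrite lnorm_scale // ger0_norm // ler_wpM2l.
move=> i; rewrite !normrM !(ger0_norm c0) !ger0_norm ?lnorm_ge0 // -mulrDr.
apply: (@lnorm_quasi _ q d _ (fun j => y i j) (fun j => z i j)) => //.
- by rewrite lerDl lnorm_ge0.
- by rewrite lerDr lnorm_ge0.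
Qed.

Lemma mixed_norm_const_le p q b d (x : 'M[R]_(b, d)) (c : R) : (0 < p)%E -> (0 < q)%E ->
  0 <= c -> (forall i j, `|x i j| <= c) ->
  mixed_norm p q x <= b%:R `^ recip p * d%:R `^ recip q * c.
Proof.
move=> p0 q0 c0 h; rewrite -mulrA; apply: lnorm_const_le => //.
  by rewrite mulr_ge0 ?powR_ge0.
by move=> i; rewrite ger0_norm ?lnorm_ge0 //; exact: lnorm_const_le.
Qed.

Lemma mixed_norm_nested p q r u b d (x : 'M[R]_(b, d)) : (0 < p)%E -> (0 < q)%E ->
  (p <= r)%E -> (q <= u)%E -> mixed_norm r u x <= mixed_norm p q x.
Proof.
move=> p0 q0 pr qu; have r0 := lt_le_trans p0 pr.
apply: le_trans (lnorm_nested _ p0 pr); apply: lnorm_mono => // i.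
by rewrite !ger0_norm ?lnorm_ge0 //; exact: lnorm_nested.
Qed.

(** Two uses of [lnorm_sum_powR], for each row and for the vector of row norms, give the factor
    [2 * 2]. The lattice and Hamming counts for whole matrices see a mixed norm only through this
    sum over the entries. *)
Lemma mixed_norm_sum_powR p q b d (x : 'M[R]_(b, d)) (s : R) : (0 < d)%N ->
  0 < s -> (s%:E <= p)%E -> (s%:E <= q)%E ->
  mixed_norm p q x <= b%:R `^ recip p * d%:R `^ recip q ->
  \sum_i \sum_j `|x i j| `^ s <= 4 * b%:R * d%:R.
Proof.
move=> d0 s0 sp sq h; set D := d%:R `^ recip q : R.
have Dp : 0 < D by rewrite powR_gt0 // ltr0n.
have h1 i : \sum_j `|x i j| `^ s <= 2 * d%:R * (lnorm q (fun j => x i j) / D) `^ s.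
  apply: (@lnorm_sum_powR _ q) => //; first by rewrite divr_ge0 ?lnorm_ge0 // ltW.
  by rewrite -/D mulrC divfK ?gt_eqF.
apply: (le_trans (ler_sum _ (fun i _ => h1 i))); rewrite -mulr_sumr.
have := @lnorm_sum_powR _ p b (fun i => lnorm q (fun j => x i j) / D) s 1 s0 sp ler01.
rewrite mulr1 powR1 mulr1; under eq_bigr => i _ do
  rewrite ger0_norm ?divr_ge0 ?lnorm_ge0 ?ltW //.
have -> : 4 * b%:R * d%:R = 2 * d%:R * (2 * b%:R) :> R by ring.
move=> H; apply: ler_wpM2l; first by rewrite mulr_ge0.
apply: H; rewrite (_ : (fun i => _) = (fun i => D^-1 * lnorm q (fun j => x i j))); last first.
  by apply/funext => i; rewrite mulrC.
rewrite lnorm_scale ?(lt_le_trans _ sp) //.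
by rewrite ger0_norm ?invr_ge0 ?(ltW Dp) // ler_pdivrMl // mulrC.
Qed.

End MixedNorm.

(** * Counting *)

Section Counting.
Context {R : realType}.

Lemma card_pred_le_weight (T : finType) (P : pred T) (w : T -> R) :
  (forall x, 0 <= w x) -> (forall x, P x -> 1 <= w x) ->
  #|[pred x | P x]|%:R <= \sum_x w x.
Proof.
move=> w0 w1; rewrite -sum1_card natr_sum (bigID P [pred x | true] w) /=.
rewrite -[leLHS]addr0; apply: lerD; last by apply: sumr_ge0.
by apply: ler_sum => x; rewrite inE => /w1.
Qed.

(* Exponential Chebyshev inequality for the counting measure. *)
Lemma card_weight_le (I J : finType) (h : I -> J -> R) (m lam : R) : 0 <= lam ->
  #|[pred f : {ffun I -> J} | \sum_i h i (f i) <= m]|%:R <=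
  expR (lam * m) * \prod_i \sum_j expR (- (lam * h i j)).
Proof.
move=> l0; rewrite (bigA_distr_bigA (fun i j => expR (- (lam * h i j)))) /= big_distrr /=.
apply: card_pred_le_weight => f; rewrite -expR_sum -expRD ?expR_ge0 // => hf.
rewrite -[leLHS]expR0 ler_expR sumrN -mulr_sumr -mulrBr.
by rewrite mulr_ge0 // subr_ge0.
Qed.

Lemma sum_inv_sqr_le (Z : nat) : \sum_(z < Z) (z.+1%:R ^+ 2)^-1 <= 2 :> R.
Proof.
suff h : \sum_(z < Z) (z.+1%:R ^+ 2)^-1 <= 2 * (1 - Z.+1%:R^-1) :> R.
  apply: le_trans h _; rewrite -[leRHS]mulr1 ler_wpM2l // lerBlDr lerDl invr_ge0 //.
elim: Z => [|Z IH]; first by rewrite big_ord0 invr1 subrr mulr0.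
rewrite big_ord_recr /=; apply: (le_trans (lerD IH (lexx _))).
have z0 : 0 < Z.+1%:R :> R by rewrite ltr0n.
rewrite -[Z.+2%:R]natr1; move: (Z.+1%:R) z0 (ler1n R Z.+1) => z z0 z1.
rewrite -subr_ge0.
have -> : 2 * (1 - (z + 1)^-1) - (2 * (1 - z^-1) + (z ^+ 2)^-1) =
          (z - 1) / (z ^+ 2 * (z + 1)).
  by field; apply/andP; split; rewrite gt_eqF //; lra.
by apply: divr_ge0; [rewrite subr_ge0 z1|nra].
Qed.

(** Up to a constant the whole sum is no larger than its first term, uniformly in [Z] and
    [lam >= 1]. As [x = (z + 1) ^ s >= 1], the exponent [lam * x] is at least [lam + (x - 1)], and
    [exp (- x)] is summable over [z]. *)
Lemma sum_expR_powR_le (s : R) : 0 < s -> exists2 C : R, 0 < C &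
  forall (Z : nat) (lam : R), 1 <= lam ->
  \sum_(z < Z) expR (- (lam * z.+1%:R `^ s)) <= C * expR (- lam).
Proof.
(* With this [n], [x ^ (n + 1) >= (z + 1) ^ 2], so the Taylor term of order [n + 1] of [exp x]
   yields a summable inverse square. *)
move=> s0; set n := (Num.truncn (2 / s)).
have hn : 2 <= s * n.+1%:R.
  by rewrite mulrC -ler_pdivrMr // ltW // truncnS_gt.
set c := n.+1`!%:R : R.
have c0 : 0 < c by rewrite ltr0n fact_gt0.
exists (expR 1 * (c * 2)) => [|Z lam l1]; first by rewrite !mulr_gt0 // expR_gt0.
apply: (@le_trans _ _ (\sum_(z < Z) expR (- lam) * (expR 1 * (c * (z.+1%:R ^+ 2)^-1)))); last first.
  rewrite -mulr_sumr -mulr_sumr -mulr_sumr mulrC ler_wpM2r ?expR_ge0 //.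
  rewrite ler_wpM2l ?expR_ge0 // ler_wpM2l ?(ltW c0) //. exact: sum_inv_sqr_le.
apply: ler_sum => z _; set x := z.+1%:R `^ s.
have z1 : 1 <= z.+1%:R :> R by rewrite ler1n.
have x1 : 1 <= x by apply: powR_ge1 => //; exact: ltW.
have -> : - (lam * x) = - lam + (- (lam * (x - 1))) by ring.
rewrite expRD ler_wpM2l ?expR_ge0 //.
apply: (@le_trans _ _ (expR (1 + - x))); first by rewrite ler_expR; nra.
rewrite expRD ler_wpM2l ?expR_ge0 // expRN.
have x0 : 0 < x by lra.
have xn : z.+1%:R ^+ 2 <= x ^+ n.+1.
  rewrite -!powR_mulrn ?(ltW x0) // -powRrM; exact: ler_powR.
have hx : x ^+ n.+1 / c <= expR x.
  by apply: le_trans (expR_ge1Dxn n (ltW x0)); rewrite lerDr.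
have z2 : 0 < z.+1%:R ^+ 2 :> R by rewrite exprn_gt0.
rewrite -[leLHS]mul1r ler_pdivrMr ?expR_gt0 // mulrAC ler_pdivlMr // mul1r.
by apply: (le_trans xn); rewrite -ler_pdivrMl // mulrC.
Qed.

(* The integers of absolute value at most [Z]: [inl tt] is [0] and
   [inr (z, neg)] is [z + 1] or its opposite. *)
Definition sint (Z : nat) := (unit + 'I_Z * bool)%type.

Definition sint_val (Z : nat) (j : sint Z) : R :=
  if j is inr (z, neg) then (-1) ^+ neg * z.+1%:R else 0.

Lemma sum_sint (Z : nat) (s lam : R) : s != 0 ->
  \sum_(j : sint Z) expR (- (lam * `|sint_val j| `^ s)) =
  1 + 2 * \sum_(z < Z) expR (- (lam * z.+1%:R `^ s)).
Proof.
move=> s0; rewrite big_sumType /= (big_pred1 tt); last by case.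
rewrite normr0 powR0 // mulr0 oppr0 expR0; congr (_ + _).
rewrite mulr_natl mulr2n -big_split /=.
transitivity (\sum_(z < Z) \sum_(b : bool) expR (- (lam * `|sint_val (inr (z, b) : sint Z)| `^ s))).
  by rewrite pair_bigA; apply: eq_bigr => -[z b].
apply: eq_bigr => z _; rewrite big_bool /= !normrM !normrX normrN1 !expr1n !mul1r.
by rewrite ger0_norm.
Qed.

(** Rounding toward zero gives the third bound, so sums of powers do not grow. By the second bound
    an entry below the step costs no more than its own size; [sparse_row_covering] interpolates it
    with the first. *)
Lemma sint_round (Z : nat) (x : R) : `|x| <= Z%:R -> exists j : sint Z,
  [/\ `|x - sint_val j| <= 1, `|x - sint_val j| <= `|x| & `|sint_val j| <= `|x| ].
Proof.
move=> xZ; have [x1|x1] := ltP `|x| 1.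
  by exists (inl tt); rewrite /= subr0 normr0; split => //; exact: ltW.
set t := Num.truncn `|x|.
have t0 : (0 < t)%N by rewrite truncn_gt0.
have tZ : (t.-1 < Z)%N.
  rewrite prednK // -(ler_nat R); apply: le_trans xZ; by rewrite truncn_le.
exists (inr (Ordinal tZ, x < 0)) => /=.
have /andP[lo hi] := truncn_itv (normr_ge0 x); rewrite -/t in lo hi.
rewrite prednK //; rewrite -natr1 in hi.
have [xn|xp] := ltP x 0.
  rewrite expr1 mulN1r opprK normrN [`|t%:R|]ger0_norm // in lo hi *.
  rewrite ltr0_norm // in lo hi *.
  have -> : `|x + t%:R| = - x - t%:R by rewrite ler0_norm; [ring|lra].
  by split; [lra| |lra]; rewrite lerBlDr lerDl.
rewrite expr0 mul1r [`|t%:R|]ger0_norm // in lo hi *.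
rewrite (ger0_norm xp) in lo hi *.
have -> : `|x - t%:R| = x - t%:R by rewrite ger0_norm // subr_ge0.
by split; [lra| |lra]; rewrite lerBlDr lerDl.
Qed.

(** The parameter [lam] is left free to trade [lam * m] against [|I| exp (- lam)]: the value 1
    serves when [m] is of the order of [|I|], a logarithmic one when [m] is much smaller. *)
Lemma card_sint_le (s : R) : 0 < s -> exists2 C : R, 0 < C &
  forall (I : finType) (Z : nat) (m lam : R), 1 <= lam ->
  #|[pred f : {ffun I -> sint Z} | \sum_i `|sint_val (f i)| `^ s <= m]|%:R <=
  expR (lam * m + C * #|I|%:R * expR (- lam)).
Proof.
move=> s0; have [C C0 hC] := sum_expR_powR_le s0.
exists (2 * C) => [|I Z m lam l1]; first by rewrite mulr_gt0.
have l0 : 0 <= lam by lra.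
apply: le_trans (@card_weight_le _ _ (fun _ j => `|sint_val j| `^ s) m lam l0) _.
rewrite expRD ler_wpM2l ?expR_ge0 // sum_sint ?gt_eqF // prodr_const.
rewrite mulrAC expRM_natr; apply: lerXn2r; rewrite ?nnegrE ?expR_ge0 //.
  by rewrite addr_ge0 // mulr_ge0 // sumr_ge0 // => *; exact: expR_ge0.
apply: le_trans (expR_ge1Dx _); rewrite lerD2l -mulrA ler_wpM2l //; exact: hC.
Qed.

(** For fixed [i] the signed integer [g i - f i] determines [g i], so each factor is at most a sum
    over all of [sint]. The bound does not depend on [n], hence the cube may be as fine as [k]
    requires. *)
Lemma card_cube_le (s : R) : 0 < s -> exists2 C : R, 1 <= C &
  forall (I : finType) (n : nat) (f : {ffun I -> 'I_n.+1}) (c : R), 0 <= c ->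
  #|[pred g : {ffun I -> 'I_n.+1} |
     \sum_i `|(g i)%:R - (f i)%:R : R| `^ s <= c * #|I|%:R]|%:R <= (expR c * C) `^ #|I|%:R.
Proof.
move=> s0; have [C C0 hC] := sum_expR_powR_le s0.
exists (1 + 2 * C) => [|I n f c c0]; first by rewrite lerDl mulr_ge0 // ltW.
apply: le_trans (@card_weight_le _ _ (fun i j => `|(nat_of_ord j)%:R - (f i)%:R| `^ s)
  (c * #|I|%:R) 1 ler01) _.
rewrite powR_mulrn; last by rewrite mulr_ge0 ?expR_ge0 // addr_ge0 // mulr_ge0 // ltW.
rewrite exprMn mul1r expRM_natr ler_wpM2l ?exprn_ge0 ?expR_ge0 // -prodr_const.
apply: ler_prod => i _; rewrite sumr_ge0 /=; last by move=> j _; exact: expR_ge0.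
(* Since [inr (z, _)] has absolute value [z + 1], a nonzero difference is stored less one. *)
pose enc (j : 'I_n.+1) : sint n.+1 := if j == f i then inl tt else
  if (f i < j)%N then inr (inord (j - (f i).+1), false) else inr (inord ((f i) - j.+1), true).
have encV j : sint_val (enc j) = j%:R - (f i)%:R.
  have jn := ltn_ord j; have fn := ltn_ord (f i).
  rewrite /enc; case: eqVneq => [->|ne]; first by rewrite subrr.
  case: ltnP => lt /=; rewrite inordK ?mul1r ?expr1 ?mulN1r; try lia.
    by rewrite -natrB 1?ltnW //; congr (_%:R); lia.
  have lt' : (j < f i)%N by rewrite ltn_neqAle lt andbT.
  by rewrite -[RHS]opprB -natrB 1?ltnW //; congr (- _%:R); lia.
have enc_inj : injective enc.
  move=> j k /(congr1 (@sint_val n.+1)); rewrite !encV => /addIr /eqP.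
  by rewrite eqr_nat => /eqP /val_inj.
apply: (@le_trans _ _ (\sum_(j : sint n.+1) expR (- (1 * `|sint_val j| `^ s)))).
  under eq_bigr => j _ do rewrite -encV.
  rewrite -(big_imset (fun z => expR (- (1 * `|sint_val z| `^ s))) (h := enc) (A := predT)) /=;
    last by move=> x y _ _ /enc_inj.
  rewrite [leRHS](bigID [in enc @: predT]) /= lerDl.
  by apply: sumr_ge0 => *; exact: expR_ge0.
rewrite sum_sint ?gt_eqF // lerD2l ler_wpM2l //.
apply: le_trans (hC _ _ (lexx _)) _.
by rewrite ler_piMr ?ltW // expR_lt1 ltrN10.
Qed.

(** With [lam = ln |J|] every coordinate contributes [1 + (|J| - 1) / |J| <= 2]. Up to the factor
    [2 ^ |I|] the ball has at most the square root of the number of all words. *)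
Lemma card_hamming_le (I J : finType) (f : {ffun I -> J}) : (0 < #|J|)%N ->
  #|[pred g : {ffun I -> J} | \sum_i ((g i != f i)%:R : R) <= #|I|%:R / 2]|%:R <=
  expR (ln #|J|%:R * (#|I|%:R / 2)) * 2 ^+ #|I| :> R.
Proof.
move=> J0; have J1 : 1 <= #|J|%:R :> R by rewrite ler1n.
have l0 : 0 <= ln (#|J|%:R : R) by exact: ln_ge0.
apply: le_trans (@card_weight_le _ _ (fun i j => (j != f i)%:R) _ _ l0) _.
rewrite ler_wpM2l ?expR_ge0 // -prodr_const; apply: ler_prod => i _.
rewrite sumr_ge0 /=; last by move=> j _; exact: expR_ge0.
rewrite (bigD1 (f i)) //= eqxx mulr0 oppr0 expR0.
rewrite (eq_bigr (fun _ => #|J|%:R^-1)); last first.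
  by move=> j /negPf -> /=; rewrite mulr1 expRN lnK // posrE ltr0n.
have -> : 2 = 1 + 1 :> R by [].
rewrite lerD2l sumr_const -[leLHS]mulr_natl ler_pdivrMr ?ltr0n // mul1r ler_nat.
exact: max_card.
Qed.

End Counting.

(** * Padding vectors with zeros *)

Section ZeroExtension.
Context {R : realType}.

Lemma lnorm_extension (p : \bar R) m n (f : 'I_m -> 'I_n) (w : 'I_m -> R) (v : 'I_n -> R) :
  (0 < p)%E -> injective f -> (forall i, v (f i) = w i) ->
  (forall j, j \notin codom f -> v j = 0) -> lnorm p v <= lnorm p w.
Proof.
move=> p0 fi vf v0; case: (exponentP p0) => [[ep _]|[s s0 [ep _]]]; rewrite ep /=.
  apply/bigmax_leP; split; first by rewrite -/(lnorm +oo%E w) lnorm_ge0.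
  move=> j _; case: (boolP (j \in codom f)) => [/codomP[i ->]|/v0 ->].
    by rewrite vf; exact: le_bigmax.
  by rewrite normr0 -/(lnorm +oo%E w) lnorm_ge0.
apply: ler_powR_l; first by rewrite invr_ge0 ltW.
  by apply: sumr_ge0 => i _; exact: powR_ge0.
rewrite (bigID [in f @: predT]) /= [X in _ + X]big1 ?addr0; last first.
  move=> j; case: (boolP (j \in codom f)) => [/codomP[i ->]|/v0 -> _].
    by rewrite imset_f.
  by rewrite normr0 powR0 ?gt_eqF.
rewrite big_imset /=; last by move=> x y _ _ /fi.
by apply: ler_sum => i _; rewrite vf.
Qed.

Lemma lnorm_ext0 (p : \bar R) n (v : 'I_n -> R) : (0 < p)%E -> (forall i, v i = 0) ->
  lnorm p v = 0.
Proof.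
move=> p0 v0; apply/eqP; rewrite eq_le lnorm_ge0 andbT.
have := @lnorm_const_le R p n v 0 p0 (lexx 0); rewrite mulr0; apply => i.
by rewrite v0 normr0.
Qed.

End ZeroExtension.

(** * Entropy numbers *)

Section EntropyNumbers.
Context {R : realType}.
Context (p q r u : \bar R).
Hypotheses (p0 : (0 < p)%E) (pr : (p <= r)%E) (q0 : (0 < q)%E) (qu : (q <= u)%E).

Let r0 : (0 < r)%E. Proof. exact: lt_le_trans pr. Qed.
Let u0 : (0 < u)%E. Proof. exact: lt_le_trans qu. Qed.

Definition is_net b d (m : nat) (eps : R) := exists y : 'I_m -> 'M[R]_(b, d),
  forall x, mixed_norm p q x <= 1 -> exists l, mixed_norm r u (x - y l) <= eps.

Lemma entropy_idE b d k : entropy_id p q r u b d k =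
  inf [set eps : R | 0 < eps /\ is_net b d (2 ^ (k - 1)) eps]%classic.
Proof.
rewrite /entropy_id /entropy_number; congr inf; apply/seteqP; split => eps /= [e0 [y hy]].
  split=> //; exists y => x hx.
  have [l _ [z hz <-]] := hy x (ex_intro2 _ _ x hx erefl); exists l.
  rewrite addrAC subrr add0r mixed_norm_scale // gtr0_norm //.
  by rewrite -[leRHS]mulr1 ler_wpM2l // ltW.
split=> //; exists y => _ [x hx <-] /=; have [l hl] := hy x hx; exists l => //.
exists (eps^-1 *: (x - y l)); last by rewrite scalerA mulfV ?gt_eqF // scale1r addrC subrK.
rewrite /unit_ball /= mixed_norm_scale // gtr0_norm ?invr_gt0 //.
by rewrite ler_pdivrMl // mulr1.
Qed.

Lemma is_net_leq b d m n eps : (m <= n)%N -> is_net b d m eps -> is_net b d n eps.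
Proof.
move=> mn [y hy]; exists (fun i => oapp y 0 (insub (nat_of_ord i))) => x hx.
have [l hl] := hy x hx; exists (widen_ord mn l) => /=.
by rewrite valK.
Qed.

Lemma is_net1 b d m : (0 < m)%N -> is_net b d m 1.
Proof.
move=> m0; apply: is_net_leq m0 _; exists (fun=> 0) => x hx; exists ord0.
by rewrite subr0; apply: le_trans hx; exact: mixed_norm_nested.
Qed.

Lemma entropy_le_net b d k m eps : 0 < eps -> (m <= 2 ^ (k - 1))%N -> is_net b d m eps ->
  entropy_id p q r u b d k <= eps.
Proof.
move=> e0 mk h; rewrite entropy_idE; apply: ge_inf.
  by exists 0 => x /= [/ltW].
by split=> //; apply: is_net_leq h.
Qed.

Lemma entropy_le1 b d k : entropy_id p q r u b d k <= 1.
Proof. by apply: (@entropy_le_net b d k 1); rewrite ?expn_gt0 //; exact: is_net1. Qed.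

Lemma entropy_ge b d k delta :
  (forall eps, 0 < eps -> is_net b d (2 ^ (k - 1)) eps -> delta <= eps) ->
  delta <= entropy_id p q r u b d k.
Proof.
move=> h; rewrite entropy_idE; apply: lb_le_inf; last by move=> e /= []; exact: h.
by exists 1; split => //; apply: is_net1; rewrite expn_gt0.
Qed.

Lemma entropy_ge0 b d k : 0 <= entropy_id p q r u b d k.
Proof. by apply: entropy_ge => eps /ltW. Qed.

Lemma entropy_anti_k b d k k' : (k <= k')%N ->
  entropy_id p q r u b d k' <= entropy_id p q r u b d k.
Proof.
move=> kk; apply: entropy_ge => eps e0 h; apply: entropy_le_net h => //.
by rewrite leq_exp2l // leq_sub2r.
Qed.

(** A small matrix padded with zeros keeps its norm, and cutting the centres of a net down to the
    block cannot increase distances. Thus one row, one column or a block of rows supplies lower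
    bounds for the full space. *)
Lemma entropy_submx b d b' d' k : (b' <= b)%N -> (d' <= d)%N ->
  entropy_id p q r u b' d' k <= entropy_id p q r u b d k.
Proof.
move=> bb dd; apply: entropy_ge => eps e0 [y hy].
apply: (@entropy_le_net _ _ _ (2 ^ (k - 1))) => //.
pose fb := widen_ord bb; pose fd := widen_ord dd.
have fbi : injective fb by move=> i j /(congr1 val) /= /val_inj.
have fdi : injective fd by move=> i j /(congr1 val) /= /val_inj.
exists (fun l => \matrix_(i, j) y l (fb i) (fd j)) => x hx.
pose X : 'M[R]_(b, d) := \matrix_(i, j)
  (if insub (nat_of_ord i) is Some i' then
   if insub (nat_of_ord j) is Some j' then x i' j' else 0 else 0).
have XE i j : X (fb i) (fd j) = x i j.
  by rewrite mxE /= !valK.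
have notin n m (h : (n <= m)%N) (j : 'I_m) : j \notin codom (widen_ord h) ->
    insub (nat_of_ord j) = None :> option 'I_n.
  move=> hj; case: insubP => //= j' _ ej; case/negP: hj; apply/codomP; exists j'.
  by apply: val_inj; rewrite /= ej.
have hX : mixed_norm p q X <= 1.
  apply: le_trans hx; apply: (@lnorm_extension R p _ _ fb) => //.
    move=> i; apply/eqP; rewrite eq_le; apply/andP; split.
      apply: (@lnorm_extension R q _ _ fd) => // j /notin jn.
      by rewrite mxE jn; case: insub.
    rewrite (_ : (fun j => x i j) = (fun j => X (fb i) (fd j))); last first.
      by apply/funext => j; rewrite XE.
    exact: (@lnorm_inj R q _ _ fd (fun j => X (fb i) j)).
  move=> i /notin ni; apply: lnorm_ext0 => // j; by rewrite mxE ni.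
have [l hl] := hy X hX; exists l; apply: le_trans hl.
apply: le_trans (_ : lnorm r (fun i => lnorm u (fun j => (X - y l) (fb i) j)) <= _); last first.
  exact: (@lnorm_inj R r _ _ fb (fun i => lnorm u (fun j => (X - y l) i j))).
apply: lnorm_mono => // i; rewrite !ger0_norm ?lnorm_ge0 //.
apply: le_trans (_ : lnorm u (fun j => (X - y l) (fb i) (fd j)) <= _); last first.
  exact: (@lnorm_inj R u _ _ fd (fun j => (X - y l) (fb i) j)).
apply: lnorm_mono => // j; by rewrite !mxE /= !valK.
Qed.

(* Each ball of the net meets the family in at most [V] points. *)
Lemma entropy_ge_family b d k (I : finType) (phi : I -> 'M[R]_(b, d)) (delta V : R) :
  0 <= V -> (forall i, mixed_norm p q (phi i) <= 1) ->
  (forall i, #|[pred j | mixed_norm r u (phi i - phi j) <= delta]|%:R <= V) ->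
  2 ^+ (k - 1) * V < #|I|%:R ->
  delta / quasi_const r u <= entropy_id p q r u b d k.
Proof.
move=> V0 h1 hV hI; have K1 := @quasi_const_ge1 R r u r0 u0.
have K0 : 0 < quasi_const r u by exact: lt_le_trans K1.
apply: entropy_ge => eps e0 [y hy]; rewrite leNgt; apply/negP => lte.
have /fin_all_exists [l hl] : forall i, exists l, mixed_norm r u (phi i - y l) <= eps.
  by move=> i; exact: hy.
have : #|I|%:R <= 2 ^+ (k - 1) * V; last by rewrite leNgt hI.
rewrite -natrX -(card_ord (2 ^ (k - 1))) mulr_natl -!sumr_const.
rewrite (partition_big l xpredT) //; apply: ler_sum => a _.
rewrite (eq_bigl [in [pred i | l i == a]]) // sumr_const;
    case: (pickP [pred i | l i == a]) => [i /= /eqP li|none].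
  apply: le_trans (hV i); rewrite ler_nat. apply: subset_leq_card; apply/fintype.subsetP => j.
  rewrite !inE => /eqP lj.
  apply: le_trans (_ : quasi_const r u * eps <= _); last first.
    by move: lte; rewrite ltr_pdivlMr // mulrC => /ltW.
  apply: (@mixed_norm_quasi R r u _ _ _ (phi i - y a) (phi j - y a)) => //.
  - move=> i' j'; rewrite !mxE.
    rewrite (_ : phi i i' j' - phi j i' j' = phi i i' j' - y a i' j' - (phi j i' j' - y a i' j')).
      exact: ler_normB.
    by ring.
  - by rewrite -li; exact: hl.
  - by rewrite -lj; exact: hl.
by rewrite (eq_card0 _) // => i; have := none i; rewrite !inE.
Qed.

End EntropyNumbers.

(** * Volumetric and packing lower bounds *)

Section LowerBounds.
Context {R : realType}.
Context (p q r u : \bar R).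
Hypotheses (p0 : (0 < p)%E) (pr : (p <= r)%E) (q0 : (0 < q)%E) (qu : (q <= u)%E).

Let r0 : (0 < r)%E. Proof. exact: lt_le_trans pr. Qed.
Let u0 : (0 < u)%E. Proof. exact: lt_le_trans qu. Qed.

Local Notation alpha := (recip p - recip r).
Local Notation beta := (recip q - recip u).

Lemma common_exponent (p1 q1 : \bar R) : (0 < p1)%E -> (0 < q1)%E ->
  exists s : R, [/\ 0 < s, (s%:E <= p1)%E & (s%:E <= q1)%E].
Proof.
case/exponentP => [[-> _]|[s s0 [-> _]]]; case/exponentP => [[-> _]|[t t0 [-> _]]].
- by exists 1; rewrite !leey.
- by exists t; rewrite leey.
- by exists s; rewrite leey.
- by exists (Num.min s t); rewrite !lee_fin lt_min s0 t0 !ge_min !lexx orbT.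
Qed.

(** The family is a grid of [(n + 1) ^ (b d)] points of a cube, scaled into the unit ball. At most
    [M ^ (b d)] of them lie close to any one, whatever [n], so [n] is taken just large enough that
    [n + 1] exceeds [M * 2 ^ ((k - 1) / (b d))]. *)
Lemma volume_lower_bound : exists2 c : R, 0 < c & forall b d k : nat, (0 < b)%N -> (0 < d)%N ->
  c * (b%:R `^ (- alpha) * d%:R `^ (- beta) * 2 `^ (- ((k - 1)%:R / (b%:R * d%:R)))) <=
  entropy_id p q r u b d k.
Proof.
have [s [s0 sr su]] := common_exponent r0 u0.
have [C C1 hC] := @card_cube_le R s s0.
(* The 4 is the constant of [mixed_norm_sum_powR]. *)
set M := expR 4 * C.
have M1 : 1 <= M by rewrite -[leLHS]mulr1 ler_pM // -[leLHS]expR0 ler_expR.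
have K1 := @quasi_const_ge1 R r u r0 u0.
have K0 : 0 < quasi_const r u by exact: lt_le_trans K1.
have M0 : 0 < M by qlra.
exists (quasi_const r u * M)^-1 => [|b d k b0 d0]; first by rewrite invr_gt0 mulr_gt0.
set B := b%:R : R; set D := d%:R : R.
have B0 : 0 < B by rewrite ltr0n.
have D0 : 0 < D by rewrite ltr0n.
set y := 2 `^ ((k - 1)%:R / (B * D)).
have y1 : 1 <= y by apply: powR_ge1; rewrite ?ler1n // divr_ge0 // mulr_ge0 // ltW.
have My1 : 1 <= M * y by rewrite -[leLHS]mulr1 ler_pM.
set n := Num.truncn (M * y).
have /andP[nle nlt] : n%:R <= M * y < n.+1%:R by apply: truncn_itv; qlra.
have n0 : (0 < n)%N by rewrite truncn_gt0.
have n0R : 0 < n%:R :> R by rewrite ltr0n.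
set I := ('I_b * 'I_d)%type.
have cI : #|{: I}|%:R = B * D by rewrite card_prod !card_ord natrM.
set cc := B `^ (- recip p) * D `^ (- recip q).
have cc0 : 0 < cc by rewrite mulr_gt0 ?powR_gt0.
set T := B `^ recip r * D `^ recip u.
have T0 : 0 < T by rewrite mulr_gt0 ?powR_gt0.
pose phi (f : {ffun I -> 'I_n.+1}) : 'M[R]_(b, d) := \matrix_(i, j) (cc / n%:R * (f (i, j))%:R).
have key := @entropy_ge_family R p q r u p0 pr q0 qu b d k _ phi (T * cc / n%:R)
  (M `^ #|{: I}|%:R).
apply: le_trans (key _ _ _ _).
- have -> : B `^ (- alpha) * D `^ (- beta) = T * cc.
    by rewrite /T /cc mulrACA -!powRDg // !opprB.
  rewrite powRN -/y.
  have -> : (quasi_const r u * M)^-1 * (T * cc * y^-1) = T * cc / quasi_const r u * (M * y)^-1.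
    by field; rewrite !gt_eqF // (lt_le_trans _ y1).
  have -> : T * cc / n%:R / quasi_const r u = T * cc / quasi_const r u * n%:R^-1.
    by field; rewrite !gt_eqF.
  apply: ler_wpM2l; first by apply: divr_ge0 (ltW K0); exact: ltW (mulr_gt0 T0 cc0).
  have My0 : 0 < M * y by qlra.
  by rewrite lef_pV2.
- exact: powR_ge0.
- move=> f; apply: le_trans (_ : B `^ recip p * D `^ recip q * cc <= _).
    apply: mixed_norm_const_le => // [|i j]; first exact: ltW.
    rewrite mxE ger0_norm; last by rewrite mulr_ge0 // divr_ge0 // ltW.
    rewrite -mulrA ler_piMr ?(ltW cc0) // ler_pdivrMl // mulr1 ler_nat.
    by rewrite -ltnS.
  by rewrite /cc mulrACA -!powRDg // !subrr !powRr0 mulr1.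
- move=> f; apply: le_trans (hC I n f 4 (ler0n _ _)).
  rewrite ler_nat; apply: subset_leq_card; apply/fintype.subsetP => g.
  rewrite !inE => h.
  have hn : mixed_norm r u ((n%:R / cc) *: (phi f - phi g)) <= T.
    rewrite mixed_norm_scale // ger0_norm ?divr_ge0 ?(ltW cc0) //.
    rewrite -ler_pdivlMl ?divr_gt0 // invf_div mulrC.
    by apply: le_trans h _; rewrite -mulrA.
  have := mixed_norm_sum_powR d0 s0 sr su hn.
  rewrite cI -/B -/D mulrA; apply: le_trans.
  rewrite pair_bigA /=; apply: ler_sum => -[i j] _ /=; rewrite !mxE.
  rewrite distrC -mulrBr mulrA.
  have -> : n%:R / cc * (cc / n%:R) = 1 by field; rewrite !gt_eqF.
  by rewrite mul1r.
- rewrite card_ffun natrX card_ord cI card_prod !card_ord.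
  rewrite -[X in _ < X]powR_mulrn // natrM -/B -/D.
  apply: le_lt_trans (_ : (M * y) `^ (B * D) < _).
    rewrite powRM ?(ltW M0) //; last by qlra.
    rewrite mulrC -powRrM divfK ?powR_mulrn //.
    by rewrite mulf_neq0 // gt_eqF.
  apply: gt0_ltr_powR; rewrite ?nnegrE ?mulr_gt0 //; qlra.
Qed.

(* The word [w] stands for the 0-1 matrix whose ones are the entries
   [(rw i j (w (i, j)), cl i j (w (i, j)))]; its row [i] must be the same for all [j]. *)
Lemma packing_lower_bound : exists2 c : R, 0 < c &
  forall (b d k N m : nat) (J : finType)
    (rw : 'I_N -> 'I_m -> J -> 'I_b) (cl : 'I_N -> 'I_m -> J -> 'I_d),
  (0 < k)%N -> (0 < N)%N -> (0 < m)%N -> (0 < #|J|)%N ->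
  (forall i j l i' j' l', rw i j l = rw i' j' l' -> i = i') ->
  (forall i j j' l l', j != j' -> rw i j l = rw i j' l') ->
  (forall i j j' l l', rw i j l = rw i j' l' -> cl i j l = cl i j' l' -> j = j' /\ l = l') ->
  k%:R + N%:R * m%:R <= N%:R * m%:R / 2 * ln (#|J|%:R : R) ->
  c * (N%:R `^ (- alpha) * m%:R `^ (- beta)) <= entropy_id p q r u b d k.
Proof.
have [s [s0 sr su]] := common_exponent r0 u0.
have K1 := @quasi_const_ge1 R r u r0 u0.
have K0 : 0 < quasi_const r u by exact: lt_le_trans K1.
(* By [mixed_norm_sum_powR] close words disagree in at most [eta ^ s * 4 * N * m = N * m / 2]
   places, the radius of [card_hamming_le]. *)
set eta := (8^-1 : R) `^ s^-1.
have eta0 : 0 < eta by rewrite powR_gt0 // invr_gt0.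
exists (eta / quasi_const r u) => [|b d k N m J rw cl k0 N0 m0 J0 rw_i rw_j rwcl hk];
    first by rewrite divr_gt0.
case: N N0 rw cl rw_i rw_j rwcl hk => // N0' _; set N := N0'.+1 => rw cl rw_i rw_j rwcl hk.
case: m m0 rw cl rw_i rw_j rwcl hk => // m0' _; set m := m0'.+1 => rw cl rw_i rw_j rwcl hk.
have NR : 0 < N%:R :> R by rewrite ltr0n.
have mR : 0 < m%:R :> R by rewrite ltr0n.
set I := ('I_N * 'I_m)%type.
have cI : #|{: I}| = (N * m)%N by rewrite card_prod !card_ord.
pose x (w : {ffun I -> J}) : 'M[R]_(b, d) := \matrix_(a, c)
  [exists ij : I, (rw ij.1 ij.2 (w ij) == a) && (cl ij.1 ij.2 (w ij) == c)]%:R.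
pose rho (w : {ffun I -> J}) i := rw i ord0 (w (i, ord0)).
have rhoE (w : {ffun I -> J}) i j : rw i j (w (i, j)) = rho w i.
  by have [->//|j0] := eqVneq j ord0; exact: rw_j.
have rho_inj w : injective (rho w) by move=> i i' /rw_i.
pose kap (w : {ffun I -> J}) i j := cl i j (w (i, j)).
have kap_inj w i : injective (kap w i).
  by move=> j j' h; have [] := rwcl i j j' (w (i, j)) (w (i, j')) _ h; rewrite ?rhoE.
have xP (w : {ffun I -> J}) a c : reflect (exists i, exists2 j, rho w i = a & kap w i j = c)
    [exists ij : I, (rw ij.1 ij.2 (w ij) == a) && (cl ij.1 ij.2 (w ij) == c)].
  apply: (iffP existsP) => [[[i j] /= /andP[/eqP h1 /eqP h2]]|[i [j h1 h2]]].
    by exists i, j => //; rewrite -h1 rhoE.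
  by exists (i, j) => /=; rewrite rhoE h1 eqxx; apply/eqP.
have sum_ind (n n' : nat) (f : 'I_n -> 'I_n') : \sum_a [exists i, f i == a]%:R <= n%:R :> R.
  rewrite -natr_sum ler_nat -[X in (_ <= X)%N]card_ord -(size_codom f).
  apply: leq_trans (_ : #|codom f| <= _)%N; last exact: card_size.
  rewrite -sum1_card [X in (_ <= X)%N]big_mkcond; apply: leq_sum => a _.
  case: existsP => // -[i /eqP <-]; by rewrite codom_f.
have x_norm w : mixed_norm p q (x w) <= N%:R `^ recip p * m%:R `^ recip q.
  apply: (@lnorm_le_weights R p b _ (fun a => [exists i, rho w i == a]%:R)) => //.
  move=> a; rewrite ger0_norm ?lnorm_ge0 //; case: existsP => [[i /eqP ia]|none].
    rewrite powR1 mul1r -[leRHS]mulr1.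
    apply: (@lnorm_le_weights R q d _ (fun c => [exists j, kap w i j == c]%:R)) => //.
    move=> c; rewrite mulr1 mxE; case: (xP) => [[i' [j h1 h2]]|_] /=; last first.
      by rewrite normr0 powR_ge0.
    have ei : i' = i by apply: (rho_inj w); rewrite h1.
    rewrite normr1; case: existsP => [_|[]]; first by rewrite powR1.
    by exists j; rewrite -ei h2.
  rewrite lnorm_ext0 ?mulr_ge0 ?powR_ge0 // => c; rewrite mxE.
  by case: (xP) => // -[i [j h1 _]]; case: none; exists i; rewrite h1.
pose cc := N%:R `^ (- recip p) * m%:R `^ (- recip q) : R.
have cc0 : 0 < cc by rewrite mulr_gt0 ?powR_gt0.
pose T := N%:R `^ recip r * m%:R `^ recip u : R.
have T0 : 0 < T by rewrite mulr_gt0 ?powR_gt0.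
pose V := expR (ln #|J|%:R * (#|{: I}|%:R / 2)) * 2 ^+ #|{: I}| : R.
have key := @entropy_ge_family R p q r u p0 pr q0 qu b d k _ (fun w => cc *: x w) (eta * T * cc) V.
apply: le_trans (key _ _ _ _).
- rewrite le_eqVlt; apply/orP; left; apply/eqP.
  have -> : N%:R `^ (- alpha) * m%:R `^ (- beta) = T * cc.
    by rewrite /T /cc mulrACA -!powRDg // !opprB.
  by field; rewrite gt_eqF.
- by rewrite mulr_ge0 ?expR_ge0.
- move=> w; rewrite mixed_norm_scale // ger0_norm ?(ltW cc0) //.
  apply: le_trans (ler_wpM2l (ltW cc0) (x_norm w)) _.
  by rewrite /cc mulrACA -!powRDg // !addNr !powRr0 mulr1.
- move=> w; apply: le_trans (card_hamming_le w J0).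
  rewrite ler_nat; apply: subset_leq_card; apply/fintype.subsetP => w'.
  rewrite !inE -scalerBr mixed_norm_scale // ger0_norm ?(ltW cc0) // mulrC.
  rewrite ler_pM2r // => h.
  (* At a disagreement, the one that [w] puts there meets a zero of [x w']. Hence [eta *: D] is
     dominated by a part of [x w - x w'], reindexed through the injections [rho w] and [kap w i]. *)
  pose D : 'M[R]_(N, m) := \matrix_(i, j) (eta^-1 * (w' (i, j) != w (i, j))%:R).
  have hD : mixed_norm r u D <= T.
    rewrite -(ler_pM2l eta0); apply: le_trans h.
    rewrite -[X in X * _]ger0_norm ?(ltW eta0) // -mixed_norm_scale //.
    apply: le_trans (_ : lnorm r (fun i => lnorm u (fun c => (x w - x w') (rho w i) c)) <= _);
        last first.
      exact: (@lnorm_inj R r _ _ (rho w) (fun a => lnorm u (fun c => (x w - x w') a c))).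
    apply: lnorm_mono => // i; rewrite !ger0_norm ?lnorm_ge0 //.
    apply: le_trans (_ : lnorm u (fun j => (x w - x w') (rho w i) (kap w i j)) <= _); last first.
      exact: (@lnorm_inj R u _ _ (kap w i) (fun c => (x w - x w') (rho w i) c)).
    apply: lnorm_mono => // j; rewrite !mxE mulrA mulfV ?gt_eqF // mul1r.
    case: eqVneq => [_|ne]; first by rewrite normr0.
    case: (xP) => [_|[]]; last by exists i, j.
    case: (xP) => [[i' [j' h1 h2]]|_]; last by rewrite subr0.
    exfalso; move: h1 h2; rewrite -(rhoE w' i' j') -(rhoE w i j) /kap => h1.
    have ei := rw_i _ _ _ _ _ _ h1; rewrite ei in h1 * => h2.
    have [ej el] := rwcl _ _ _ _ _ h1 h2.
    by case/negP: ne; rewrite -el ej.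
  have := mixed_norm_sum_powR (ltn0Sn _) s0 sr su hD.
  rewrite pair_bigA /= => hs.
  have eta_s : eta `^ s = 8^-1 by rewrite powRVK ?gt_eqF // invr_ge0.
  have e1 : \sum_(ij : I) ((w' ij != w ij)%:R : R) = 8^-1 * \sum_(ij : I) `|D ij.1 ij.2| `^ s.
    rewrite mulr_sumr; apply: eq_bigr => -[i j] _ /=; rewrite mxE.
    case: eqVneq => _ /=; first by rewrite mulr0 normr0 powR0 ?gt_eqF // mulr0.
    by rewrite mulr1 ger0_norm ?invr_ge0 ?(ltW eta0) // -eta_s -powRM ?invr_ge0 ?(ltW eta0) //
        mulfV ?gt_eqF // powR1.
  rewrite e1 cI natrM; apply: le_trans (ler_wpM2l _ hs) _; first by rewrite invr_ge0.
  by rewrite -/m; qlra.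
(* Both powers of two are bounded by powers of [e]; the strict inequality comes from [k - 1 < k]. *)
- rewrite card_ffun natrX cI.
  have J1 : 0 < #|J|%:R :> R by rewrite ltr0n.
  have two n : 2 ^+ n <= expR n%:R :> R.
    have e2 : 2 <= expR 1 :> R by apply: le_trans (expR_ge1Dx _); qlra.
    by rewrite -[n%:R]mul1r expRM_natr lerXn2r ?nnegrE ?expR_ge0.
  rewrite /V cI -[in ltRHS](lnK J1) -expRM_natr.
  apply: le_lt_trans (_ : expR (k - 1)%:R * (expR (ln #|J|%:R * ((N * m)%:R / 2)) *
    expR (N * m)%:R) < _).
    by apply: ler_pM => //; apply: ler_wpM2l => //; exact: expR_ge0.
  rewrite -!expRD ltr_expR natrM natrB //; qlra.
Qed.

(** The rows are cut into [N] blocks of [t]; a letter in ['I_t * 'I_d] picks a row of its block and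
    a column in it, so each block carries a single one. *)
Lemma packing_rows : exists2 c : R, 0 < c & forall b d k N t : nat,
  (0 < k)%N -> (0 < N)%N -> (0 < d)%N -> (0 < t)%N -> (N * t <= b)%N ->
  k%:R + N%:R <= N%:R / 2 * ln ((t * d)%:R : R) ->
  c * N%:R `^ (- alpha) <= entropy_id p q r u b d k.
Proof.
have [c c0 hc] := packing_lower_bound; exists c => // b d k N t k0 N0 d0 t0 Nt hk.
have lt_b (i : 'I_N) (l : 'I_t * 'I_d) : (i * t + l.1 < b)%N.
  apply: leq_trans Nt; apply: leq_trans (_ : i * t + t <= _)%N; first by rewrite ltn_add2l.
  by rewrite addnC -mulSn leq_mul2r ltn_ord orbT.
have := hc b d k N 1 ('I_t * 'I_d)%type (fun i _ l => Ordinal (lt_b i l)) (fun _ _ l => l.2).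
rewrite powR1 mulr1; apply => //.
- by rewrite card_prod !card_ord muln_gt0 t0.
- move=> i j l i' j' l' [] /(congr1 (divn^~ t)); rewrite !divnMDl // !divn_small // !addn0.
  exact: val_inj.
- by move=> i j j' l l'; rewrite !ord1 eqxx.
- move=> i j j' [l1 l2] [l1' l2'] [] /addnI /val_inj -> /= ->; split=> //.
  by rewrite !ord1.
- by rewrite card_prod !card_ord !mulr1.
Qed.

(** Every row is used, and its columns are cut into [m] blocks of [t]; a letter picks the position
    of the one in its block. *)
Lemma packing_columns : exists2 c : R, 0 < c & forall b d k m t : nat,
  (0 < k)%N -> (0 < b)%N -> (0 < m)%N -> (0 < t)%N -> (m * t <= d)%N ->
  k%:R + b%:R * m%:R <= b%:R * m%:R / 2 * ln (t%:R : R) ->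
  c * (b%:R `^ (- alpha) * m%:R `^ (- beta)) <= entropy_id p q r u b d k.
Proof.
have [c c0 hc] := packing_lower_bound; exists c => // b d k m t k0 b0 m0 t0 mt hk.
have lt_d (j : 'I_m) (l : 'I_t) : (j * t + l < d)%N.
  apply: leq_trans mt; apply: leq_trans (_ : j * t + t <= _)%N; first by rewrite ltn_add2l.
  by rewrite addnC -mulSn leq_mul2r ltn_ord orbT.
apply: (hc b d k b m 'I_t (fun i _ _ => i) (fun _ j l => Ordinal (lt_d j l))) => //.
- by rewrite card_ord.
- move=> i j j' l l' _ [] e; have := congr1 (divn^~ t) e.
  rewrite !divnMDl // !divn_small // !addn0 => /val_inj ej; split=> //.
  by move: e; rewrite ej => /addnI /val_inj.
- by rewrite card_ord.
Qed.

End LowerBounds.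

(** * Coverings *)

Section Coverings.
Context {R : realType}.

(* The choice [lam = ln (e + e n / m)] makes [n * exp (- lam)] at most [m]. *)
Lemma card_sparse_le (s : R) : 0 < s -> exists2 C : R, 1 <= C &
  forall (I : finType) (Z : nat) (m : R), 0 < m ->
  #|[pred f : {ffun I -> sint Z} | \sum_i `|sint_val (f i) : R| `^ s <= m]|%:R <=
  expR (C * m * ln (expR 1 + expR 1 * #|I|%:R / m)).
Proof.
move=> s0; have [C C0 hC] := @card_sint_le R s s0.
exists (1 + C) => [|I Z m m0]; first by rewrite lerDl ltW.
set w := expR 1 + expR 1 * #|I|%:R / m.
have e1 : 1 < expR 1 :> R by rewrite expR_gt1.
have q0 : 0 <= #|I|%:R / m by rewrite divr_ge0 // ltW.
have we : expR 1 <= w by rewrite lerDl -mulrA mulr_ge0 // expR_ge0.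
have w0 : 0 < w by qlra.
have l1 : 1 <= ln w by rewrite -[leLHS](expRK 1) ler_ln ?posrE ?expR_gt0.
apply: le_trans (hC I Z m (ln w) l1) _.
rewrite ler_expR expRN lnK //.
have h : #|I|%:R / w <= m.
  rewrite ler_pdivrMr // mulrDr.
  have -> : m * (expR 1 * #|I|%:R / m) = expR 1 * #|I|%:R by field; rewrite gt_eqF.
  have : 0 <= #|I|%:R :> R by [].
  qnra.
have -> : C * #|I|%:R / w = C * (#|I|%:R / w) by rewrite mulrA.
have h1 : C * (#|I|%:R / w) <= C * m by rewrite ler_wpM2l // ltW.
have h2 : C * m <= C * m * ln w by rewrite ler_peMr // mulr_ge0 // ltW.
qlra.
Qed.

Lemma sint_level_prf (N : nat) (a : nat) : (a <= N)%N -> exists j : sint N,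
  `|sint_val j : R| = a%:R.
Proof.
case: N => [|N]; case: a => [|a] // h; try by exists (inl tt); rewrite /= normr0.
by exists (inr (inord a, false)); rewrite /= expr0 mul1r inordK // ger0_norm.
Qed.

(** Levels are stored as signed integers with a redundant sign, so that [card_sparse_le] with
    exponent 1 also counts the level assignments. *)
Definition sint_level (N : nat) (j : sint N) : nat := if j is inr (z, _) then z.+1 else 0.

Lemma sint_levelE (N : nat) (j : sint N) : `|sint_val j : R| = (sint_level j)%:R.
Proof.
by case: j => [_|[z b]] /=; rewrite ?normr0 // normrM normrX normrN1 expr1n mul1r ger0_norm.
Qed.

Definition is_row_net (q u : \bar R) d (m : nat) (eps : R) := exists y : 'I_m -> 'I_d -> R,
  forall v, lnorm q v <= 1 -> exists l, lnorm u (fun j => v j - y l j) <= eps.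

Section Nets.
Context (p q r u : \bar R).
Hypotheses (p0 : (0 < p)%E) (pr : (p <= r)%E) (q0 : (0 < q)%E) (qu : (q <= u)%E).

Let r0 : (0 < r)%E. Proof. exact: lt_le_trans pr. Qed.
Let u0 : (0 < u)%E. Proof. exact: lt_le_trans qu. Qed.

Local Notation alpha := (recip p - recip r).
Local Notation beta := (recip q - recip u).

Lemma is_net_fin b d (T : finType) (y : T -> 'M[R]_(b, d)) eps :
  (forall x, mixed_norm p q x <= 1 -> exists t, mixed_norm r u (x - y t) <= eps) ->
  is_net p q r u b d #|T| eps.
Proof.
move=> h; exists (fun i => y (enum_val i)) => x /h[t ht].
by exists (enum_rank t); rewrite enum_rankK.
Qed.

Lemma is_row_net_fin d (T : finType) (y : T -> 'I_d -> R) eps :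
  (forall v, lnorm q v <= 1 -> exists t, lnorm u (fun j => v j - y t j) <= eps) ->
  is_row_net q u d #|T| eps.
Proof.
move=> h; exists (fun i => y (enum_val i)) => x /h[t ht].
by exists (enum_rank t); rewrite enum_rankK.
Qed.

Lemma unit_grid (n : nat) (x : R) : (0 < n)%N -> `|x| <= 1 -> exists l : 'I_n.+1,
  `|x - (2 * l%:R / n%:R - 1)| <= 2 / n%:R.
Proof.
move=> n0 x1; have nR : 0 < n%:R :> R by rewrite ltr0n.
have /andP[xl xr] : -1 <= x <= 1 by rewrite -ler_norml.
set t := Num.truncn (n%:R * (x + 1) / 2).
have t0 : 0 <= n%:R * (x + 1) / 2 by apply: divr_ge0 => //; qnra.
have /andP[lo hi] := truncn_itv t0; rewrite -/t -?[t.+1%:R]natr1 in lo hi.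
have hn : n%:R * (x + 1) <= n%:R * 2 by apply: ler_wpM2l; qlra.
have tn : (t < n.+1)%N by rewrite ltnS -(ler_nat R); qlra.
exists (Ordinal tn) => /=.
have -> : x - (2 * t%:R / n%:R - 1) = 2 / n%:R * (n%:R * (x + 1) / 2 - t%:R).
  by field; rewrite gt_eqF.
have c0 : 0 <= 2 / n%:R :> R by rewrite divr_ge0.
rewrite normrM ger0_norm // ler_piMr // ger0_norm; qlra.
Qed.

(* A coarse lattice reduces to a cube, which is subdivided into small cubes. *)
Lemma volume_covering : exists2 C : R, 1 <= C & forall (b d : nat) (delta : R),
  (0 < b)%N -> (0 < d)%N -> 0 < delta -> delta <= 1 ->
  exists2 m : nat, m%:R <= (C / delta) `^ (b%:R * d%:R) &
    is_net p q r u b d m (delta * (b%:R `^ (- alpha) * d%:R `^ (- beta))).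
Proof.
have [s [s0 sp sq]] := common_exponent p0 q0.
have [C C0 hC] := @card_sint_le R s s0.
have E1 : 1 <= expR (4 + C) by rewrite -[leLHS]expR0 ler_expR; qlra.
(* Per entry, [exp (4 + C)] accounts for the coarse lattice, counted with [lam = 1], and [4 / delta]
   for the [n + 1] fine positions. *)
exists (4 * expR (4 + C)) => [|b d delta b0 d0 dl0 dl1]; first by qlra.
set B := b%:R : R; set D := d%:R : R.
have B0 : 0 < B by rewrite ltr0n.
have D0 : 0 < D by rewrite ltr0n.
set I := ('I_b * 'I_d)%type.
have cI : #|{: I}|%:R = B * D by rewrite card_prod !card_ord natrM.
set cc := B `^ (- recip p) * D `^ (- recip q).
have cc0 : 0 < cc by rewrite mulr_gt0 ?powR_gt0.
have ccV : cc^-1 = B `^ recip p * D `^ recip q by rewrite /cc !powRN invfM !invrK.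
set Z := (Num.truncn cc^-1).+1.
have hZ : cc^-1 <= Z%:R by apply: ltW; exact: truncnS_gt.
set n := (Num.truncn (2 / delta)).+1.
have n0 : (0 < n)%N by [].
have nR : 0 < n%:R :> R by rewrite ltr0n.
have hn : 2 / delta <= n%:R by apply: ltW; exact: truncnS_gt.
pose P (f : {ffun I -> sint Z}) := \sum_i `|sint_val (f i) : R| `^ s <= 4 * (B * D).
pose T := ({f : {ffun I -> sint Z} | P f} * {ffun I -> 'I_n.+1})%type.
pose y (t : T) : 'M[R]_(b, d) := \matrix_(i, j)
  (cc * (sint_val (val t.1 (i, j)) + (2 * (t.2 (i, j))%:R / n%:R - 1))).
exists #|{: T}|.
  rewrite card_prod natrM card_sig card_ffun natrX card_ord -[X in _ * X]powR_mulrn // cI.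
  have -> : 4 * expR (4 + C) / delta = expR (4 + C) * (4 / delta) by ring.
  rewrite powRM ?expR_ge0 //; last by rewrite divr_ge0 // ltW.
  have BD0 : 0 <= B * D by rewrite ltW // mulr_gt0.
  apply: ler_pM; rewrite ?powR_ge0 //.
    apply: le_trans (hC I Z _ 1 (lexx _)) _; rewrite mul1r cI -expRM ler_expR.
    have : expR (-1) <= 1 :> R by rewrite expR_le1; qlra.
    have : 0 <= C * (B * D) by rewrite mulr_ge0 // ltW.
    by qnra.
  apply: ler_powR_l => //.
  have h2 : n%:R <= 2 / delta + 1.
    by rewrite /n -natr1 lerD2r truncn_le divr_ge0 // ltW.
  have h3 : 2 <= 2 / delta by rewrite ler_pdivlMr //; qlra.
  have -> : 4 / delta = 2 / delta + 2 / delta by field; rewrite gt_eqF.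
  rewrite -natr1; qlra.
apply: (@is_net_fin b d _ y) => x hx.
set X := cc^-1 *: x.
have hX : mixed_norm p q X <= B `^ recip p * D `^ recip q.
  by rewrite mixed_norm_scale // ger0_norm ?invr_ge0 ?(ltW cc0) // -ccV ler_piMr ?invr_ge0 // ltW.
have hXs := mixed_norm_sum_powR d0 s0 sp sq hX.
have hXe i j : `|X i j| <= Z%:R.
  apply: le_trans hZ; rewrite ccV; apply: le_trans hX.
  apply: le_trans (_ : lnorm q (fun j => X i j) <= _); first exact: (lnorm_entry (fun j => X i j)).
  rewrite -[leLHS]ger0_norm ?lnorm_ge0 //.
  exact: (lnorm_entry (fun i => lnorm q (fun j => X i j))).
have /fin_all_exists[f hf] : forall ij : I, exists z : sint Z,
    `|X ij.1 ij.2 - sint_val z| <= 1 /\ `|sint_val z| <= `|X ij.1 ij.2|.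
  by move=> ij; have [z [z1 _ z2]] := sint_round (hXe ij.1 ij.2); exists z.
have /fin_all_exists[g hg] : forall ij : I, exists l : 'I_n.+1,
    `|X ij.1 ij.2 - sint_val (f ij) - (2 * l%:R / n%:R - 1)| <= 2 / n%:R.
  by move=> ij; apply: unit_grid => //; have [] := hf ij.
have Pf : P (finfun f).
  rewrite /P mulrA; apply: le_trans hXs; rewrite pair_bigA /=.
  apply: ler_sum => ij _; rewrite ffunE; apply: ler_powR_l => //; first exact: ltW.
  by have [] := hf ij.
exists (exist (fun f => is_true (P f)) _ Pf, finfun g) => /=.
have -> : delta * (B `^ (- alpha) * D `^ (- beta)) = B `^ recip r * D `^ recip u * (cc * delta).
  by rewrite [RHS]mulrA /cc [X in _ = X * _]mulrACA -!powRDg // !opprB mulrC.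
apply: mixed_norm_const_le => // [|i j]; first by rewrite mulr_ge0 // ltW.
rewrite !mxE !ffunE /=.
have -> : x i j - cc * (sint_val (f (i, j)) + (2 * (g (i, j))%:R / n%:R - 1)) =
   cc * (X i j - sint_val (f (i, j)) - (2 * (g (i, j))%:R / n%:R - 1)).
  by rewrite /X mxE; field; rewrite !gt_eqF.
rewrite normrM ger0_norm ?(ltW cc0) // ler_wpM2l ?(ltW cc0) //.
apply: le_trans (hg (i, j)) _; rewrite ler_pdivrMr // mulrC -ler_pdivrMr //.
Qed.

(** Here [s = q] and the step is [h = m ^ (- 1 / s)], so [v / h] has [s]-th powers of total at most
    [m] and [card_sparse_le] applies. The error of an entry is at most [h] and at most [|v j|],
    hence at most [(|v j| ^ s) ^ recip u * h ^ (1 - s * recip u)]; the last factor is [m ^ - beta],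
    and the first is summed by weights. *)
Lemma sparse_row_covering : 0 < recip q -> exists2 C : R, 1 <= C & forall (d : nat) (m : R), 0 <
    m ->
  exists2 n : nat, n%:R <= expR (C * m * ln (expR 1 + expR 1 * d%:R / m)) &
    is_row_net q u d n (m `^ (- beta)).
Proof.
move=> rq0; have [s s0 [qs rq]] := recip_gt0_fin q0 rq0.
have [C C1 hC] := card_sparse_le s0.
exists C => // d m m0.
set h := m `^ (- s^-1).
have h0 : 0 < h by rewrite powR_gt0.
have hs : h `^ s = m^-1.
  by rewrite /h powRN -powR_inv1 ?powR_ge0 // powRAC powRVK ?gt_eqF ?powR_inv1 ?ltW.
set Z := (Num.truncn h^-1).+1.
have hZ : h^-1 <= Z%:R by apply: ltW; exact: truncnS_gt.
pose P (f : {ffun 'I_d -> sint Z}) := \sum_i `|sint_val (f i) : R| `^ s <= m.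
exists #|{: {f : {ffun 'I_d -> sint Z} | P f}}|.
  by rewrite card_sig -[in leRHS](card_ord d); exact: hC.
pose y (f : {f : {ffun 'I_d -> sint Z} | P f}) j : R := h * sint_val (val f j).
apply: (@is_row_net_fin d _ y) => v hv.
have hvs : \sum_i `|v i| `^ s <= 1.
  by have := hv; rewrite qs => /(lnorm_fin_le s0); rewrite powR1.
have /fin_all_exists[f hf] : forall j, exists z : sint Z,
    [/\ `|v j / h - sint_val z| <= 1, `|v j / h - sint_val z| <= `|v j / h| &
     `|sint_val z| <= `|v j / h|].
  move=> j; apply: sint_round; apply: le_trans hZ.
  rewrite normrM normfV (ger0_norm (ltW h0)) ler_piMl ?invr_ge0 ?(ltW h0) //.
  by apply: le_trans hv; exact: lnorm_entry.
have Pf : P (finfun f).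
  rewrite /P; apply: le_trans (_ : \sum_i `|v i| `^ s * m <= _); last first.
    by rewrite -mulr_suml ler_piMl // ltW.
  apply: ler_sum => j _; rewrite ffunE; have [_ _ hj] := hf j.
  apply: le_trans (ler_powR_l (ltW s0) (normr_ge0 _) hj) _.
  rewrite normrM powRM // normfV (ger0_norm (ltW h0)).
  by rewrite -[h^-1]powR_inv1 ?(ltW h0) // powRAC hs powR_inv1 ?invr_ge0 ?invrK // ltW.
exists (exist (fun f => is_true (P f)) _ Pf).
have := @lnorm_le_weights R u d (fun j => v j - h * sint_val (f j))
  (fun j => `|v j| `^ s) (m `^ (- beta)) 1 u0 (powR_ge0 _ _) (fun j => powR_ge0 _ _) hvs.
rewrite powR1 mul1r => H.
rewrite (_ : (fun j => _) = (fun j => v j - h * sint_val (f j))); last first.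
  by apply/funext => j; rewrite /y /= ffunE.
apply: H => j; have [z1 z2 _] := hf j.
set e := v j - _.
have ee : e = h * (v j / h - sint_val (f j)) by rewrite /e; field; rewrite gt_eqF.
have e1 : `|e| <= h by rewrite ee normrM ger0_norm ?(ltW h0) // ler_piMr // ltW.
have e2 : `|e| <= `|v j|.
  rewrite ee normrM ger0_norm ?(ltW h0) //; apply: le_trans (ler_wpM2l (ltW h0) z2) _.
  by rewrite normrM normfV (ger0_norm (ltW h0)) mulrCA mulfV ?gt_eqF // mulr1.
have [->|en0] := eqVneq e 0; first by rewrite normr0 mulr_ge0 ?powR_ge0.
have ep : 0 < `|e| by rewrite normr_gt0.
have ru0 := recip_ge0 u0.
have hru : s * recip u <= 1.
  by have := recip_le q0 qu; rewrite rq -ler_pdivlMl // mulr1.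
rewrite -[leLHS](powRr1 (ltW ep)) -{1}(subrK (s * recip u) 1) addrC powRDg // -powRrM.
apply: ler_pM; rewrite ?powR_ge0 //.
  by apply: ler_powR_l => //; rewrite mulr_ge0 // ltW.
apply: le_trans (ler_powR_l _ (ltW ep) e1) _; first by rewrite subr_ge0.
rewrite /h -powRrM rq le_eqVlt; apply/orP; left; apply/eqP; congr (_ `^ _).
by field; rewrite gt_eqF.
Qed.

(** This is [volume_covering] for a matrix with a single row, where the outer norm is the absolute
    value. *)
Lemma dense_row_covering : exists2 C : R, 1 <= C & forall (d : nat) (delta : R),
  (0 < d)%N -> 0 < delta -> delta <= 1 ->
  exists2 n : nat, n%:R <= (C / delta) `^ d%:R &
    is_row_net q u d n (delta * d%:R `^ (- beta)).
Proof.
have [C C1 hC] := volume_covering; exists C => // d delta d0 e0 e1.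
have [m hm [y hy]] := hC 1 d delta (ltn0Sn _) d0 e0 e1.
exists m; first by rewrite mul1r in hm.
exists (fun l j => y l ord0 j) => v hv.
have single (p1 : \bar R) (w : 'I_1 -> R) : (0 < p1)%E -> lnorm p1 w = `|w ord0|.
  move=> p10; apply/eqP; rewrite eq_le lnorm_entry // andbT.
  have := @lnorm_const_le R p1 1 w `|w ord0| p10 (normr_ge0 _); rewrite powR1 mul1r; apply.
  by move=> i; rewrite ord1.
have [|l hl] := hy (\row_j v j).
  rewrite /mixed_norm single // ger0_norm ?lnorm_ge0 //.
  by rewrite (_ : (fun j => _) = v) //; apply/funext => j; rewrite mxE.
exists l; move: hl; rewrite powR1 mul1r; apply: le_trans.
rewrite /mixed_norm single // ger0_norm ?lnorm_ge0 //.
by apply: lnorm_mono => // j; rewrite !mxE.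
Qed.

End Nets.
End Coverings.

(** * From row nets to a net of matrices *)

Section Combine.
Context {R : realType}.
Context (p q r u : \bar R).
Hypotheses (p0 : (0 < p)%E) (pr : (p <= r)%E) (q0 : (0 < q)%E) (qu : (q <= u)%E).

Let r0 : (0 < r)%E. Proof. exact: lt_le_trans pr. Qed.
Let u0 : (0 < u)%E. Proof. exact: lt_le_trans qu. Qed.

Local Notation alpha := (recip p - recip r).
Local Notation beta := (recip q - recip u).

Lemma card_dffun_ord (I : finType) (n : I -> nat) :
  #|{: {dffun forall i : I, 'I_(n i)}}| = (\prod_i n i)%N.
Proof.
rewrite card_dep_ffun /image_mem foldrE big_map big_enum /=.
by apply: eq_bigr => i _; rewrite card_ord.
Qed.

(* Every row is assigned a level; the number of level assignments of total at
   most [N] is only [expR (C N ln (e + e b / N))]. *)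
Lemma covering_of_rows : exists2 C : R, 1 <= C &
  forall (b d N : nat) (lev : nat -> ('I_d -> R) -> Prop) (err : nat -> ('I_d -> R) -> R)
    (cost : nat -> R) (S eps : R), (0 < N)%N ->
  (forall v, (v <= N)%N -> exists2 m : nat, m%:R <= expR (cost v) &
     exists y : 'I_m -> 'I_d -> R, forall x, lev v x ->
     exists l, lnorm u (fun j => x j - y l j) <= err v x) ->
  (forall x : 'M[R]_(b, d), mixed_norm p q x <= 1 -> exists a : 'I_b -> nat,
     [/\ (\sum_i a i <= N)%N, forall i, lev (a i) (fun j => x i j) &
         lnorm r (fun i => err (a i) (fun j => x i j)) <= eps]) ->
  (forall a : 'I_b -> nat, (\sum_i a i <= N)%N -> \sum_i cost (a i) <= S) ->
  exists2 m : nat, m%:R <= expR (C * N%:R * ln (expR 1 + expR 1 * b%:R / N%:R) + S) &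
    is_net p q r u b d m eps.
Proof.
have [C C1 hC] := @card_sparse_le R 1 ltr01.
exists C => // b d N lev err cost S eps N0 hrow hx hcost.
have NR : 0 < N%:R :> R by rewrite ltr0n.
have /choice[my hmy] : forall v : nat, exists my : {m : nat & 'I_m -> 'I_d -> R},
    (v <= N)%N -> (projT1 my)%:R <= expR (cost v) /\ (forall x, lev v x ->
     exists l, lnorm u (fun j => x j - projT2 my l j) <= err v x).
  move=> v; case: (leqP v N) => [/hrow[m hm [y hy]]|_]; first by exists (existT _ m y).
  by exists (existT _ 0 (fun _ _ => 0)).
pose M v := projT1 (my v); pose Y v : 'I_(M v) -> 'I_d -> R := projT2 (my v).
pose lv (f : {ffun 'I_b -> sint N}) i := sint_level (f i).
pose P (f : {ffun 'I_b -> sint N}) := \sum_i `|sint_val (f i) : R| `^ 1 <= N%:R.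
have PE f : P f = (\sum_i lv f i <= N)%N.
  rewrite /P -(ler_nat R) natr_sum; congr (_ <= _); apply: eq_bigr => i _.
  by rewrite powRr1 // sint_levelE.
pose I := {f : {ffun 'I_b -> sint N} | P f}.
(* A centre is a level assignment together with one point from the net of each row. The nets depend
   on the levels, so the count is a sum over assignments of products of net sizes, each product at
   most [exp S]. *)
pose T := {f : I & {dffun forall i : 'I_b, 'I_(M (lv (val f) i))}}.
pose y (t : T) : 'M[R]_(b, d) := \matrix_(i, j) Y _ (tagged t i) j.
exists #|{: T}|.
  rewrite card_tagged sumnE big_map big_enum /= natr_sum.
  apply: le_trans (_ : \sum_(f : I) expR S <= _).
    apply: ler_sum => f _; rewrite card_dffun_ord natr_prod.
    have := valP f; rewrite -[_ (val f)]/(P (val f)) PE => hf.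
    apply: le_trans (_ : \prod_(i < b) expR (cost (lv (val f) i)) <= _).
      apply: ler_prod => i _; rewrite ler0n /=; apply: (hmy _ _).1.
      by apply: leq_trans hf; rewrite (bigD1 i) //= leq_addr.
    by rewrite -expR_sum ler_expR; exact: hcost.
  rewrite sumr_const -[leLHS]mulr_natl expRD ler_wpM2r ?expR_ge0 //.
  by rewrite card_sig; have := hC 'I_b N N%:R NR; rewrite card_ord.
apply: (@is_net_fin R p q r u b d _ y) => x /hx[a [aN hlev herr]].
have aleN i : (a i <= N)%N by apply: leq_trans aN; rewrite (bigD1 i) //= leq_addr.
have /fin_all_exists[f hf] : forall i, exists j : sint N, sint_level j = a i.
  move=> i; have [j hj] := @sint_level_prf R N (a i) (aleN i); exists j.
  by apply/eqP; rewrite -(eqr_nat R) -sint_levelE hj.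
have Pf : P (finfun f).
  by rewrite PE (eq_bigr a) // => i _; rewrite /lv ffunE hf.
have lvE i : lv (finfun f) i = a i by rewrite /lv ffunE hf.
have : forall i, exists l : 'I_(M (lv (finfun f) i)),
    lnorm u (fun j => x i j - Y _ l j) <= err (a i) (fun j => x i j).
  by move=> i; rewrite lvE; exact: (hmy _ (aleN i)).2 _ (hlev i).
move=> /fin_all_exists[g hg].
pose t : T := Tagged (fun f : I => {dffun forall i : 'I_b, 'I_(M (lv (val f) i))})
  (finfun g : {dffun forall i : 'I_b, 'I_(M (lv (val (exist (fun f => is_true (P f)) _ Pf : I))
      i))}).
exists t; apply: le_trans herr; apply: lnorm_mono => // i.
rewrite ger0_norm ?lnorm_ge0 //; apply: le_trans (_ : err (a i) (fun j => x i j) <= _);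
    last exact: ler_norm.
apply: le_trans (hg i); apply: lnorm_mono => // j; by rewrite !mxE /t /= ffunE.
Qed.

End Combine.

(** * Distribution of the norm over the levels *)

Section RowLevels.
Context {R : realType}.
Context (p q r u : \bar R).
Hypotheses (p0 : (0 < p)%E) (pr : (p <= r)%E) (q0 : (0 < q)%E) (qu : (q <= u)%E).

Let r0 : (0 < r)%E. Proof. exact: lt_le_trans pr. Qed.
Let u0 : (0 < u)%E. Proof. exact: lt_le_trans qu. Qed.

Local Notation alpha := (recip p - recip r).
Local Notation beta := (recip q - recip u).

Lemma row_net_scale d m eps (sigma : R) : 0 < sigma -> is_row_net q u d m eps ->
  exists y : 'I_m -> 'I_d -> R, forall x, lnorm q x <= sigma ->
  exists l, lnorm u (fun j => x j - y l j) <= sigma * eps.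
Proof.
move=> s0 [y hy]; exists (fun l j => sigma * y l j) => x hx.
have [|l hl] := hy (fun j => sigma^-1 * x j).
  by rewrite lnorm_scale // ger0_norm ?invr_ge0 ?(ltW s0) // ler_pdivrMl // mulr1.
exists l; rewrite (_ : (fun j => _) = (fun j => sigma * (sigma^-1 * x j - y l j))).
  by rewrite lnorm_scale // ger0_norm ?(ltW s0) // ler_wpM2l // ltW.
by apply/funext => j; rewrite mulrBr mulrA mulfV ?gt_eqF // mul1r.
Qed.

(* Rows whose [q]-norm is below [N `^ (- 1 / p)] are approximated by zero. *)
Lemma sparse_rows_covering : 0 < recip p -> exists2 C : R, 1 <= C &
  forall (b d N : nat) (kappa eps : R), (0 < N)%N -> 0 <= eps ->
  (forall v, (0 < v <= N)%N -> exists2 m : nat, m%:R <= expR (kappa * v%:R) &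
     is_row_net q u d m (eps * (v.+1%:R / N%:R) `^ (- alpha))) ->
  0 <= kappa -> N%:R `^ (- alpha) <= eps ->
  exists2 m : nat,
    m%:R <= expR (C * N%:R * ln (expR 1 + expR 1 * b%:R / N%:R) + kappa * N%:R) &
    is_net p q r u b d m (C * eps).
Proof.
move=> rp0; have [s s0 [ps rp]] := recip_gt0_fin p0 rp0.
have [C0 C01 hC0] := covering_of_rows p0 pr q0 qu.
set K := 3 `^ recip r : R.
have K0 : 0 <= K by exact: powR_ge0.
exists (C0 + K) => [|b d N kappa eps N0 eps0 hrow kap0 hN]; first by qlra.
have NR : 0 < N%:R :> R by rewrite ltr0n.
pose nrm (x : 'I_d -> R) := lnorm q x.
pose lev (v : nat) (x : 'I_d -> R) := v = Num.truncn (N%:R * nrm x `^ s).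
(* A level-0 row is replaced by zero with its own norm as error, so [err] must see the row. *)
pose err (v : nat) (x : 'I_d -> R) : R := if v == 0 then nrm x else
   (v.+1%:R / N%:R) `^ s^-1 * (eps * (v.+1%:R / N%:R) `^ (- alpha)).
have := hC0 b d N lev err (fun v => kappa * v%:R) (kappa * N%:R) (K * eps) N0.
have step1 v : (v <= N)%N -> exists2 m : nat, m%:R <= expR (kappa * v%:R) &
     exists y : 'I_m -> 'I_d -> R, forall x, lev v x ->
     exists l, lnorm u (fun j => x j - y l j) <= err v x.
  case: v => [_|v vN].
    exists 1%N; first by rewrite mulr0 expR0.
    exists (fun _ _ => 0) => x _; exists ord0.
    rewrite /err /= (_ : (fun j => _) = x); first exact: lnorm_nested.
    by apply/funext => j; rewrite subr0.
  have [m hm hy] := hrow v.+1 vN.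
  have s1 : 0 < v.+2%:R / N%:R :> R by rewrite divr_gt0.
  exists m => //; have [y hy'] := row_net_scale (powR_gt0 s^-1 s1) hy.
  exists y => x hx; apply: hy'.
  have x0 : 0 <= nrm x by exact: lnorm_ge0.
  rewrite -/(nrm x) -[leLHS](@powRK _ _ s) ?gt_eqF //.
  apply: ler_powR_l; rewrite ?invr_ge0 ?powR_ge0 ?(ltW s0) //.
  by rewrite ler_pdivlMr // mulrC hx ltW // truncnS_gt.
have step3 (a : 'I_b -> nat) : (\sum_i a i <= N)%N -> \sum_i kappa * (a i)%:R <= kappa * N%:R.
  by move=> h; rewrite -mulr_sumr ler_wpM2l // -natr_sum ler_nat.
move=> /(_ step1) H; have [] := H _ step3.
  move=> x hx; pose w i := nrm (fun j => x i j) `^ s.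
  have w0 i : 0 <= w i by exact: powR_ge0.
  have ws : \sum_i w i <= 1.
    have := hx; rewrite /mixed_norm ps => /(lnorm_fin_le s0); rewrite powR1.
    by under eq_bigr => i _ do rewrite ger0_norm ?lnorm_ge0 //.
  pose a i := Num.truncn (N%:R * w i).
  have aw i : (a i)%:R <= N%:R * w i by rewrite truncn_le mulr_ge0.
  have awS i : N%:R * w i < (a i).+1%:R by exact: truncnS_gt.
  have asum : \sum_i (a i)%:R <= N%:R :> R.
    apply: le_trans (ler_sum _ (fun i _ => aw i)) _; rewrite -mulr_sumr.
    by rewrite ler_piMr.
  exists a; split => //; first by rewrite -(ler_nat R) natr_sum.
  (* A row of level 0 is charged to its mass [w i], any other to [(a i + 1) / N <= 2 a i / N]. The
     weights add up to at most 3, the base in [K]. *)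
  apply: (@lnorm_le_weights R r b _ (fun i => w i + 2 * (a i)%:R / N%:R)) => //.
  - by move=> i; rewrite addr_ge0 // divr_ge0 // mulr_ge0.
  - rewrite big_split /= -mulr_suml -mulr_sumr.
    have : 2 * (\sum_i (a i)%:R) / N%:R <= 2 :> R.
      by rewrite -mulrA ler_piMr // ler_pdivrMr // mul1r.
    by qlra.
  move=> i; rewrite /err; case: eqP => [a0|/eqP an0].
    rewrite a0 mulr0 mul0r addr0 ger0_norm ?lnorm_ge0 //.
    have [n0|n0] := eqVneq (nrm (fun j => x i j)) 0; first by rewrite n0 mulr_ge0 ?powR_ge0.
    have np : 0 < nrm (fun j => x i j) by rewrite lt0r n0 lnorm_ge0.
    have wp : 0 < w i by rewrite powR_gt0.
    (* At level 0, [w i < 1 / N], so [w i ^ alpha] is at most [N ^ - alpha]; the factor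
       [w i ^ recip r] is left to the weights. *)
    have -> : nrm (fun j => x i j) = w i `^ recip r * w i `^ alpha.
      by rewrite -powRDg // addrC subrK rp powRK ?gt_eqF // lnorm_ge0.
    apply: ler_wpM2l; first exact: powR_ge0.
    apply: le_trans hN; rewrite (powRN_inv _ (ltW NR)).
    apply: ler_powR_l => //; first by rewrite subr_ge0; exact: recip_le.
    by have := awS i; rewrite a0 => /ltW; rewrite -ler_pdivlMl // mulr1.
  have an : (0 < a i)%N by rewrite lt0n.
  have s1 : 0 < (a i).+1%:R / N%:R :> R by rewrite divr_gt0.
  rewrite ger0_norm ?mulr_ge0 ?powR_ge0 // mulrCA mulrC ler_wpM2r //.
  rewrite -powRDg // -rp opprB addrC subrK.
  apply: ler_powR_l; rewrite ?(ltW s1) ?recip_ge0 //.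
  apply: le_trans (_ : 2 * (a i)%:R / N%:R <= _); last by rewrite lerDr.
  by rewrite ler_pM2r ?invr_gt0 // -natrM ler_nat mul2n -addnn -addn1 leq_add2l.
move=> m hm [y hy]; exists m.
  apply: le_trans hm _; rewrite ler_expR lerD2r; apply: ler_wpM2r; last by qnra.
  apply: ln_ge0.
  have e1 : 1 < expR 1 :> R by rewrite expR_gt1.
  have : 0 <= expR 1 * b%:R / N%:R :> R by rewrite divr_ge0 // mulr_ge0 // expR_ge0.
  by qlra.
exists y => x /hy[l hl]; exists l; apply: le_trans hl _.
by apply: ler_wpM2r => //; qlra.
Qed.

(** With [N = b] recording the levels costs only [O(b)] nats and every row, also one of level 0, can
    afford a net: the numbers [a i + 1] add up to at most [2 b]. For [p = +oo] all levels are 0, so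
    [recip p] may vanish. *)
Lemma dense_rows_covering : exists2 C : R, 1 <= C &
  forall (b d : nat) (kappa eps : R), (0 < b)%N -> 0 <= eps -> 0 <= kappa ->
  (forall v, (v <= b)%N -> exists2 m : nat, m%:R <= expR (kappa * v.+1%:R) &
     is_row_net q u d m (eps * (v.+1%:R / b%:R) `^ (- alpha))) ->
  exists2 m : nat, m%:R <= expR (C * b%:R + 2 * kappa * b%:R) &
    is_net p q r u b d m (C * eps).
Proof.
have [C0 C01 hC0] := covering_of_rows p0 pr q0 qu.
set K := 2 `^ recip r : R.
have K0 : 0 <= K by exact: powR_ge0.
set L := ln (expR 1 + expR 1) : R.
have e1 : 1 < expR 1 :> R by rewrite expR_gt1.
have L0 : 0 <= L by apply: ln_ge0; qlra.
exists (C0 + K + C0 * L) => [|b d kappa eps b0 eps0 kap0 hrow]; first by qnra.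
have bR : 0 < b%:R :> R by rewrite ltr0n.
pose lev (v : nat) (x : 'I_d -> R) := lnorm q x <= (v.+1%:R / b%:R) `^ recip p.
pose err (v : nat) (x : 'I_d -> R) : R :=
   (v.+1%:R / b%:R) `^ recip p * (eps * (v.+1%:R / b%:R) `^ (- alpha)).
have := hC0 b d b lev err (fun v => kappa * v.+1%:R) (2 * kappa * b%:R) (K * eps) b0.
have step1 v : (v <= b)%N -> exists2 m : nat, m%:R <= expR (kappa * v.+1%:R) &
     exists y : 'I_m -> 'I_d -> R, forall x, lev v x ->
     exists l, lnorm u (fun j => x j - y l j) <= err v x.
  move=> vb; have [m hm hy] := hrow v vb.
  have s1 : 0 < v.+1%:R / b%:R :> R by rewrite divr_gt0.
  by exists m => //; exact: row_net_scale (powR_gt0 _ s1) hy.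
have Sb (a : 'I_b -> nat) : (\sum_i a i <= b)%N -> \sum_i (a i).+1%:R <= 2 * b%:R :> R.
  move=> h; under eq_bigr => i _ do rewrite -natr1.
  rewrite big_split /= sumr_const card_ord mulr_natl mulr2n lerD2r.
  by rewrite -natr_sum ler_nat.
have step3 (a : 'I_b -> nat) : (\sum_i a i <= b)%N ->
    \sum_i kappa * (a i).+1%:R <= 2 * kappa * b%:R.
  by move=> /Sb h; rewrite -mulr_sumr [2 * kappa]mulrC -mulrA ler_wpM2l.
move=> /(_ step1) H; have [] := H _ step3.
  move=> x hx.
  have [a [asum ha]] : exists a : 'I_b -> nat, (\sum_i a i <= b)%N /\
      forall i, lev (a i) (fun j => x i j).
    case: (exponentP p0) => [[ep rp]|[s s0 [ep rp]]].
      exists (fun=> 0%N); split; first by rewrite big1.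
      move=> i; rewrite /lev rp powRr0; apply: le_trans hx.
      rewrite -[leLHS]ger0_norm ?lnorm_ge0 //.
      exact: (lnorm_entry (fun i => lnorm q (fun j => x i j))).
    pose w i := lnorm q (fun j => x i j) `^ s.
    have w0 i : 0 <= w i by exact: powR_ge0.
    have ws : \sum_i w i <= 1.
      have := hx; rewrite /mixed_norm ep => /(lnorm_fin_le s0); rewrite powR1.
      by under eq_bigr => i _ do rewrite ger0_norm ?lnorm_ge0 //.
    pose a i := Num.truncn (b%:R * w i).
    exists a; split.
      rewrite -(ler_nat R) natr_sum.
      apply: le_trans (_ : \sum_i b%:R * w i <= _).
        by apply: ler_sum => i _; rewrite truncn_le mulr_ge0.
      by rewrite -mulr_sumr ler_piMr.
    move=> i; rewrite /lev -[leLHS](@powRK _ _ s) ?lnorm_ge0 ?gt_eqF // rp.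
    apply: ler_powR_l; rewrite ?invr_ge0 ?powR_ge0 ?(ltW s0) //.
    by rewrite ler_pdivlMr // mulrC ltW // truncnS_gt.
  exists a; split => //.
  apply: (@lnorm_le_weights R r b _ (fun i => (a i).+1%:R / b%:R)) => //.
    by rewrite -mulr_suml ler_pdivrMr //; exact: Sb.
  move=> i; have s1 : 0 < (a i).+1%:R / b%:R :> R by rewrite divr_gt0.
  rewrite /err ger0_norm ?mulr_ge0 ?powR_ge0 // mulrCA mulrC ler_wpM2r //.
  by rewrite -powRDg // opprB addrC subrK.
move=> m hm [y hy]; exists m.
  apply: le_trans hm _; rewrite ler_expR lerD2r mulfK ?gt_eqF // -/L.
  by rewrite mulrAC; apply: ler_wpM2r => //; qlra.
exists y => x /hy[l hl]; exists l; apply: le_trans hl _.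
by apply: ler_wpM2r => //; qnra.
Qed.

End RowLevels.

(** * Estimates for logarithms and bit counts *)

Section Numerics.
Context {R : realType}.

Lemma expR1_gt2 : 2 <= expR 1 :> R.
Proof. by apply: le_trans (expR_ge1Dx _); qlra. Qed.

Lemma ln_le_ln (x y : R) : 0 < x -> x <= y -> ln x <= ln y.
Proof. by move=> x0 xy; rewrite ler_ln // posrE // (lt_le_trans x0). Qed.

Lemma lnMg (x y : R) : 0 < x -> 0 < y -> ln (x * y) = ln x + ln y.
Proof. by move=> x0 y0; rewrite lnM. Qed.

Lemma ln_expR1M (x : R) : 0 < x -> ln (expR 1 * x) = 1 + ln x.
Proof. by move=> x0; rewrite lnMg ?expR_gt0 // expRK. Qed.

Lemma ln2_bounds : 2^-1 <= (ln 2 : R) <= 1.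
Proof.
apply/andP; split; last by rewrite -[leRHS](expRK 1); apply: ln_le_ln; rewrite ?expR1_gt2.
have h := expR_ge1Dx (- 2^-1 : R).
have : ln (2^-1 : R) <= - 2^-1 by rewrite -[leRHS]expRK; apply: ln_le_ln; qlra.
by rewrite lnV ?posrE // lerN2.
Qed.

Lemma ln_e_ratio_ge1 (A k : R) : 0 < k -> k <= A -> 1 <= ln (expR 1 * A / k).
Proof.
move=> k0 kA; rewrite -mulrA ln_expR1M ?divr_gt0 //; last by qlra.
by rewrite lerDl ln_ge0 // ler_pdivlMr // mul1r.
Qed.

Lemma ln_sqrtE (x : R) : 0 < x -> ln x = 2 * ln (Num.sqrt x).
Proof.
move=> x0; have s0 : 0 < Num.sqrt x by rewrite sqrtr_gt0.
by rewrite mulr_natl -lnXn // sqr_sqrtr // ltW.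
Qed.

Lemma ln_le_2sqrt (x : R) : 0 < x -> ln x <= 2 * Num.sqrt x.
Proof.
move=> x0; have s0 : 0 < Num.sqrt x by rewrite sqrtr_gt0.
rewrite ln_sqrtE // ler_wpM2l // ltW //; exact: ln_sublinear.
Qed.

Lemma ln_le_half (x : R) : 0 < x -> ln x <= x / 2.
Proof.
move=> x0; have s0 : 0 < Num.sqrt x by rewrite sqrtr_gt0.
rewrite ln_sqrtE // -[X in _ <= X / 2](sqr_sqrtr (ltW x0)).
move: (Num.sqrt x) s0 => s s0.
have h : ln s <= s - 1.
  by have := @le_ln1Dx R (s - 1); rewrite (_ : 1 + (s - 1) = s); [apply; qlra|ring].
have : 0 <= (s - 2) ^+ 2 by exact: sqr_ge0.
rewrite !expr2; qnra.
Qed.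

Lemma le1_lnD (x : R) : 0 <= x -> 1 <= ln (expR 1 + x).
Proof.
by move=> x0; rewrite -[leLHS](expRK 1); apply: ln_le_ln; rewrite ?expR_gt0 // lerDl.
Qed.

(** With [rho = k / x], the logarithm on the left is at most [1 + ln (e A / k) + ln rho]. The first
    two terms times [x] are at most [2 k / C]; for the third, [ln rho <= 2 sqrt rho] is a small
    multiple of [rho] because [rho >= C]. It makes sparse nets affordable for [x] of order
    [k / ln (e A / k)]. *)
Lemma bit_budget (tau : R) : 0 < tau -> exists2 C : R, 2 <= C &
  forall A k x : R, 0 < k -> k <= A -> 0 < x -> x * C * ln (expR 1 * A / k) <= k ->
  x * ln (expR 1 + expR 1 * A / x) <= tau * k.
Proof.
move=> t0; set c := 2 + 4 / tau.
have q0 : 0 < 4 / tau by rewrite divr_gt0.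
have c2 : 2 <= c by rewrite lerDl ltW.
exists (c ^+ 2) => [|A k x k0 kA x0 hx]; first by rewrite expr2; qnra.
set L := ln _ in hx; have L1 : 1 <= L by exact: ln_e_ratio_ge1.
have A0 : 0 < A by qlra.
have c0 : 0 < c ^+ 2 by rewrite exprn_gt0 //; qlra.
have xck : x * c ^+ 2 <= k by apply: le_trans hx; rewrite ler_peMr // mulr_ge0 // ltW.
have xk : x <= k by apply: le_trans xck; rewrite ler_peMr ?(ltW x0) // expr2; qnra.
have xA : x <= A by qlra.
set rho := k / x; have rho0 : 0 < rho by rewrite divr_gt0.
have h1 : ln (expR 1 + expR 1 * A / x) <= 1 + L + ln rho.
  apply: le_trans (_ : ln (2 * (expR 1 * A / k * rho)) <= _).
    have e1 : 0 < expR 1 :> R by exact: expR_gt0.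
    apply: ln_le_ln; first by rewrite addr_gt0 // divr_gt0 // mulr_gt0.
    have -> : 2 * (expR 1 * A / k * rho) = expR 1 * (A / x) + expR 1 * (A / x).
      by rewrite /rho; field; rewrite !gt_eqF.
    by rewrite -mulrA lerD2r ler_peMr ?(ltW e1) // ler_pdivlMr // mul1r.
  have e2 : 0 < expR 1 * A / k by rewrite divr_gt0 // mulr_gt0 // expR_gt0.
  rewrite lnMg //; last exact: mulr_gt0.
  rewrite lnMg // -/L addrA !lerD2r.
  by case/andP: ln2_bounds.
have h2 : x * ln rho <= 2 * k / c.
  have sr : Num.sqrt rho <= rho / c.
    have crho : c ^+ 2 <= rho by rewrite ler_pdivlMr // mulrC.
    have cs : c <= Num.sqrt rho.
      rewrite -[leLHS]ger0_norm; last by qlra.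
      by rewrite -sqrtr_sqr ler_wsqrtr.
    rewrite ler_pdivlMr; last by qlra.
    rewrite -{2}(sqr_sqrtr (ltW rho0)) expr2 ler_wpM2l //; exact: sqrtr_ge0.
  apply: le_trans (ler_wpM2l (ltW x0) (ln_le_2sqrt rho0)) _.
  have -> : 2 * k / c = x * (2 * (rho / c)).
    by rewrite /rho; field; rewrite !gt_eqF //; qlra.
  by rewrite ler_wpM2l ?(ltW x0) // ler_wpM2l.
have h3 : x * (1 + L) <= 2 * k / c ^+ 2.
  rewrite ler_pdivlMr //; have h : x * c ^+ 2 * 1 <= x * c ^+ 2 * L.
    by rewrite ler_wpM2l // mulr_ge0 // ltW.
  by move: (c ^+ 2) hx h => cc hx h; qnra.
have h4 : 2 * k / c ^+ 2 <= k / c.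
  have -> : 2 * k / c ^+ 2 = k / c * (2 / c) by field; rewrite gt_eqF //; qlra.
  rewrite ler_piMr ?divr_ge0 ?(ltW k0) ?ler_pdivrMr ?mul1r //; qlra.
apply: le_trans (ler_wpM2l (ltW x0) h1) _; rewrite mulrDr.
apply: le_trans (lerD h3 h2) _; apply: le_trans (lerD h4 (lexx _)) _.
have -> : k / c + 2 * k / c = 3 / c * k by field; rewrite gt_eqF //; qlra.
rewrite ler_wpM2r ?(ltW k0) // ler_pdivrMr; last by qlra.
by rewrite /c mulrDr mulrCA mulfV ?gt_eqF // mulr1; qlra.
Qed.

Lemma powRN_le (a b x : R) : 0 <= x -> 0 < a -> a <= b -> b `^ (- x) <= a `^ (- x).
Proof.
move=> x0 a0 ab; have b0 : 0 < b by qlra.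
rewrite !powRN lef_pV2 ?posrE ?powR_gt0 //; apply: ler_powR_l => //; exact: ltW.
Qed.

Lemma powR_div (a b x : R) : 0 < a -> 0 < b -> (a / b) `^ x = a `^ x * b `^ (- x).
Proof.
move=> a0 b0; rewrite powRM ?invr_ge0 ?ltW //; congr (_ * _).
by rewrite -[b^-1]powR_inv1 ?ltW // -powRrM mulN1r.
Qed.

(** For [0 < k <= A] this solves [x ln (e A / x) = k] up to constants: it is the number of nonzero
    entries among [A] positions that about [k] bits can describe. *)
Definition log_scaled (k A : R) : R := k / ln (expR 1 * A / k).

Lemma trunc_ge_half (x : R) : 1 <= x -> x / 2 <= (Num.truncn x)%:R.
Proof.
move=> x1; have h := truncnS_gt x; rewrite -natr1 in h.
have : (1 : R) <= (Num.truncn x)%:R by rewrite ler1n truncn_gt0.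
qlra.
Qed.

End Numerics.

(** * Bounds in terms of [k / ln (e A / k)] *)

Section UpperBounds.
Context {R : realType}.
Context (p q r u : \bar R).
Hypotheses (p0 : (0 < p)%E) (pr : (p <= r)%E) (q0 : (0 < q)%E) (qu : (q <= u)%E).

Local Notation alpha := (recip p - recip r).
Local Notation beta := (recip q - recip u).
Local Notation ek := (entropy_id p q r u).

Let alpha0 : 0 <= alpha. Proof. by rewrite subr_ge0; exact: recip_le. Qed.
Let beta0 : 0 <= beta. Proof. by rewrite subr_ge0; exact: recip_le. Qed.

(** The quarter comes from [k - 1 >= k / 2] and [ln 2 >= 1 / 2], which give
    [2 ^ (k - 1) >= exp (k / 4)]. *)
Lemma entropy_le_expR b d k m (S eps : R) : (2 <= k)%N -> 0 < eps -> m%:R <= expR S ->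
  S <= k%:R / 4 -> is_net p q r u b d m eps -> ek b d k <= eps.
Proof.
move=> k2 e0 hm hS; apply: entropy_le_net => //.
rewrite -(ler_nat R) natrX; apply: le_trans hm _.
rewrite -[2%:R]lnK ?posrE // -expRM_natr ler_expR natrB; last by apply: ltnW.
have k2R : 2 <= k%:R :> R by rewrite ler_nat.
case/andP: (@ln2_bounds R) => l1 l2; qnra.
Qed.

Lemma is_row_net_mono d m (e1 e2 : R) : e1 <= e2 -> is_row_net q u d m e1 ->
  is_row_net q u d m e2.
Proof. by move=> e [y hy]; exists y => v /hy[l hl]; exists l; exact: le_trans e. Qed.

(** About [y / C1] levels are used, with [y] the scaled [k]. A row of level [v] gets the sparse net
    with parameter [v + 1], of radius [(v + 1) ^ - beta <= (v + 1) ^ - alpha]. The bound on [y]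
    ensures [N <= b], so [ln (e + e d)] is within the budget [ln (e + e b d / N)]. *)
Lemma upper_sparse : 0 < alpha -> alpha <= beta -> exists2 C0 : R, 2 <= C0 &
  forall C1 : R, C0 <= C1 -> exists2 C : R, 0 < C &
  forall b d k : nat, (0 < b)%N -> (0 < d)%N -> (0 < k)%N -> (k <= b * d)%N ->
  log_scaled k%:R (b%:R * d%:R) <= C1 * b%:R ->
  ek b d k <= C * log_scaled k%:R (b%:R * d%:R) `^ (- alpha).
Proof.
move=> al0 ab; have be0 : 0 < beta by qlra.
have rp0 : 0 < recip p.
  by have := recip_ge0 (lt_le_trans p0 pr); qlra.
have rq0 : 0 < recip q.
  by have := recip_ge0 (lt_le_trans q0 qu); qlra.
have [C2 C21 sparse] := sparse_rows_covering p0 pr q0 qu rp0.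
have [C3 C31 row] := sparse_row_covering q0 qu rq0.
set W := C2 + 2 * C3.
have W0 : 0 < W by rewrite /W; qlra.
have [C0 C02 bits] := @bit_budget R (W * 4)^-1 ltac:(rewrite invr_gt0; qlra).
exists C0 => // C1 C01.
exists (C2 * (2 * C1) `^ alpha) => [|b d k b0 d0 k0 kbd].
  by rewrite mulr_gt0 ?powR_gt0 //; qlra.
have BD : k%:R <= b%:R * d%:R :> R by rewrite -natrM ler_nat.
have kR : 0 < k%:R :> R by rewrite ltr0n.
have bR : 0 < b%:R :> R by rewrite ltr0n.
have d1 : 1 <= d%:R :> R by rewrite ler1n.
rewrite /log_scaled; set L := ln (expR 1 * (b%:R * d%:R) / k%:R); set y := _ / L => hy.
have L1 : 1 <= L by exact: ln_e_ratio_ge1.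
have y0 : 0 < y by rewrite divr_gt0 //; qlra.
have yL : y * L = k%:R by rewrite /y divfK // gt_eqF //; qlra.
clearbody y.
have C10 : 0 < C1 by qlra.
set N := Num.truncn (y / C1).
have yC0 : 0 <= y / C1 by rewrite divr_ge0 // ltW.
have goalE : C2 * (2 * C1) `^ alpha * y `^ (- alpha) = C2 * (y / (2 * C1)) `^ (- alpha).
  by rewrite powR_div // ?mulr_gt0 // opprK -mulrA [X in _ * X]mulrC.
rewrite goalE.
have y2 : 0 < y / (2 * C1) by rewrite divr_gt0 // mulr_gt0.
have [N0|N0] := posnP N.
  have yC : y / C1 < 1 by rewrite -[1]/(1%:R) -truncn_lt_nat // -/N N0.
  apply: le_trans (entropy_le1 p0 pr q0 qu b d k) _.
  rewrite -[leLHS]mul1r; apply: ler_pM => //.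
  have := @powRN_le R _ 1 _ alpha0 y2; rewrite powR1; apply.
  have -> : y / (2 * C1) = y / C1 / 2 by field; rewrite gt_eqF.
  qlra.
have Nhalf : y / C1 / 2 <= N%:R by apply: trunc_ge_half; rewrite -truncn_gt0.
have NR : 1 <= N%:R :> R by rewrite ler1n.
have NR0 : 0 < N%:R :> R by qlra.
have Ny : N%:R <= y / C1 by rewrite truncn_le.
clearbody N.
have NyC : N%:R * C1 <= y by rewrite -ler_pdivlMr.
have Nb : N%:R <= b%:R :> R by have := le_trans NyC hy; rewrite [C1 * _]mulrC ler_pM2r.
have NCL : N%:R * C1 * L <= k%:R by rewrite -yL ler_wpM2r //; qlra.
have NCL' : N%:R * C0 * L <= k%:R.
  by apply: le_trans NCL; rewrite ler_wpM2r ?ler_wpM2l //; qlra.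
have hb := bits _ _ _ kR BD NR0 NCL'.
clear bits hy; clearbody L.
have k2 : (2 <= k)%N.
  rewrite -(ler_nat R); apply: le_trans NCL; rewrite -mulrA.
  have : 2 <= C1 * L by qnra.
  qnra.
set eps := N%:R `^ (- alpha).
have eps0 : 0 < eps by rewrite powR_gt0.
(* The factor 2 comes from [v + 1 <= 2 v]. *)
set kap := 2 * C3 * ln (expR 1 + expR 1 * d%:R).
have e0 : 0 < expR 1 :> R by exact: expR_gt0.
have kap0 : 0 <= kap.
  rewrite mulr_ge0 //; first by qlra.
  have : 0 <= expR 1 * d%:R :> R by rewrite mulr_ge0 // ltW.
  by move/le1_lnD; qlra.
have [|m hm net] := sparse b d N kap eps N0 (ltW eps0) _ kap0 (lexx _).
  move=> v /andP[v0 vN].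
  have vR : 1 <= v%:R :> R by rewrite ler1n.
  have v1 : 0 < v.+1%:R :> R by [].
  have [n hn hrow] := row d v.+1%:R v1.
  exists n; last first.
    apply: is_row_net_mono hrow; rewrite /eps powR_div // opprK mulrCA -powRDg // addNr powRr0
        mulr1.
    by apply: ler_powR; rewrite ?ler1n // lerN2.
  apply: le_trans hn _; rewrite ler_expR /kap.
  have lnle : ln (expR 1 + expR 1 * d%:R / v.+1%:R) <= ln (expR 1 + expR 1 * d%:R : R).
    apply: ln_le_ln; first by rewrite addr_gt0 // divr_gt0 // mulr_gt0 //; qlra.
    rewrite lerD2l ler_pdivrMr // ler_peMr ?ler1n // mulr_ge0 // ltW //.
  have l0 : 0 <= ln (expR 1 + expR 1 * d%:R : R).
    by apply: ln_ge0; have := @expR1_gt2 R; qnra.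
  apply: le_trans (ler_wpM2l _ lnle) _; first by rewrite mulr_ge0 //; qlra.
  have -> : 2 * C3 * ln (expR 1 + expR 1 * d%:R) * v%:R = C3 * (2 * v%:R) * ln (expR 1 + expR 1
      * d%:R) by ring.
  rewrite ler_wpM2r // ler_wpM2l ?(le_trans _ C31) //.
  by rewrite -natr1; qlra.
apply: le_trans (_ : C2 * eps <= _); last first.
  rewrite ler_wpM2l //; first by qlra.
  apply: powRN_le => //.
  by have -> : y / (2 * C1) = y / C1 / 2 by field; rewrite gt_eqF.
apply: entropy_le_expR hm _ net => //; first by rewrite mulr_gt0 //; qlra.
set Q := ln (expR 1 + expR 1 * (b%:R * d%:R) / N%:R) in hb.
have q1 : ln (expR 1 + expR 1 * b%:R / N%:R) <= Q.
  apply: ln_le_ln; first by rewrite addr_gt0 // divr_gt0 // mulr_gt0.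
  by rewrite lerD2l ler_pM2r ?invr_gt0 // ler_pM2l // ler_peMr // ltW.
have q2 : ln (expR 1 + expR 1 * d%:R) <= Q.
  apply: ln_le_ln; first by rewrite addr_gt0 // mulr_gt0 //; qlra.
  rewrite lerD2l -mulrA ler_pM2l // ler_pdivlMr // mulrC ler_wpM2r //; qlra.
apply: le_trans (_ : W * (N%:R * Q) <= _); last first.
  apply: le_trans (ler_wpM2l (ltW W0) hb) _.
  rewrite le_eqVlt; apply/orP; left; apply/eqP; field; qlra.
rewrite /W /kap [leRHS]mulrDl; apply: lerD.
  by rewrite -mulrA ler_wpM2l ?ler_wpM2l //; qlra.
rewrite -!mulrA ler_wpM2l // ler_wpM2l //; first by qlra.
by rewrite mulrC ler_wpM2l // ltW.
Qed.

(** Now each row can afford [m0 = y / (C1 b) >= 1] entries on average, with [y] the scaled [k];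
    level [v] gets the sparse net with parameter [m0 (v + 1)]. Again [alpha <= beta] turns
    [(v + 1) ^ - beta] into the required [(v + 1) ^ - alpha]. *)
Lemma upper_dense : 0 < beta -> alpha <= beta -> exists2 C0 : R, 2 <= C0 &
  forall C1 : R, C0 <= C1 -> exists2 C : R, 0 < C &
  forall b d k : nat, (0 < b)%N -> (0 < d)%N -> (0 < k)%N -> (k <= b * d)%N ->
  C1 * b%:R <= log_scaled k%:R (b%:R * d%:R) ->
  ek b d k <= C * (b%:R `^ (- alpha) * (log_scaled k%:R (b%:R * d%:R) / b%:R) `^ (- beta)).
Proof.
move=> be0 ab.
have rq0 : 0 < recip q.
  by have := recip_ge0 (lt_le_trans q0 qu); qlra.
have [C2 C21 dense] := dense_rows_covering p0 pr q0 qu.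
have [C3 C31 row] := sparse_row_covering q0 qu rq0.
set W := C2 + 2 * C3.
have W0 : 0 < W by rewrite /W; qlra.
have [C0 C02 bits] := @bit_budget R (W * 4)^-1 ltac:(rewrite invr_gt0; qlra).
exists C0 => // C1 C01.
exists (C2 * C1 `^ beta) => [|b d k b0 d0 k0 kbd].
  by rewrite mulr_gt0 ?powR_gt0 //; qlra.
have BD : k%:R <= b%:R * d%:R :> R by rewrite -natrM ler_nat.
have kR : 0 < k%:R :> R by rewrite ltr0n.
have bR : 0 < b%:R :> R by rewrite ltr0n.
have b1 : 1 <= b%:R :> R by rewrite ler1n.
have d1 : 1 <= d%:R :> R by rewrite ler1n.
rewrite /log_scaled; set L := ln (expR 1 * (b%:R * d%:R) / k%:R); set y := _ / L => hy.
have L1 : 1 <= L by exact: ln_e_ratio_ge1.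
have y0 : 0 < y by rewrite divr_gt0 //; qlra.
have yL : y * L = k%:R by rewrite /y divfK // gt_eqF //; qlra.
clearbody y.
have C10 : 0 < C1 by qlra.
set m0 := y / C1 / b%:R.
have m0E : b%:R * m0 = y / C1 by rewrite /m0 mulrC divfK // gt_eqF.
have m01 : 1 <= m0 by rewrite ler_pdivlMr // mul1r ler_pdivlMr // mulrC.
have m00 : 0 < m0 by qlra.
have goalE : C2 * C1 `^ beta * (b%:R `^ (- alpha) * (y / b%:R) `^ (- beta)) =
    C2 * (b%:R `^ (- alpha) * m0 `^ (- beta)).
  have -> : m0 = y / b%:R / C1 by rewrite /m0 mulrAC.
  rewrite [in RHS]powR_div ?divr_gt0 // opprK; ring.
rewrite goalE; clearbody m0; set eps := b%:R `^ (- alpha) * m0 `^ (- beta).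
have eps0 : 0 < eps by rewrite mulr_gt0 // powR_gt0.
have e0 : 0 < expR 1 :> R by exact: expR_gt0.
set Q := ln (expR 1 + expR 1 * d%:R / m0).
have Q1 : 1 <= Q.
  by apply: le1_lnD; apply: divr_ge0; [apply: mulr_ge0 => //; exact: ltW|exact: ltW].
set kap := C3 * m0 * Q.
have kap0 : 0 <= kap by apply: mulr_ge0; [apply: mulr_ge0|]; qlra.
have [|m hm net] := dense b d kap eps b0 (ltW eps0) kap0.
  move=> v vb.
  have v1 : 0 < v.+1%:R :> R by [].
  have v11 : 1 <= v.+1%:R :> R by rewrite ler1n.
  have mv : 0 < m0 * v.+1%:R by rewrite mulr_gt0.
  have [n hn hrow] := row d (m0 * v.+1%:R) mv.
  exists n; last first.
    apply: is_row_net_mono hrow; rewrite /eps powR_div // opprK.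
    rewrite powRM ?(ltW m00) //.
    have -> : b%:R `^ (- alpha) * m0 `^ (- beta) * (v.+1%:R `^ (- alpha) * b%:R `^ alpha) =
      m0 `^ (- beta) * v.+1%:R `^ (- alpha) * (b%:R `^ (- alpha) * b%:R `^ alpha) by ring.
    rewrite -powRDg // addNr powRr0 mulr1 ler_wpM2l ?powR_ge0 //.
    by apply: ler_powR; rewrite ?lerN2.
  apply: le_trans hn _; rewrite ler_expR /kap.
  have lnle : ln (expR 1 + expR 1 * d%:R / (m0 * v.+1%:R)) <= Q.
    apply: ln_le_ln; first by rewrite addr_gt0 // divr_gt0 // mulr_gt0 //; qlra.
    rewrite lerD2l ler_pM2l; last by rewrite mulr_gt0 //; qlra.
    by rewrite lef_pV2 ?posrE // ler_peMr // ltW.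
  apply: le_trans (ler_wpM2l _ lnle) _; first by rewrite mulr_ge0 //; qlra.
  by rewrite le_eqVlt; apply/orP; left; apply/eqP; ring.
apply: entropy_le_expR hm _ net => //; last first.
- have yC0 : 0 < y / C1 by rewrite divr_gt0.
  have hb : y / C1 * ln (expR 1 + expR 1 * (b%:R * d%:R) / (y / C1)) <= (W * 4)^-1 * k%:R.
    apply: bits => //; rewrite -/L -yL; apply: ler_wpM2r; first by qlra.
    by rewrite mulrAC ler_pdivrMr // ler_wpM2l // ltW.
  rewrite -m0E in hb.
  have eQ : expR 1 * (b%:R * d%:R) / (b%:R * m0) = expR 1 * d%:R / m0.
    by field; rewrite !gt_eqF.
  rewrite eQ -/Q in hb.
  apply: le_trans (_ : W * (b%:R * m0 * Q) <= _); last first.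
    apply: le_trans (ler_wpM2l (ltW W0) hb) _.
    rewrite le_eqVlt; apply/orP; left; apply/eqP; field; qlra.
  rewrite /W /kap [leRHS]mulrDl; apply: lerD.
    apply: ler_wpM2l; first by qlra.
    by rewrite -mulrA ler_peMr ?(ltW bR) //; qnra.
  rewrite le_eqVlt; apply/orP; left; apply/eqP; ring.
- by rewrite mulr_gt0 //; qlra.
- rewrite -(ler_nat R) -yL.
  have : 2 <= y by qnra.
  qnra.
Qed.

(* The two regimes of case (ii) meet at [log_scaled k (b d) = b]. *)
Lemma upper_ii : alpha <= beta -> exists2 C : R, 0 < C &
  forall b d k : nat, (0 < b)%N -> (0 < d)%N -> (0 < k)%N -> (k <= b * d)%N ->
  let y := log_scaled k%:R (b%:R * d%:R) in
  (y <= b%:R -> ek b d k <= C * y `^ (- alpha)) /\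
  (b%:R <= y -> ek b d k <= C * (b%:R `^ (- alpha) * (y / b%:R) `^ (- beta))).
Proof.
move=> ab.
(* For [alpha = 0] the sparse bound is the trivial 1, and [recip p] may be 0, which [upper_sparse]
   excludes. *)
have [al00|aln0] := eqVneq alpha 0.
  have [be00|ben0] := eqVneq beta 0.
    exists 1 => // b d k b0 d0 k0 kbd y; rewrite al00 be00 !oppr0 !powRr0 !mulr1.
    by split=> _; exact: entropy_le1.
  have be1 : 0 < beta by rewrite lt0r ben0.
  have [C0 C02 H] := upper_dense be1 ab; have [C Cp hC] := H C0 (lexx _).
  exists (C + 1 + C0 `^ beta) => [|b d k b0 d0 k0 kbd y].
    by have := powR_ge0 C0 beta; qlra.
  have bR : 0 < b%:R :> R by rewrite ltr0n.
  have P0 := powR_ge0 C0 beta.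
  split.
    rewrite al00 oppr0 powRr0 mulr1 => _.
    by apply: le_trans (entropy_le1 p0 pr q0 qu b d k) _; qlra.
  move=> by_; have y0 : 0 < y by qlra.
  have X0 : 0 <= b%:R `^ (- alpha) * (y / b%:R) `^ (- beta) by rewrite mulr_ge0 ?powR_ge0.
  have [yC|yC] := leP (C0 * b%:R) y.
    apply: le_trans (hC b d k b0 d0 k0 kbd yC) _; rewrite -/y ler_wpM2r //; qlra.
  apply: le_trans (entropy_le1 p0 pr q0 qu b d k) _.
  apply: le_trans (_ : C0 `^ beta * (y / b%:R) `^ (- beta) <= _); last first.
    rewrite al00 oppr0 powRr0 mul1r ler_wpM2r ?powR_ge0 //; qlra.
  have h : C0 `^ (- beta) <= (y / b%:R) `^ (- beta).
    by apply: powRN_le => //; [exact: divr_gt0|rewrite ler_pdivrMr // ltW].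
  have := ler_wpM2l (powR_ge0 C0 beta) h; apply: le_trans.
  by rewrite -powRDg ?addrN ?powRr0 //; qlra.
have al1 : 0 < alpha by rewrite lt0r aln0.
have be1 : 0 < beta by qlra.
have [D0 D02 HD] := upper_dense be1 ab.
have [S0 S02 HS] := upper_sparse al1 ab.
set C0 := D0 + S0.
have [CD CDp hCD] := HD C0 ltac:(rewrite /C0; qlra).
have [CS CSp hCS] := HS C0 ltac:(rewrite /C0; qlra).
have P0 : 0 < C0 `^ beta by rewrite powR_gt0 // /C0; qlra.
exists (CD + CS + CS * C0 `^ beta) => [|b d k b0 d0 k0 kbd y].
  have : 0 < CS * C0 `^ beta by exact: mulr_gt0.
  by qlra.
have PS : 0 < CS * C0 `^ beta by rewrite mulr_gt0.
have bR : 0 < b%:R :> R by rewrite ltr0n.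
have C01 : 1 <= C0 by rewrite /C0; qlra.
split.
  move=> yb; apply: le_trans (hCS b d k b0 d0 k0 kbd _) _; last first.
    by rewrite -/y ler_wpM2r ?powR_ge0 //; qlra.
  by apply: le_trans yb _; rewrite ler_peMl // ltW.
move=> by_; have y0 : 0 < y by qlra.
have X0 : 0 <= b%:R `^ (- alpha) * (y / b%:R) `^ (- beta) by rewrite mulr_ge0 ?powR_ge0.
have [yC|yC] := leP (C0 * b%:R) y.
  apply: le_trans (hCD b d k b0 d0 k0 kbd yC) _; rewrite -/y ler_wpM2r //; qlra.
(* Just above the threshold the sparse bound is still available, and it exceeds the dense expression
   by a factor of at most [C0 ^ beta], apart from [CS]. *)
apply: le_trans (hCS b d k b0 d0 k0 kbd (ltW yC)) _; rewrite -/y.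
apply: le_trans (_ : CS * (C0 `^ beta * (b%:R `^ (- alpha) * (y / b%:R) `^ (- beta))) <= _);
    last first.
  by rewrite mulrA ler_wpM2r //; qlra.
rewrite ler_wpM2l ?(ltW CSp) //.
apply: le_trans (powRN_le alpha0 bR by_) _.
rewrite mulrCA ler_peMr ?powR_ge0 //.
have h : C0 `^ (- beta) <= (y / b%:R) `^ (- beta).
  by apply: powRN_le => //; [exact: divr_gt0|rewrite ler_pdivrMr // ltW].
have := ler_wpM2l (ltW P0) h; apply: le_trans.
by rewrite -powRDg ?addrN ?powRr0 //; qlra.
Qed.

(** Taking [delta = t ^ - alpha] costs only [d (ln C + alpha ln t)] nats; the weaker form linear in
    [t] is the one that sums over levels. *)
Lemma dense_row_covering_expR : exists2 C : R, 1 <= C & forall (d : nat) (t : R),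
  (0 < d)%N -> 1 <= t ->
  exists2 n : nat, n%:R <= expR (C * d%:R * t) &
    is_row_net q u d n (t `^ (- alpha) * d%:R `^ (- beta)).
Proof.
have [C C1 row] := dense_row_covering p0 pr q0 qu.
have lnC := ln_ge0 C1.
exists (ln C + alpha + 1) => [|d t d0 t1].
  by have := alpha0; qlra.
have t0 : 0 < t by qlra.
have dR : 0 < d%:R :> R by rewrite ltr0n.
have dl0 : 0 < t `^ (- alpha) by rewrite powR_gt0.
have dl1 : t `^ (- alpha) <= 1.
  by have := powRN_le alpha0 (ltr01 : 0 < 1 :> R) t1; rewrite powR1.
have [n hn net] := row d _ d0 dl0 dl1; exists n => //.
apply: le_trans hn _; rewrite powRE ?divr_gt0 //; last by qlra.
rewrite ler_expR -mulrA [leRHS]mulrCA ler_wpM2l ?(ltW dR) // powRN invrK.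
rewrite lnMg ?powR_gt0 //; last by qlra.
rewrite ln_powR; have h1 := ltW (ln_sublinear t0); have h2 := ln_ge0 t1.
have h3 : alpha * ln t <= alpha * t by rewrite ler_wpM2l.
have h4 : ln C <= ln C * t by rewrite ler_peMr.
qlra.
Qed.

(** With [g = alpha / beta > 1] the parameter [M w ^ g] gives the radius. For [w < 1] the logarithm
    grows by at most [g ln (1 / w)], and the spare factor [w ^ (g - 1)] absorbs it, since [w ^ (g -
    1) * g * ln (1 / w) <= g / (g - 1)]. *)
Lemma sparse_row_covering_expR : 0 < beta -> beta < alpha -> exists2 C : R, 1 <= C &
  forall (d : nat) (M w : R), 0 < M -> 0 < w -> w <= 2 ->
  exists2 n : nat, n%:R <= expR (C * w * (M * ln (expR 1 + expR 1 * d%:R / M))) &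
    is_row_net q u d n (M `^ (- beta) * w `^ (- alpha)).
Proof.
move=> be0 ab.
have rq0 : 0 < recip q.
  by have := recip_ge0 (lt_le_trans q0 qu); qlra.
have [C C1 row] := sparse_row_covering q0 qu rq0.
set g := alpha / beta.
have g1 : 1 < g by rewrite ltr_pdivlMr // mul1r.
have gb : g * beta = alpha by rewrite /g divfK // gt_eqF.
clearbody g.
have P0 : 0 < 2 `^ (g - 1) :> R by rewrite powR_gt0.
have G0 : 0 < g / (g - 1) by rewrite divr_gt0 // ?subr_gt0 //; qlra.
exists (C * (2 `^ (g - 1) + 1 + g / (g - 1))) => [|d M w M0 w0 w2]; first by qnra.
have e0 : 0 < expR 1 :> R by exact: expR_gt0.
have wg : 0 < w `^ g by rewrite powR_gt0.
have m0 : 0 < M * w `^ g by rewrite mulr_gt0.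
have [n hn net] := row d _ m0; exists n; last first.
  by move: net; rewrite powRM ?(ltW M0) ?powR_ge0 // -powRrM mulrN gb.
apply: le_trans hn _; rewrite ler_expR.
set Q := ln (expR 1 + expR 1 * d%:R / M).
have dM : 0 <= expR 1 * d%:R / M.
  by apply: divr_ge0; [apply: mulr_ge0 => //; exact: ltW|exact: ltW].
have Q1 : 1 <= Q by exact: le1_lnD.
have -> : C * (2 `^ (g - 1) + 1 + g / (g - 1)) * w * (M * Q) =
  C * M * w * ((2 `^ (g - 1) + 1 + g / (g - 1)) * Q) by ring.
have -> : w `^ g = w * w `^ (g - 1).
  by rewrite -{2}[w]powRr1 ?(ltW w0) // -powRDg // addrC subrK.
have wg0 : 0 < w `^ (g - 1) by rewrite powR_gt0.
set Q' := ln _.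
have -> : C * (M * (w * w `^ (g - 1))) * Q' = C * M * w * (w `^ (g - 1) * Q') by ring.
apply: ler_wpM2l; first by rewrite !mulr_ge0 // ?ltW //; qlra.
have QE : Q' = ln (expR 1 + expR 1 * d%:R / M * w `^ (- g)).
  rewrite /Q'; congr (ln (_ + _)); have -> : w * w `^ (g - 1) = w `^ g.
    by rewrite -{1}[w]powRr1 ?(ltW w0) // -powRDg // addrC subrK.
  by rewrite invfM mulrA powRN.
have [w1|w1] := leP 1 w.
  have QQ : Q' <= Q.
    rewrite QE; apply: ln_le_ln; first by apply: ltr_wpDr => //; apply: mulr_ge0 => //;
        exact: powR_ge0.
    rewrite lerD2l ler_piMr //; have gg : 0 <= g by qlra.
    by have := powRN_le gg (ltr01 : 0 < 1 :> R) w1; rewrite powR1.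
  apply: ler_pM; rewrite ?powR_ge0 //.
    rewrite QE; apply: le_trans ler01 _; apply: le1_lnD; apply: mulr_ge0 => //; exact: powR_ge0.
  apply: le_trans (_ : 2 `^ (g - 1) <= _); last by qlra.
  by apply: ler_powR_l => //; rewrite ?subr_ge0 ltW.
have w1' : w <= 1 by qlra.
have QQ : Q' <= Q + g * ln w^-1.
  have wge : 1 <= w `^ (- g) by rewrite powRN -[leLHS]invr1 lef_pV2 ?posrE // powR_le1 //; qlra.
  rewrite QE; apply: le_trans (_ : ln ((expR 1 + expR 1 * d%:R / M) * w `^ (- g)) <= _).
    apply: ln_le_ln; first by apply: ltr_wpDr => //; apply: mulr_ge0 => //; exact: powR_ge0.
    by rewrite mulrDl lerD2r ler_peMr // ltW.
  rewrite lnMg ?powR_gt0 //; last by qlra.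
  by rewrite -/Q ln_powR lnV ?posrE // mulNr mulrN.
have h1 : w `^ (g - 1) <= 1 by apply: powR_le1; qlra.
have h2 : w `^ (g - 1) * ((g - 1) * ln w^-1) <= 1.
  have z0 : 0 < w `^ (- (g - 1)) by rewrite powR_gt0.
  have -> : (g - 1) * ln w^-1 = ln (w `^ (- (g - 1))).
    by rewrite ln_powR lnV ?posrE // mulrN mulNr.
  apply: le_trans (ler_wpM2l (ltW wg0) (ltW (ln_sublinear z0))) _.
  by rewrite -powRDg // addrN powRr0.
have h3 : w `^ (g - 1) * (g * ln w^-1) <= g / (g - 1).
  have -> : w `^ (g - 1) * (g * ln w^-1) = g / (g - 1) * (w `^ (g - 1) * ((g - 1) * ln w^-1)).
    by field; rewrite subr_eq0 gt_eqF.
  by rewrite ler_piMr // ltW.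
apply: le_trans (ler_wpM2l (ltW wg0) QQ) _; rewrite mulrDr.
have h4 : w `^ (g - 1) * Q <= 1 * Q by apply: ler_wpM2r => //; qlra.
have h5 : g / (g - 1) <= g / (g - 1) * Q by rewrite ler_peMr // ltW.
have h6 : 0 <= 2 `^ (g - 1) * Q by rewrite mulr_ge0 ?powR_ge0 //; qlra.
qlra.
Qed.

(** The maximum keeps the logarithm at least 1: the value is [ln (e b / k)] for [k <= b] and 1
    beyond. It measures the cost of recording the levels. *)
Definition row_log (b k : nat) : R := ln (expR 1 * Num.max b%:R k%:R / k%:R).

(** For [t >= 1] the dense net serves; for [t < 1] the sparse one with [M = d], where
    [ln (e + e d / M)] is a constant. *)
Lemma row_covering_expR : 0 < beta -> beta < alpha -> exists2 C : R, 1 <= C &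
  forall (d : nat) (t : R), (0 < d)%N -> 0 < t ->
  exists2 n : nat, n%:R <= expR (C * d%:R * t) &
    is_row_net q u d n (t `^ (- alpha) * d%:R `^ (- beta)).
Proof.
move=> be0 ab.
have [C1 C11 H1] := dense_row_covering_expR.
have [C2 C21 H2] := sparse_row_covering_expR be0 ab.
set Q := ln (expR 1 + expR 1) : R.
have Q1 : 1 <= Q by apply: le1_lnD; exact: expR_ge0.
exists (C1 + C2 * Q) => [|d t d0 t0]; first by qnra.
have dR : 0 < d%:R :> R by rewrite ltr0n.
have dt0 : 0 < d%:R * t by rewrite mulr_gt0.
have [t1|t1] := leP 1 t.
  have [n hn net] := H1 d t d0 t1; exists n => //.
  apply: le_trans hn _; rewrite ler_expR -!mulrA ler_wpM2r ?(ltW dt0) //; qnra.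
have [n hn net] := H2 d d%:R t dR t0 ltac:(qlra).
exists n; last by rewrite mulrC.
apply: le_trans hn _; rewrite ler_expR mulfK ?gt_eqF // -/Q.
have -> : C2 * t * (d%:R * Q) = C2 * Q * (d%:R * t) by ring.
by rewrite -[leRHS]mulrA ler_wpM2r ?(ltW dt0) //; qlra.
Qed.

(** About [k / (C1 lam)] levels are used: recording them takes at most [k / 8] nats, as [lam]
    dominates [row_log], and the row nets take another [k / 8]. The parameter [eps] is the floor
    below which the row nets cannot push the common radius. *)
Lemma upper_scheme : 0 < alpha -> exists2 C0 : R, 2 <= C0 & forall C1 : R, C0 <= C1 ->
  exists2 C : R, 0 < C & forall (b d k : nat) (lam eps : R),
  (0 < b)%N -> (0 < k)%N -> row_log b k <= lam -> 0 <= eps ->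
  (forall N v : nat, (0 < v <= N)%N -> N%:R * C1 * lam <= k%:R ->
    exists2 m : nat, m%:R <= expR (k%:R / (8 * N%:R) * v%:R : R) &
    is_row_net q u d m (Num.max (N%:R `^ (- alpha)) eps * (v.+1%:R / N%:R) `^ (- alpha))) ->
  ek b d k <= C * Num.max ((lam / k%:R) `^ alpha) eps.
Proof.
move=> al0.
have rp0 : 0 < recip p.
  by have := recip_ge0 (lt_le_trans p0 pr); qlra.
have [C2 C21 sparse] := sparse_rows_covering p0 pr q0 qu rp0.
have [C0 C02 bits] := @bit_budget R (C2 * 8)^-1 ltac:(rewrite invr_gt0; qlra).
exists C0 => // C1 C01.
set W := (2 * C1) `^ alpha.
have C10 : 0 < C1 by qlra.
have W1 : 1 <= W by apply: powR_ge1 => //; qlra.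
exists (C2 * W) => [|b d k lam eps b0 k0 hlam eps0 hrow]; first by qnra.
have kR : 0 < k%:R :> R by rewrite ltr0n.
have kA : k%:R <= Num.max b%:R k%:R :> R by rewrite le_max lexx orbT.
have bA : b%:R <= Num.max b%:R k%:R :> R by rewrite le_max lexx.
have L1 : 1 <= row_log b k by exact: ln_e_ratio_ge1.
have lam0 : 0 < lam by qlra.
set y := k%:R / lam.
have y0 : 0 < y by rewrite divr_gt0.
have yL : y * lam = k%:R by rewrite /y divfK // gt_eqF.
have ylam : (lam / k%:R) `^ alpha = y `^ (- alpha).
  by rewrite /y !powR_div // opprK mulrC.
rewrite ylam; clearbody y.
have hL1 := L1; rewrite /row_log in hL1.
have WE : W * y `^ (- alpha) = (y / C1 / 2) `^ (- alpha).
  have -> : y / C1 / 2 = y / (2 * C1) by field; rewrite gt_eqF.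
  by rewrite powR_div ?mulr_gt0 // opprK mulrC.
have X0 : 0 <= y `^ (- alpha) by exact: powR_ge0.
have M0 : 0 <= Num.max (y `^ (- alpha)) eps by rewrite le_max X0.
set N := Num.truncn (y / C1).
have yC0 : 0 < y / C1 by rewrite divr_gt0.
have [N0|N0] := posnP N.
  have yC : y / C1 < 1 by rewrite -[1]/(1%:R) -truncn_lt_nat ?(ltW yC0) // -/N N0.
  apply: le_trans (entropy_le1 p0 pr q0 qu b d k) _.
  apply: le_trans (_ : W * y `^ (- alpha) <= _).
    rewrite WE; have y2 : 0 < y / C1 / 2 by qlra.
    have := @powRN_le R _ 1 _ alpha0 y2; rewrite powR1; apply; qlra.
  rewrite -mulrA; apply: le_trans (_ : W * Num.max (y `^ (- alpha)) eps <= _).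
    by rewrite ler_wpM2l ?(le_trans _ W1) // le_max lexx.
  by rewrite ler_peMl // mulr_ge0 // (le_trans _ W1).
have NR : 1 <= N%:R :> R by rewrite ler1n.
have NR0 : 0 < N%:R :> R by qlra.
have NyC : N%:R * C1 <= y by rewrite -ler_pdivlMr // truncn_le ltW.
have NCL : N%:R * C1 * lam <= k%:R by rewrite -yL ler_wpM2r // ltW.
have NCL' : N%:R * C0 * row_log b k <= k%:R.
  apply: le_trans NCL; apply: ler_pM => //; rewrite ?ler_wpM2l //; try qlra.
  by rewrite mulr_ge0 //; qlra.
have hb := bits _ _ _ kR kA NR0 NCL'.
have k2 : (2 <= k)%N.
  rewrite -(ler_nat R); apply: le_trans NCL; rewrite -mulrA.
  have : 2 <= C1 * lam by qnra.
  qnra.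
set e1 := Num.max (N%:R `^ (- alpha)) eps.
have e10 : 0 < e1 by rewrite lt_max powR_gt0.
have kap0 : 0 <= k%:R / (8 * N%:R) :> R by rewrite divr_ge0 // mulr_ge0.
have hN1 : N%:R `^ (- alpha) <= e1 by rewrite le_max lexx.
have [|m hm net] := sparse b d N (k%:R / (8 * N%:R)) e1 N0 (ltW e10) _ kap0 hN1.
  by move=> v v1; exact: hrow.
apply: le_trans (_ : C2 * e1 <= _); last first.
  rewrite -mulrA ler_wpM2l //; first by qlra.
  rewrite /e1 ge_max; apply/andP; split.
    apply: le_trans (_ : W * y `^ (- alpha) <= _).
      rewrite WE; apply: powRN_le => //; first by rewrite divr_gt0.
      by apply: trunc_ge_half; rewrite -truncn_gt0.
    by rewrite ler_wpM2l ?(le_trans _ W1) // le_max lexx.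
  apply: le_trans (_ : 1 * Num.max (y `^ (- alpha)) eps <= _).
    by rewrite mul1r le_max lexx orbT.
  by rewrite ler_wpM2r.
apply: entropy_le_expR hm _ net => //; first by rewrite mulr_gt0 //; qlra.
have -> : k%:R / (8 * N%:R) * N%:R = k%:R / 8 :> R by field; rewrite gt_eqF.
have e0 : 0 < expR 1 :> R by exact: expR_gt0.
have h1 : ln (expR 1 + expR 1 * b%:R / N%:R) <=
    ln (expR 1 + expR 1 * Num.max b%:R k%:R / N%:R : R).
  apply: ln_le_ln; first by rewrite addr_gt0 // divr_gt0 // mulr_gt0 // ltr0n.
  by rewrite lerD2l ler_pM2r ?invr_gt0 // ler_pM2l.
have h2 : C2 * (N%:R * ln (expR 1 + expR 1 * Num.max b%:R k%:R / N%:R)) <= k%:R / 8.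
  have C2p : 0 <= C2 by qlra.
  apply: le_trans (ler_wpM2l C2p hb) _.
  by rewrite le_eqVlt; apply/orP; left; apply/eqP; field; qlra.
have h3 := ler_wpM2l (ltW NR0) h1.
have h4 : C2 * (N%:R * ln (expR 1 + expR 1 * b%:R / N%:R)) <= k%:R / 8.
  by apply: le_trans h2; rewrite ler_wpM2l //; qlra.
rewrite mulrA in h4; qlra.
Qed.

Lemma level_scale (N v : nat) (c : R) : (0 < N)%N -> 0 < c ->
  (v.+1%:R / N%:R * c) `^ (- alpha) = c `^ (- alpha) * (v.+1%:R / N%:R) `^ (- alpha).
Proof. by move=> N0 c0; rewrite powRM ?(ltW c0) ?divr_ge0 // mulrC. Qed.

(** The parameter [t] of the row net is a multiple [c] of the relative level, where
    [c = k / (16 C1 d)] makes its cost [k (v + 1) / (16 N)], within the allowance because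
    [v + 1 <= 2 v]. The floor is then [c ^ - alpha * d ^ - beta]. *)
Lemma upper_i_large : 0 < beta -> beta < alpha -> exists2 C : R, 0 < C &
  forall b d k : nat, (0 < b)%N -> (0 < d)%N -> (0 < k)%N ->
  ek b d k <= C * Num.max ((row_log b k / k%:R) `^ alpha)
                          ((d%:R / k%:R) `^ alpha * d%:R `^ (- beta)).
Proof.
move=> be0 ab; have al0 : 0 < alpha by qlra.
have [C0 C02 H] := upper_scheme al0; have [C Cp hC] := H C0 (lexx _).
have [C1 C11 row] := row_covering_expR be0 ab.
set W := (16 * C1) `^ alpha.
have W1 : 1 <= W by apply: powR_ge1 => //; qlra.
exists (C * W) => [|b d k b0 d0 k0]; first by qnra.
have kR : 0 < k%:R :> R by rewrite ltr0n.
have dR : 0 < d%:R :> R by rewrite ltr0n.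
set X := (d%:R / k%:R) `^ alpha * d%:R `^ (- beta).
have X0 : 0 <= X by rewrite mulr_ge0 ?powR_ge0.
have WX0 : 0 <= W * X by rewrite mulr_ge0 //; qlra.
have Y0 := powR_ge0 (row_log b k / k%:R) alpha.
have M0 : 0 <= Num.max ((row_log b k / k%:R) `^ alpha) X by rewrite le_max Y0.
apply: le_trans (hC b d k (row_log b k) (W * X) b0 k0 (lexx _) WX0 _) _; last first.
  rewrite -mulrA ler_wpM2l ?(ltW Cp) // ge_max; apply/andP; split.
    by apply: le_trans (ler_peMl M0 W1); rewrite le_max lexx.
  by rewrite ler_wpM2l ?le_max ?lexx ?orbT //; qlra.
move=> N v /andP[v0 vN] _.
have N0 : (0 < N)%N by exact: leq_trans vN.
have NR : 0 < N%:R :> R by rewrite ltr0n.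
have vR : 1 <= v%:R :> R by rewrite ler1n.
set c := k%:R / (16 * C1) / d%:R.
have c0 : 0 < c by rewrite !divr_gt0 // mulr_gt0 //; qlra.
have t0 : 0 < v.+1%:R / N%:R * c by rewrite mulr_gt0 // divr_gt0.
have [n hn net] := row d _ d0 t0; exists n.
  apply: le_trans hn _; rewrite ler_expR -natr1.
  have -> : C1 * d%:R * ((v%:R + 1) / N%:R * c) = k%:R / (8 * N%:R) * ((v%:R + 1) / 2).
    by rewrite /c; field; rewrite !gt_eqF //; qlra.
  by apply: ler_wpM2l; [rewrite divr_ge0 // mulr_ge0|qlra].
apply: is_row_net_mono net; rewrite level_scale // mulrAC.
rewrite ler_wpM2r ?powR_ge0 // le_max; apply/orP; right.
rewrite /X mulrA ler_wpM2r ?powR_ge0 // le_eqVlt; apply/orP; left; apply/eqP.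
have C16 : 0 < 16 * C1 by qlra.
rewrite /c powR_div //; last exact: divr_gt0.
by rewrite !powR_div // /W !opprK; ring.
Qed.

(** For [k <= d] a single row can exhaust the bits: [M = k / (C3 ln (e d / k))] is the sparsity
    allowed by [bit_budget], and the floor is [M ^ - beta]. *)
Lemma upper_i_small : 0 < beta -> beta < alpha -> exists2 C : R, 0 < C &
  forall b d k : nat, (0 < b)%N -> (0 < d)%N -> (0 < k)%N -> (k <= d)%N ->
  ek b d k <= C * Num.max ((row_log b k / k%:R) `^ alpha)
                          ((ln (expR 1 * d%:R / k%:R) / k%:R) `^ beta).
Proof.
move=> be0 ab; have al0 : 0 < alpha by qlra.
have [C0 C02 H] := upper_scheme al0; have [C Cp hC] := H C0 (lexx _).
have [C1 C11 row] := sparse_row_covering_expR be0 ab.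
have [C3 C32 bits] := @bit_budget R (C1 * 16)^-1 ltac:(rewrite invr_gt0; qlra).
set W := C3 `^ beta.
have W1 : 1 <= W by apply: powR_ge1 => //; qlra.
exists (C * W) => [|b d k b0 d0 k0 kd]; first by qnra.
have kR : 0 < k%:R :> R by rewrite ltr0n.
have dR : 0 < d%:R :> R by rewrite ltr0n.
have kdR : k%:R <= d%:R :> R by rewrite ler_nat.
set L := ln _; have L1 : 1 <= L by exact: ln_e_ratio_ge1.
have L0 : 0 < L by qlra.
set X := (L / k%:R) `^ beta.
have X0 : 0 <= X by exact: powR_ge0.
have WX0 : 0 <= W * X by rewrite mulr_ge0 //; qlra.
have Y0 := powR_ge0 (row_log b k / k%:R) alpha.
have M0 : 0 <= Num.max ((row_log b k / k%:R) `^ alpha) X by rewrite le_max Y0.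
apply: le_trans (hC b d k (row_log b k) (W * X) b0 k0 (lexx _) WX0 _) _; last first.
  rewrite -mulrA ler_wpM2l ?(ltW Cp) // ge_max; apply/andP; split.
    by apply: le_trans (ler_peMl M0 W1); rewrite le_max lexx.
  by rewrite ler_wpM2l ?le_max ?lexx ?orbT //; qlra.
move=> N v /andP[v0 vN] _.
have N0 : (0 < N)%N by exact: leq_trans vN.
have NR : 0 < N%:R :> R by rewrite ltr0n.
have vR : 1 <= v%:R :> R by rewrite ler1n.
set M := k%:R / (C3 * L).
have CL : 0 < C3 * L by rewrite mulr_gt0 //; qlra.
have M00 : 0 < M by rewrite divr_gt0.
have hb : M * ln (expR 1 + expR 1 * d%:R / M) <= (C1 * 16)^-1 * k%:R.
  by apply: bits => //; rewrite -/L -mulrA /M divfK // gt_eqF.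
have w0 : 0 < v.+1%:R / N%:R :> R by rewrite divr_gt0.
have w2 : v.+1%:R / N%:R <= 2 :> R.
  by rewrite ler_pdivrMr // -natrM ler_nat mul2n -addnn -addn1 leq_add.
have [n hn net] := row d M _ M00 w0 w2; exists n.
  apply: le_trans hn _; rewrite ler_expR.
  have w00 : 0 <= C1 * (v.+1%:R / N%:R) by rewrite mulr_ge0 ?(ltW w0) //; qlra.
  apply: le_trans (ler_wpM2l w00 hb) _.
  have -> : C1 * (v.+1%:R / N%:R) * ((C1 * 16)^-1 * k%:R) = k%:R / (8 * N%:R) * ((v%:R + 1) / 2).
    by rewrite -natr1; field; rewrite !gt_eqF //; qlra.
  by apply: ler_wpM2l; [rewrite divr_ge0 // mulr_ge0|qlra].
apply: is_row_net_mono net.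
rewrite ler_wpM2r ?powR_ge0 // le_max; apply/orP; right.
rewrite le_eqVlt; apply/orP; left; apply/eqP.
rewrite /M powR_div // opprK powRM ?(ltW L0) //; last by qlra.
by rewrite /X powR_div // /W; ring.
Qed.

(** With [beta = 0] the floor disappears: adding [d] to [lam] gives [16 C1 N d <= k], which pays for
    dense row nets with [t = v + 1], of radius [(v + 1) ^ - alpha]. *)
Lemma upper_ia : q = u -> 0 < alpha -> exists2 C : R, 0 < C &
  forall b d k : nat, (0 < b)%N -> (0 < d)%N -> (0 < k)%N ->
  ek b d k <= C * ((row_log b k + d%:R) / k%:R) `^ alpha.
Proof.
move=> equ al0.
have [C0 C02 H] := upper_scheme al0.
have [C1 C11 row] := dense_row_covering_expR.
have [C Cp hC] := H (C0 + 16 * C1) ltac:(qlra).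
exists C => // b d k b0 d0 k0.
have kR : 0 < k%:R :> R by rewrite ltr0n.
have dR : 0 < d%:R :> R by rewrite ltr0n.
have kA : k%:R <= Num.max b%:R k%:R :> R by rewrite le_max lexx orbT.
have L1 : 1 <= row_log b k by exact: ln_e_ratio_ge1.
set lam := row_log b k + d%:R.
apply: le_trans (hC b d k lam 0 b0 k0 _ (lexx _) _) _; last first.
- by rewrite max_l ?powR_ge0.
- move=> N v /andP[v0 vN] hN.
  have N0 : (0 < N)%N by exact: leq_trans vN.
  have NR : 0 < N%:R :> R by rewrite ltr0n.
  have vR : 1 <= v%:R :> R by rewrite ler1n.
  have v1 : 1 <= v.+1%:R :> R by rewrite ler1n.
  have [n hn net] := row d _ d0 v1; exists n.
    apply: le_trans hn _; rewrite ler_expR.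
    have h : N%:R * (16 * C1) * d%:R <= k%:R.
      apply: le_trans hN; apply: ler_pM => //; last by rewrite /lam; qlra.
        by rewrite mulr_ge0 //; qlra.
      by rewrite ler_wpM2l //; qlra.
    have -> : k%:R / (8 * N%:R) * v%:R = k%:R * v%:R / (8 * N%:R) :> R by ring.
    rewrite ler_pdivlMr ?mulr_gt0 // -natr1.
    have -> : C1 * d%:R * (v%:R + 1) * (8 * N%:R) = N%:R * (16 * C1) * d%:R * ((v%:R + 1) / 2).
      by field.
    apply: ler_pM => //; try qlra.
    by rewrite !mulr_ge0 //; qlra.
  apply: is_row_net_mono net.
  rewrite equ subrr oppr0 powRr0 mulr1 max_l ?powR_ge0 //.
  by rewrite powR_div // opprK mulrCA -powRDg // addNr powRr0 mulr1.
- by rewrite lerDl.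
Qed.

(** While [2 ^ ((k - 1) / (b d))] is below the constant [V], [volume_covering] is of no use, and
    monotonicity in [k] reduces to [k = b d], where the bounds of all cases coincide up to
    constants. Beyond that, [delta] is [V] over this power. *)
Lemma upper_large_k : exists2 C : R, 0 < C &
  forall b d k : nat, (0 < b)%N -> (0 < d)%N -> (b * d <= k)%N ->
  ek b d k <= C * (b%:R `^ (- alpha) * d%:R `^ (- beta) * 2 `^ (- ((k%:R - 1) / (b%:R * d%:R)))).
Proof.
have mid : exists2 C : R, 0 < C & forall b d : nat, (0 < b)%N -> (0 < d)%N ->
    ek b d (b * d) <= C * (b%:R `^ (- alpha) * d%:R `^ (- beta)).
  have [ab|ba] := leP alpha beta.
    have [C Cp hC] := upper_ii ab; exists C => // b d b0 d0.
    have bR : 0 < b%:R :> R by rewrite ltr0n.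
    have dR : 0 < d%:R :> R by rewrite ltr0n.
    have [|_] := hC b d (b * d)%N b0 d0 _ (leqnn _); first by rewrite muln_gt0 b0.
    rewrite /log_scaled natrM mulfK ?gt_eqF ?mulr_gt0 // expRK divr1.
    by rewrite mulrAC mulfV ?gt_eqF // mul1r; apply; rewrite ler_peMr ?ler1n // ltW.
  have al0 : 0 < alpha by have := beta0; qlra.
  have logE b d : (0 < b)%N -> (0 < d)%N -> row_log b (b * d) = 1.
    move=> b0 d0; rewrite /row_log max_r ?mulfK ?expRK // ?natrM.
      by rewrite gt_eqF // mulr_gt0 // ltr0n.
    by rewrite ler_peMr // ler1n.
  have [be0|ben0] := eqVneq beta 0.
    have equ : q = u.
      apply/eqP; rewrite eq_le qu leNgt /=; apply/negP => /(recip_lt q0); move: be0; qlra.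
    have [C Cp hC] := upper_ia equ al0.
    exists (C * 2 `^ alpha) => [|b d b0 d0]; first by rewrite mulr_gt0 // powR_gt0.
    have bR : 0 < b%:R :> R by rewrite ltr0n.
    have dR : 1 <= d%:R :> R by rewrite ler1n.
    apply: le_trans (hC b d (b * d)%N b0 d0 _) _; first by rewrite muln_gt0 b0.
    rewrite logE // be0 oppr0 powRr0 mulr1 -mulrA ler_wpM2l ?(ltW Cp) //.
    rewrite -powR_div // natrM; apply: ler_powR_l; first exact: ltW.
      by rewrite divr_ge0 ?mulr_ge0 //; qlra.
    rewrite ler_pdivrMr ?mulr_gt0 //; last by qlra.
    have -> : 2 / b%:R * (b%:R * d%:R) = 2 * d%:R :> R by field; rewrite gt_eqF.
    qlra.
  have be1 : 0 < beta by rewrite lt0r ben0.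
  have [C Cp hC] := upper_i_large be1 ba; exists C => // b d b0 d0.
  have bR : 0 < b%:R :> R by rewrite ltr0n.
  have dR : 1 <= d%:R :> R by rewrite ler1n.
  have dR0 : 0 < d%:R :> R by qlra.
  apply: le_trans (hC b d (b * d)%N b0 d0 _) _; first by rewrite muln_gt0 b0.
  rewrite ler_wpM2l ?(ltW Cp) // logE // natrM ge_max; apply/andP; split.
    rewrite powR_div ?mulr_gt0 // powR1 mul1r powRM ?(ltW bR) //.
    by rewrite ler_wpM2l ?powR_ge0 // ler_powR // lerN2 ltW.
  rewrite ler_wpM2r ?powR_ge0 // (_ : d%:R / (b%:R * d%:R) = 1 / b%:R); last first.
    by field; rewrite !gt_eqF.
  by rewrite powR_div // powR1 mul1r.
have [C Cp hmid] := mid; have [V V1 hV] := volume_covering p0 pr q0 qu.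
exists (C * V + V) => [|b d k b0 d0 kbd]; first by qnra.
have bd0 : (0 < b * d)%N by rewrite muln_gt0 b0.
have k0 : (0 < k)%N by exact: leq_trans kbd.
have bR : 0 < b%:R :> R by rewrite ltr0n.
have dR : 0 < d%:R :> R by rewrite ltr0n.
have BD0 : 0 < b%:R * d%:R :> R by rewrite mulr_gt0.
have kE : k%:R - 1 = (k - 1)%:R :> R by rewrite natrB.
rewrite kE [2 `^ _]powRN; set z := 2 `^ _; have z0 : 0 < z by rewrite powR_gt0.
set X := b%:R `^ (- alpha) * d%:R `^ (- beta).
have X0 : 0 < X by rewrite mulr_gt0 // powR_gt0.
have V0 : 0 < V by qlra.
have [zV|zV] := leP V z.
  have dl0 : 0 < V / z by rewrite divr_gt0.
  have dl1 : V / z <= 1 by rewrite ler_pdivrMr // mul1r.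
  have [m hm net] := hV b d _ b0 d0 dl0 dl1.
  apply: le_trans (_ : V / z * X <= _).
    apply: entropy_le_net net => //; first exact: mulr_gt0.
    rewrite -(ler_nat R); apply: le_trans hm _.
    rewrite invf_div mulrCA mulfV ?gt_eqF // mulr1 /z -powRrM divfK ?gt_eqF //.
    by rewrite powR_mulrn // natrX.
  rewrite mulrDl; have -> : V / z * X = V * (X / z) by ring.
  by rewrite lerDr !mulr_ge0 ?invr_ge0 // ltW.
apply: le_trans (entropy_anti_k p0 pr q0 qu b d kbd) _.
apply: le_trans (hmid b d b0 d0) _; rewrite -/X.
have h : C * X <= C * V * (X / z).
  have -> : C * V * (X / z) = C * X * (V / z) by ring.
  rewrite ler_peMr //; first by rewrite mulr_ge0 // ltW.
  by rewrite ler_pdivlMr // mul1r ltW.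
apply: le_trans h _; rewrite mulrDl lerDl !mulr_ge0 ?invr_ge0 // ltW //.
Qed.

End UpperBounds.

(** * Lower bounds matching the coverings *)

Section IntermediateLowerBounds.
Context {R : realType}.
Context (p q r u : \bar R).
Hypotheses (p0 : (0 < p)%E) (pr : (p <= r)%E) (q0 : (0 < q)%E) (qu : (q <= u)%E).

Local Notation alpha := (recip p - recip r).
Local Notation beta := (recip q - recip u).
Local Notation ek := (entropy_id p q r u).

Let alpha0 : 0 <= alpha. Proof. by rewrite subr_ge0; exact: recip_le. Qed.
Let beta0 : 0 <= beta. Proof. by rewrite subr_ge0; exact: recip_le. Qed.

(** The restriction [ln A <= k] enters the lower bounds here: [ln (e A / k) <= 1 + k <= 2 k]. *)
Lemma log_scaled_ge_half (A k : R) : 1 <= k -> k <= A -> ln A <= k -> 2^-1 <= log_scaled k A.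
Proof.
move=> k1 kA hk; have L1 := ln_e_ratio_ge1 (lt_le_trans ltr01 k1) kA.
have A0 : 0 < A by qlra.
rewrite /log_scaled ler_pdivlMr; last by qlra.
have : ln (expR 1 * A / k) = 1 + ln A - ln k.
  by rewrite -mulrA ln_expR1M ?divr_gt0 ?ln_div ?posrE //; qlra.
have := ln_ge0 k1; qlra.
Qed.

Lemma divn_ge_half (n m : nat) : (0 < m)%N -> (m <= n)%N ->
  n%:R / (2 * m%:R) <= (n %/ m)%:R :> R.
Proof.
move=> m0 mn; have q1 : (0 < n %/ m)%N by rewrite divn_gt0.
rewrite ler_pdivrMr ?mulr_gt0 ?ltr0n // -!natrM ler_nat.
have h : (n <= (n %/ m).+1 * m)%N by rewrite ltnW // ltn_ceil.
apply: leq_trans h _; rewrite [(2 * m)%N]mulnC mulnCA mulnC leq_mul2l.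
by rewrite muln2 -addnn -addn1 leq_add2l q1 orbT.
Qed.

Lemma half_le_ln (L t : R) : 16 <= L -> expR (L - 8) <= t -> L / 2 <= ln t.
Proof.
move=> L16 ht; have : L - 8 <= ln t by rewrite -[leLHS]expRK; apply: ln_le_ln; rewrite ?expR_gt0.
qlra.
Qed.

Lemma expR7_ge : 128 <= expR 7 :> R.
Proof.
have -> : 7 = 1 * 7%:R :> R by rewrite mul1r.
rewrite expRM_natr; apply: le_trans (_ : 2 ^+ 7 <= _); first by rewrite -natrX.
by apply: lerXn2r; rewrite ?nnegrE ?expR_ge0 // expR1_gt2.
Qed.

(* For [y <= b] the packing uses about [y] rows with one nonzero entry each, for
   [y >= b] it uses all rows with about [y / b] nonzero entries each. *)
Lemma lower_main : exists2 c : R, 0 < c &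
  forall b d k : nat, (0 < b)%N -> (0 < d)%N -> (0 < k)%N -> (k <= b * d)%N ->
  ln (b%:R * d%:R) <= k%:R :> R ->
  let y := log_scaled k%:R (b%:R * d%:R) in
  (y <= b%:R -> c * y `^ (- alpha) <= ek b d k) /\
  (b%:R <= y -> c * (b%:R `^ (- alpha) * (y / b%:R) `^ (- beta)) <= ek b d k).
Proof.
have [cV cV0 HV] := volume_lower_bound p0 pr q0 qu.
have [cA cA0 HA] := packing_rows p0 pr q0 qu.
have [cB cB0 HB] := packing_columns p0 pr q0 qu.
set E := expR 16 * 16 : R.
have E1 : 1 <= E by rewrite /E; have := expR_ge1Dx (16 : R); qlra.
have E0 : 0 < E by qlra.
have Ea : 0 < E `^ (- alpha) by exact: powR_gt0.
have Eb : 0 < E `^ (- beta) by exact: powR_gt0.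
have Ea1 : E `^ (- alpha) <= 1.
  by have := powRN_le alpha0 (ltr01 : 0 < 1 :> R) E1; rewrite powR1.
have Eb1 : E `^ (- beta) <= 1.
  by have := powRN_le beta0 (ltr01 : 0 < 1 :> R) E1; rewrite powR1.
have a10 : 0 < 10 `^ (- alpha) :> R by exact: powR_gt0.
have b18 : 0 < 18 `^ (- beta) :> R by exact: powR_gt0.
have a101 : 10 `^ (- alpha) <= 1 :> R.
  by have := powRN_le alpha0 (ltr01 : 0 < 1 :> R) (_ : 1 <= 10); rewrite powR1; apply; qlra.
have b181 : 18 `^ (- beta) <= 1 :> R.
  by have := powRN_le beta0 (ltr01 : 0 < 1 :> R) (_ : 1 <= 18); rewrite powR1; apply; qlra.
set c1 := cV / 2 * (E `^ (- alpha) * E `^ (- beta)).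
set c2 := cA * 10 `^ (- alpha).
set c3 := cB * (10 `^ (- alpha) * 18 `^ (- beta)).
have c10 : 0 < c1 by rewrite /c1 !mulr_gt0 //; qlra.
have c20 : 0 < c2 by rewrite mulr_gt0.
have c30 : 0 < c3 by rewrite !mulr_gt0.
exists (Num.min c1 (Num.min c2 c3)) => [|b d k b0 d0 k0 kbd hk y]; first by rewrite !lt_min c10 c20.
set c := Num.min _ _.
have cc1 : c <= c1 by rewrite ge_min lexx.
have cc2 : c <= c2 by rewrite !ge_min lexx !orbT.
have cc3 : c <= c3 by rewrite !ge_min lexx !orbT.
have use (c' X Y : R) : c <= c' -> 0 <= X -> c' * X <= Y -> c * X <= Y.
  by move=> h X0; apply: le_trans; rewrite ler_wpM2r.
clearbody c.
have bR : 0 < b%:R :> R by rewrite ltr0n.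
have dR : 0 < d%:R :> R by rewrite ltr0n.
have d1 : 1 <= d%:R :> R by rewrite ler1n.
have kR : 0 < k%:R :> R by rewrite ltr0n.
have k1 : 1 <= k%:R :> R by rewrite ler1n.
have BD : k%:R <= b%:R * d%:R :> R by rewrite -natrM ler_nat.
have BD0 : 0 < b%:R * d%:R :> R by rewrite mulr_gt0.
have yh : 2^-1 <= y by exact: log_scaled_ge_half.
have y0 : 0 < y by qlra.
set L := ln (expR 1 * (b%:R * d%:R) / k%:R) : R.
have L1 : 1 <= L by exact: ln_e_ratio_ge1.
have L0 : 0 < L by qlra.
have yL : y * L = k%:R by rewrite /y /log_scaled -/L divfK // gt_eqF.
have expL : expR (L - 1) = b%:R * d%:R / k%:R.
  rewrite expRB lnK ?posrE ?divr_gt0 ?mulr_gt0 ?expR_gt0 //.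
  by field; rewrite !gt_eqF ?expR_gt0.
clearbody y L.
have Y0 := powR_ge0 y (- alpha).
have Z0 : 0 <= b%:R `^ (- alpha) * (y / b%:R) `^ (- beta) by rewrite mulr_ge0 ?powR_ge0.
(* If [L <= 16], then [k] is within a constant factor of [b d] and the volumetric bound suffices;
   otherwise the alphabets below are large enough for packing. *)
have [L16|L16] := leP L 16.
  have lowV : cV / 2 * (b%:R `^ (- alpha) * d%:R `^ (- beta)) <= ek b d k.
    apply: le_trans (HV b d k b0 d0).
    have h : 2^-1 <= 2 `^ (- ((k - 1)%:R / (b%:R * d%:R))) :> R.
      rewrite -[leLHS]powR_inv1 //; apply: ler_powR; first by qlra.
      rewrite lerN2 ler_pdivrMr // mul1r natrB //; qlra.
    have -> : cV / 2 * (b%:R `^ (- alpha) * d%:R `^ (- beta)) =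
       cV * (b%:R `^ (- alpha) * d%:R `^ (- beta)) * 2^-1 by ring.
    rewrite [leRHS]mulrA; apply: ler_wpM2l => //.
    by rewrite !mulr_ge0 ?powR_ge0 // ltW.
  have yE : b%:R * d%:R / E <= y.
    have : b%:R * d%:R / k%:R <= expR 16 :> R by rewrite -expL ler_expR; qlra.
    rewrite ler_pdivrMr // => h.
    rewrite ler_pdivrMr // /E; apply: le_trans h _.
    rewrite -yL mulrCA ler_wpM2l ?(ltW y0) // ler_wpM2l ?expR_ge0 //.
  split=> hy; apply: (use c1) => //; apply: le_trans lowV; rewrite /c1 -mulrA;
    (apply: ler_wpM2l; first by qlra).
    have dE : d%:R <= E.
      have := le_trans yE hy; rewrite ler_pdivrMr //.
      by rewrite ler_pM2l.
    have h1 : E `^ (- alpha) * y `^ (- alpha) <= b%:R `^ (- alpha).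
      rewrite -powRM ?(ltW y0) ?(ltW E0) //; apply: powRN_le => //.
      move: yE; rewrite ler_pdivrMr // mulrC => h; qnra.
    have h2 : E `^ (- beta) <= d%:R `^ (- beta) by exact: powRN_le.
    have -> : E `^ (- alpha) * E `^ (- beta) * y `^ (- alpha) =
      E `^ (- alpha) * y `^ (- alpha) * E `^ (- beta) by ring.
    by apply: ler_pM; rewrite ?mulr_ge0 ?powR_ge0.
  have h2 : E `^ (- beta) * (y / b%:R) `^ (- beta) <= d%:R `^ (- beta).
    rewrite -powRM ?divr_ge0 ?(ltW y0) ?(ltW E0) //; apply: powRN_le => //.
    rewrite mulrA ler_pdivlMr //; move: yE; rewrite ler_pdivrMr // => h; qlra.
  have -> : E `^ (- alpha) * E `^ (- beta) * (b%:R `^ (- alpha) * (y / b%:R) `^ (- beta)) =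
    E `^ (- alpha) * b%:R `^ (- alpha) * (E `^ (- beta) * (y / b%:R) `^ (- beta)) by ring.
  apply: ler_pM; rewrite ?mulr_ge0 ?powR_ge0 //.
  by rewrite ler_piMl ?powR_ge0.
have e7 := expR7_ge.
(* Here [ln (b d / k) = L - 1] and [x <= 128 y <= exp 7 * k], so the logarithm is at least
   [L - 8 >= L / 2]. *)
have key (x : R) : 0 < x -> x <= 128 * y -> L / 2 <= ln (b%:R * d%:R / x).
  move=> x0 hx; apply: half_le_ln => //; first exact: ltW.
  have -> : L - 8 = L - 1 - 7 by ring.
  rewrite expRB expL.
  have -> : b%:R * d%:R / k%:R / expR 7 = b%:R * d%:R / (k%:R * expR 7) :> R.
    by field; rewrite !gt_eqF ?expR_gt0.
  rewrite ler_pM2l // lef_pV2 ?posrE ?mulr_gt0 ?expR_gt0 //.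
  apply: le_trans hx _; rewrite -yL mulrAC mulrC -mulrA ler_wpM2l ?(ltW y0) //.
  have : 128 <= expR 7 * L by apply: le_trans e7 _; rewrite ler_peMr ?expR_ge0.
  by rewrite mulrC.
(* With [x >= 8 y] and [L >= 16], both [k = y L] and [x] fit into [x L / 4]. *)
have budget (x t : R) : 0 < x -> 8 * y <= x -> L / 2 <= ln t -> k%:R + x <= x / 2 * ln t.
  move=> x0 h8 ht; apply: le_trans (_ : x / 2 * (L / 2) <= _); last first.
    by apply: ler_wpM2l => //; qlra.
  rewrite -yL; qnra.
(* As [y >= 1 / 2], rounding up keeps [N <= 10 y]. *)
set N := (Num.truncn (8 * y)).+1.
have Ny : 8 * y < N%:R by exact: truncnS_gt.
have Ny10 : N%:R <= 10 * y.
  have : (Num.truncn (8 * y))%:R <= 8 * y by rewrite truncn_le; qlra.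
  rewrite /N -natr1; qlra.
have NR : 0 < N%:R :> R by rewrite ltr0n.
have [Nb|Nb] := leqP N b.
  have NbR : N%:R <= b%:R :> R by rewrite ler_nat.
  have t0 : (0 < b %/ N)%N by rewrite divn_gt0.
  have ht : L / 2 <= ln ((b %/ N * d)%:R : R).
    have x0 : 0 < 2 * N%:R :> R by rewrite mulr_gt0.
    apply: le_trans (key (2 * N%:R) x0 _) _; first by qlra.
    apply: ln_le_ln; first by rewrite divr_gt0.
    rewrite natrM mulrAC ler_wpM2r // divn_ge_half //.
  have low := HA b d k N (b %/ N)%N k0 isT d0 t0 _ (budget _ _ NR (ltW Ny) ht).
  have {}low := low ltac:(by rewrite mulnC leq_trunc_div).
  split=> hy; last by exfalso; qlra.
  apply: (use c2) => //; apply: le_trans low; rewrite /c2 -mulrA; apply: ler_wpM2l;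
      first exact: ltW.
  rewrite -powRM ?(ltW y0) //; exact: powRN_le.
have bN : b%:R < N%:R :> R by rewrite ltr_nat.
have by10 : b%:R <= 10 * y by qlra.
have yb0 : 0 < y / b%:R by rewrite divr_gt0.
have yb1 : 1 <= 10 * (y / b%:R) by rewrite mulrA ler_pdivlMr // mul1r.
set m := (Num.truncn (8 * (y / b%:R))).+1.
have my : 8 * (y / b%:R) < m%:R by exact: truncnS_gt.
have my18 : m%:R <= 18 * (y / b%:R).
  have : (Num.truncn (8 * (y / b%:R)))%:R <= 8 * (y / b%:R) by rewrite truncn_le; qlra.
  rewrite /m -natr1; qlra.
have mR : 0 < m%:R :> R by rewrite ltr0n.
have bm : 8 * y <= b%:R * m%:R.
  have : b%:R * (8 * (y / b%:R)) <= b%:R * m%:R by rewrite ler_wpM2l // ltW.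
  by rewrite (_ : b%:R * (8 * (y / b%:R)) = 8 * y) //; field; rewrite gt_eqF.
have bmu : b%:R * m%:R <= 18 * y.
  have : b%:R * m%:R <= b%:R * (18 * (y / b%:R)) by rewrite ler_wpM2l // ltW.
  by rewrite (_ : b%:R * (18 * (y / b%:R)) = 18 * y) //; field; rewrite gt_eqF.
(* Otherwise [key] would bound the logarithm of a number at most 1 from below by [L / 2 > 0]. *)
have md : (m <= d)%N.
  rewrite -(ler_nat R) leNgt; apply/negP => dm.
  have x0 : 0 < b%:R * m%:R :> R by rewrite mulr_gt0.
  have := key _ x0 ltac:(qlra).
  have : ln (b%:R * d%:R / (b%:R * m%:R)) <= 0 :> R.
    apply: ln_le0; rewrite ler_pdivrMr // mul1r ler_wpM2l ?(ltW bR) // ltW //.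
  qlra.
have t0 : (0 < d %/ m)%N by rewrite divn_gt0.
have ht : L / 2 <= ln ((d %/ m)%:R : R).
  have x0 : 0 < b%:R * (2 * m%:R) :> R by rewrite !mulr_gt0.
  have hx : b%:R * (2 * m%:R) <= 128 * y by rewrite mulrCA; qlra.
  apply: le_trans (key _ x0 hx) _.
  apply: ln_le_ln; first by rewrite divr_gt0.
  rewrite -mulf_div mulfV ?gt_eqF // mul1r divn_ge_half //.
have bm0 : 0 < b%:R * m%:R :> R by rewrite mulr_gt0.
have low := HB b d k m (d %/ m)%N k0 b0 isT t0 _ (budget _ _ bm0 bm ht).
have {}low := low ltac:(by rewrite mulnC leq_trunc_div).
split=> hy; apply: (use c3) => //; apply: le_trans low; rewrite /c3 -mulrA;
  (apply: ler_wpM2l; first exact: ltW).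
  have h1 : 10 `^ (- alpha) * y `^ (- alpha) <= b%:R `^ (- alpha).
    by rewrite -powRM ?(ltW y0) //; apply: powRN_le.
  have h2 : 18 `^ (- beta) <= m%:R `^ (- beta) :> R.
    apply: powRN_le => //; apply: le_trans my18 _.
    by rewrite ler_piMr // ler_pdivrMr // mul1r.
  have -> : 10 `^ (- alpha) * 18 `^ (- beta) * y `^ (- alpha) =
    10 `^ (- alpha) * y `^ (- alpha) * 18 `^ (- beta) by ring.
  by apply: ler_pM; rewrite ?mulr_ge0 ?powR_ge0.
have h2 : 18 `^ (- beta) * (y / b%:R) `^ (- beta) <= m%:R `^ (- beta).
  by rewrite -powRM ?(ltW yb0) //; apply: powRN_le.
have -> : 10 `^ (- alpha) * 18 `^ (- beta) * (b%:R `^ (- alpha) * (y / b%:R) `^ (- beta)) =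
  10 `^ (- alpha) * b%:R `^ (- alpha) * (18 `^ (- beta) * (y / b%:R) `^ (- beta)) by ring.
apply: ler_pM; rewrite ?mulr_ge0 ?powR_ge0 //.
by rewrite ler_piMl ?powR_ge0.
Qed.

(** Restriction to one row gives [lower_main] with [b = 1]. Its sparse regime [y <= 1] only occurs
    for [y] between [1 / 2] and 1, where all powers are constants. *)
Lemma lower_row : exists2 c : R, 0 < c & forall b d k : nat, (0 < b)%N -> (0 < k)%N ->
  (k <= d)%N -> ln (d%:R) <= k%:R :> R ->
  c * (ln (expR 1 * d%:R / k%:R) / k%:R) `^ beta <= ek b d k.
Proof.
have [c c0 hc] := lower_main.
have P0 : 0 < 2 `^ (- beta) :> R by rewrite powR_gt0.
have P1 : 2 `^ (- beta) <= 1 :> R.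
  by have := powRN_le beta0 (ltr01 : 0 < 1 :> R) (_ : 1 <= 2); rewrite powR1; apply; qlra.
exists (c * 2 `^ (- beta)) => [|b d k b0 k0 kd hk]; first by rewrite mulr_gt0.
have d0 : (0 < d)%N by exact: leq_trans kd.
have kR : 0 < k%:R :> R by rewrite ltr0n.
have k1 : 1 <= k%:R :> R by rewrite ler1n.
have kdR : k%:R <= d%:R :> R by rewrite ler_nat.
apply: le_trans (entropy_submx p0 pr q0 qu k b0 (leqnn d)).
have := hc 1%N d k isT d0 k0; rewrite mul1n mul1r => /(_ kd hk).
have yh : 2^-1 <= log_scaled k%:R d%:R :> R by exact: log_scaled_ge_half.
have -> : (ln (expR 1 * d%:R / k%:R) / k%:R) `^ beta = log_scaled k%:R d%:R `^ (- beta) :> R.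
  rewrite /log_scaled powRN -[X in _ = X]powR_inv1 ?powR_ge0 // powRAC powR_inv1 ?invf_div //.
  by rewrite divr_ge0 // ln_ge0 // ler_pdivlMr // mul1r; have := @expR1_gt2 R; qnra.
move: (log_scaled _ _) yh => y yh [h1 h2].
have y0 : 0 < y by qlra.
have Yb := powR_ge0 y (- beta).
have [y1|y1] := leP 1 y.
  apply: le_trans (h2 y1); rewrite powR1 mul1r divr1 -mulrA ler_wpM2l ?(ltW c0) //.
  by rewrite ler_piMl.
apply: le_trans (h1 (ltW y1)); rewrite -mulrA ler_wpM2l ?(ltW c0) //.
apply: le_trans (_ : 1 <= _).
  rewrite -powRM ?(ltW y0) //; have h : 1 <= 2 * y by qlra.
  by have := powRN_le beta0 (ltr01 : 0 < 1 :> R) h; rewrite powR1.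
by have := powRN_le alpha0 y0 (ltW y1); rewrite powR1.
Qed.

Lemma lower_column : exists2 c : R, 0 < c & forall b d k : nat, (0 < d)%N -> (0 < k)%N ->
  (k <= b)%N -> ln (b%:R) <= k%:R :> R ->
  c * (ln (expR 1 * b%:R / k%:R) / k%:R) `^ alpha <= ek b d k.
Proof.
have [c c0 hc] := lower_main.
exists c => // b d k d0 k0 kb hk.
have b0 : (0 < b)%N by exact: leq_trans kb.
have kR : 0 < k%:R :> R by rewrite ltr0n.
have kbR : k%:R <= b%:R :> R by rewrite ler_nat.
have L1 : 1 <= ln (expR 1 * b%:R / k%:R) :> R by exact: ln_e_ratio_ge1.
apply: le_trans (entropy_submx p0 pr q0 qu k (leqnn b) d0).
have := hc b 1%N k b0 isT k0; rewrite muln1 mulr1 => /(_ kb hk) [h1 _].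
have -> : (ln (expR 1 * b%:R / k%:R) / k%:R) `^ alpha = log_scaled k%:R b%:R `^ (- alpha) :> R.
  rewrite /log_scaled powRN -[X in _ = X]powR_inv1 ?powR_ge0 // powRAC powR_inv1 ?invf_div //.
  by rewrite divr_ge0 //; qlra.
apply: h1; apply: le_trans kbR; rewrite /log_scaled ler_pdivrMr; last by qlra.
by rewrite ler_peMr // ltW.
Qed.

(** Only [b'], the quotient [k / d] rounded up, rows are kept. Then [b' d] is comparable to [k], so
    the exponential factor of the volumetric bound is at least [1 / 2]. *)
Lemma lower_volume : exists2 c : R, 0 < c & forall b d k : nat, (0 < d)%N ->
  (d <= k)%N -> (k <= b * d)%N ->
  c * ((d%:R / k%:R) `^ alpha * d%:R `^ (- beta)) <= ek b d k.
Proof.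
have [c c0 hc] := volume_lower_bound p0 pr q0 qu.
have P0 : 0 < 2 `^ (- alpha) :> R by rewrite powR_gt0.
exists (c / 2 * 2 `^ (- alpha)) => [|b d k d0 dk kbd]; first by rewrite !mulr_gt0 //; qlra.
have k0 : (0 < k)%N by exact: leq_trans dk.
have kR : 0 < k%:R :> R by rewrite ltr0n.
have dR : 0 < d%:R :> R by rewrite ltr0n.
set b' := ((k.-1) %/ d).+1.
have kb' : (k <= b' * d)%N.
  by have := ltn_ceil k.-1 d0; rewrite -/b' prednK.
have b'b : (b' <= b)%N by rewrite /b' ltn_divLR // prednK.
have b'k : b'%:R <= 2 * (k%:R / d%:R) :> R.
  rewrite mulrA ler_pdivlMr // -!natrM ler_nat /b' mulSn.
  have h := leq_trunc_div k.-1 d.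
  rewrite mul2n -addnn; apply: leq_add => //; exact: leq_trans h (leq_pred k).
apply: le_trans (entropy_submx p0 pr q0 qu k b'b (leqnn d)).
apply: le_trans (hc b' d k isT d0).
have bR : 0 < b'%:R :> R by rewrite ltr0n.
have BD : k%:R <= b'%:R * d%:R :> R by rewrite -natrM ler_nat.
have BD0 : 0 < b'%:R * d%:R :> R by rewrite mulr_gt0.
have h : 2^-1 <= 2 `^ (- ((k - 1)%:R / (b'%:R * d%:R))) :> R.
  rewrite -[leLHS]powR_inv1 //; apply: ler_powR; first by qlra.
  by rewrite lerN2 ler_pdivrMr // mul1r natrB //; qlra.
have -> : c / 2 * 2 `^ (- alpha) * ((d%:R / k%:R) `^ alpha * d%:R `^ (- beta)) =
  c * (2 `^ (- alpha) * (d%:R / k%:R) `^ alpha * d%:R `^ (- beta) * 2^-1) by ring.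
apply: ler_wpM2l; first exact: ltW.
apply: ler_pM; rewrite ?mulr_ge0 ?powR_ge0 //.
apply: ler_wpM2r; first exact: powR_ge0.
have -> : (d%:R / k%:R) `^ alpha = (k%:R / d%:R) `^ (- alpha) :> R.
  by rewrite !powR_div // opprK mulrC.
by rewrite -powRM ?divr_ge0 //; apply: powRN_le.
Qed.

(** By monotonicity in [k] the bound at [k' = floor (ln (b d)) + 1] suffices. There the scaled value
    lies between [1 / 2] and 2, by [ln k' <= k' / 2], and [lower_main] gives a constant. *)
Lemma lower_small_k : exists2 c : R, 0 < c & forall b d k : nat, (0 < b)%N -> (0 < d)%N ->
  (0 < k)%N -> k%:R <= ln (b%:R * d%:R) :> R -> c <= ek b d k.
Proof.
have [c c0 hc] := lower_main.
have P0 : 0 < 2 `^ (- alpha) :> R by rewrite powR_gt0.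
have Q0 : 0 < 2 `^ (- beta) :> R by rewrite powR_gt0.
have P1 : 2 `^ (- alpha) <= 1 :> R.
  by have := powRN_le alpha0 (ltr01 : 0 < 1 :> R) (_ : 1 <= 2); rewrite powR1; apply; qlra.
have Q1 : 2 `^ (- beta) <= 1 :> R.
  by have := powRN_le beta0 (ltr01 : 0 < 1 :> R) (_ : 1 <= 2); rewrite powR1; apply; qlra.
exists (c * (2 `^ (- alpha) * 2 `^ (- beta))) => [|b d k b0 d0 k0 hk]; first by rewrite !mulr_gt0.
have bR : 0 < b%:R :> R by rewrite ltr0n.
have b1 : 1 <= b%:R :> R by rewrite ler1n.
have dR : 0 < d%:R :> R by rewrite ltr0n.
have A0 : 0 < b%:R * d%:R :> R by rewrite mulr_gt0.
set A := b%:R * d%:R in hk A0 *.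
have lnA : ln A <= A - 1.
  have := @le_ln1Dx R (A - 1); rewrite (_ : 1 + (A - 1) = A); [apply; qlra|ring].
set k' := (Num.truncn (ln A)).+1.
have k'0 : (0 < k')%N by [].
have l0 : 0 <= ln A by have : 0 <= k%:R :> R by []; qlra.
have k'l : ln A < k'%:R by exact: truncnS_gt.
have k'u : k'%:R <= ln A + 1 by rewrite /k' -natr1 lerD2r truncn_le.
have k'A : (k' <= b * d)%N by rewrite -(ler_nat R) natrM -/A; qlra.
have kk' : (k <= k')%N by rewrite -(ler_nat R); qlra.
have k'1 : 1 <= k'%:R :> R by rewrite ler1n.
apply: le_trans (entropy_anti_k p0 pr q0 qu b d kk').
have k'AR : k'%:R <= A by qlra.
have [] := hc b d k' b0 d0 k'0 k'A (ltW k'l); rewrite -/A.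
have yh : 2^-1 <= log_scaled k'%:R A by apply: log_scaled_ge_half => //; exact: ltW.
have y2 : log_scaled k'%:R A <= 2.
  have L1 : 1 <= ln (expR 1 * A / k'%:R) by apply: ln_e_ratio_ge1 => //; qlra.
  rewrite /log_scaled ler_pdivrMr; last by qlra.
  have -> : ln (expR 1 * A / k'%:R) = 1 + ln A - ln k'%:R.
    by rewrite -mulrA ln_expR1M ?divr_gt0 ?ln_div ?posrE //; qlra.
  have := @ln_le_half R k'%:R ltac:(qlra); qlra.
move: (log_scaled _ _) yh y2 => y yh y2 h1 h2.
have y0 : 0 < y by qlra.
have ya : 2 `^ (- alpha) <= y `^ (- alpha) by exact: powRN_le.
have [yb|yb] := leP y b%:R.
  apply: le_trans (h1 yb); rewrite ler_wpM2l ?(ltW c0) //.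
  by apply: le_trans ya; rewrite ler_piMr // ltW.
apply: le_trans (h2 (ltW yb)); rewrite ler_wpM2l ?(ltW c0) //.
apply: ler_pM; rewrite ?(ltW P0) ?(ltW Q0) //; apply: powRN_le => //; first by qlra.
  by rewrite divr_gt0.
by rewrite ler_pdivrMr //; qlra.
Qed.

End IntermediateLowerBounds.

(** * The cases of the theorem *)

Section Cases.
Context {R : realType}.
Context (p q r u : \bar R).
Hypotheses (p0 : (0 < p)%E) (pr : (p <= r)%E) (q0 : (0 < q)%E) (qu : (q <= u)%E).

Local Notation alpha := (recip p - recip r).
Local Notation beta := (recip q - recip u).
Local Notation ek := (entropy_id p q r u).

Let alpha0 : 0 <= alpha. Proof. by rewrite subr_ge0; exact: recip_le. Qed.
Let beta0 : 0 <= beta. Proof. by rewrite subr_ge0; exact: recip_le. Qed.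

(** Reciprocal constants make the relation symmetric, so the order of its two arguments is harmless
    and one number per case has to be enlarged when the cases are merged. *)
Lemma equiv_of_bounds (c C M a x : R) : 0 <= a -> 0 < c -> 0 < C -> c^-1 + C <= M ->
  c * a <= x -> x <= C * a -> equiv_with M^-1 M x a.
Proof.
move=> a0 c0 C0 hM h1 h2; have ci : 0 < c^-1 by rewrite invr_gt0.
have M0 : 0 < M by qlra.
split.
  rewrite ler_pdivrMl //; apply: le_trans h2 _; apply: ler_wpM2r => //; qlra.
apply: le_trans (_ : c^-1 * x <= _); first by rewrite ler_pdivlMl.
apply: ler_wpM2r; last by qlra.
by apply: le_trans h1; rewrite mulr_ge0 // ltW.
Qed.

Lemma equiv_mono (C M a x : R) : 0 <= x -> 0 < C -> C <= M ->
  equiv_with C^-1 C x a -> equiv_with M^-1 M x a.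
Proof.
move=> a0 C0 CM [h1 h2]; split.
  by apply: le_trans h1; apply: ler_wpM2r => //; rewrite lef_pV2 ?posrE //; qlra.
by apply: le_trans h2 _; apply: ler_wpM2r.
Qed.

Lemma powR_inv_log_scaled (k A x : R) : 0 < k -> k <= A ->
  (ln (expR 1 * A / k) / k) `^ x = log_scaled k A `^ (- x).
Proof.
move=> k0 kA; have L0 : 0 < ln (expR 1 * A / k) := lt_le_trans ltr01 (ln_e_ratio_ge1 k0 kA).
by rewrite /log_scaled !powR_div // opprK mulrC.
Qed.

(** The bounds change form at [y = b], the formulas at [k = b ln d]. The two thresholds agree up to
    constants if [d >= 2]; for [alpha = beta] the two formulas coincide and the threshold is
    immaterial. *)
Lemma case_ii : alpha <= beta -> exists2 C : R, 0 < C &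
  forall b d k : nat, (0 < b)%N -> (0 < d)%N -> (0 < k)%N -> (k <= b * d)%N ->
  ln (b%:R * d%:R) <= k%:R :> R ->
  (k%:R <= b%:R * ln d%:R :> R -> equiv_with C^-1 C (ek b d k)
     ((ln (expR 1 * b%:R * d%:R / k%:R) / k%:R) `^ alpha)) /\
  ((1 < d)%N \/ alpha = beta -> b%:R * ln d%:R <= k%:R :> R -> equiv_with C^-1 C (ek b d k)
     (b%:R `^ (- alpha) * (b%:R * ln (expR 1 * b%:R * d%:R / k%:R) / k%:R) `^ beta)).
Proof.
move=> ab.
have [c c0 hc] := lower_main p0 pr q0 qu; have [C C0 hC] := upper_ii p0 pr q0 qu ab.
have t2 : 0 < 2 `^ (- beta) :> R by rewrite powR_gt0.
have t5 : 0 < 5 `^ (- beta) :> R by rewrite powR_gt0.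
have t21 : 2 `^ (- beta) <= 1 :> R.
  by have := powRN_le beta0 (ltr01 : 0 < 1 :> R) (_ : 1 <= 2); rewrite powR1; apply; qlra.
have t51 : 5 `^ (- beta) <= 1 :> R.
  by have := powRN_le beta0 (ltr01 : 0 < 1 :> R) (_ : 1 <= 5); rewrite powR1; apply; qlra.
set c' := c * (2 `^ (- beta) * 5 `^ (- beta)).
have c'0 : 0 < c' by rewrite !mulr_gt0.
exists (c'^-1 + C) => [|b d k b0 d0 k0 kbd hk]; first by rewrite addr_gt0 ?invr_gt0.
have bR : 0 < b%:R :> R by rewrite ltr0n.
have dR : 0 < d%:R :> R by rewrite ltr0n.
have kR : 0 < k%:R :> R by rewrite ltr0n.
have BD : k%:R <= b%:R * d%:R :> R by rewrite -natrM ler_nat.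
have BD0 : 0 < b%:R * d%:R :> R by rewrite mulr_gt0.
have [hc1 hc2] := hc b d k b0 d0 k0 kbd hk.
have [hC1 hC2] := hC b d k b0 d0 k0 kbd.
rewrite -[expR 1 * b%:R * d%:R]mulrA.
have L1 := ln_e_ratio_ge1 kR BD.
have -> : (b%:R * ln (expR 1 * (b%:R * d%:R) / k%:R) / k%:R) `^ beta =
    (log_scaled k%:R (b%:R * d%:R) / b%:R) `^ (- beta) :> R.
  rewrite -mulrA powRM ?(ltW bR) ?divr_ge0 //; last by qlra.
  rewrite powR_inv_log_scaled // powR_div //; first by rewrite opprK mulrC.
  by rewrite /log_scaled divr_gt0 //; qlra.
rewrite powR_inv_log_scaled //.
have LE : ln (expR 1 * (b%:R * d%:R) / k%:R) = 1 + ln b%:R + ln d%:R - ln k%:R :> R.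
  by rewrite -mulrA ln_expR1M ?divr_gt0 // ln_div ?posrE // lnMg //; ring.
have yE : log_scaled k%:R (b%:R * d%:R) * (1 + ln b%:R + ln d%:R - ln k%:R) = k%:R :> R.
  by rewrite -LE /log_scaled divfK // gt_eqF //; qlra.
rewrite LE in L1.
have y0 : 0 < log_scaled k%:R (b%:R * d%:R) :> R.
  by rewrite /log_scaled divr_gt0 // LE; qlra.
move: (log_scaled _ _) y0 yE hc1 hc2 hC1 hC2 => y y0 yE hc1 hc2 hC1 hC2.
have Ya := powR_ge0 y (- alpha).
have Ba := powR_ge0 (b%:R : R) (- alpha).
have Yb := powR_ge0 (y / b%:R) (- beta).
have Yba := powR_ge0 (y / b%:R) (- alpha).
have T0 : 0 <= b%:R `^ (- alpha) * (y / b%:R) `^ (- beta) by rewrite mulr_ge0.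
have yb0 : 0 < y / b%:R by rewrite divr_gt0.
have c'c (X : R) : 0 <= X -> c' * X <= c * X.
  move=> X0; rewrite ler_wpM2r // /c' ler_piMr ?(ltW c0) //.
  by rewrite mulr_ile1 // ltW.
have yab : y `^ (- alpha) = b%:R `^ (- alpha) * (y / b%:R) `^ (- alpha).
  by rewrite -powRM ?(ltW bR) ?(ltW yb0) // mulrC divfK // gt_eqF.
split=> [hlarge|hd hsmall].
  apply: (equiv_of_bounds Ya c'0 C0 (lexx _)).
    have [yb|yb] := leP y b%:R; first by apply: le_trans (hc1 yb); exact: c'c.
    have lnd0 : 0 < ln d%:R :> R.
      by have := lt_le_trans kR hlarge; rewrite pmulr_rgt0.
    (* Since [ln (ln d) <= ln d / 2], the logarithm [L] is at least [ln d / 2], and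
       [y L = k <= b ln d] gives [y <= 2 b]. *)
    have lk : ln k%:R <= ln b%:R + ln d%:R / 2 :> R.
      apply: le_trans (ln_le_ln kR hlarge) _; rewrite lnMg // lerD2l.
      exact: ln_le_half.
    have y2b : y <= 2 * b%:R.
      have : y * (ln d%:R / 2) <= b%:R * ln d%:R.
        apply: le_trans hlarge; rewrite -yE; apply: ler_wpM2l; [exact: ltW|qlra].
      by rewrite mulrA mulrAC ler_pM2r // ler_pdivrMr // mulrC.
    apply: le_trans (hc2 (ltW yb)); rewrite /c' -mulrA ler_wpM2l ?(ltW c0) //.
    have h1 : y `^ (- alpha) <= b%:R `^ (- alpha) by apply: powRN_le => //; exact: ltW.
    have h2 : 2 `^ (- beta) <= (y / b%:R) `^ (- beta).
      by apply: powRN_le => //; rewrite ler_pdivrMr.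
    rewrite mulrC; apply: ler_pM => //.
    by apply: le_trans h2; rewrite ler_piMr // ltW.
  have [yb|yb] := leP y b%:R; first exact: hC1.
  apply: le_trans (hC2 (ltW yb)) _; rewrite ler_wpM2l ?(ltW C0) // yab ler_wpM2l //.
  by apply: ler_powR; rewrite ?lerN2 // ler_pdivlMr // mul1r ltW.
apply: (equiv_of_bounds T0 c'0 C0 (lexx _)).
  have [by_|yb] := leP b%:R y; first by apply: le_trans (hc2 by_); exact: c'c.
  apply: le_trans (hc1 (ltW yb)); rewrite yab.
  case: hd => [d1|<-]; last by apply: c'c; rewrite mulr_ge0.
  have lnd : 2^-1 <= ln d%:R :> R.
    case/andP: (@ln2_bounds R) => h _; apply: le_trans h _.
    by apply: ln_le_ln => //; rewrite ler_nat.
  have lnlnd : -1 <= ln (ln d%:R : R).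
    apply: le_trans (_ : ln (2^-1 : R) <= _); last exact: ln_le_ln.
    by rewrite lnV ?posrE // lerN2; case/andP: (@ln2_bounds R).
  (* Conversely [L <= 2 + ln d <= 5 ln d], since [ln d >= 1 / 2]; hence [b <= 5 y]. *)
  have lk : ln b%:R - 1 <= ln k%:R :> R.
    apply: le_trans (ln_le_ln _ hsmall); last by rewrite mulr_gt0 //; qlra.
    rewrite lnMg //; qlra.
  have yb5 : b%:R <= 5 * y.
    have : b%:R * ln d%:R <= y * (5 * ln d%:R).
      apply: le_trans hsmall _; rewrite -yE ler_wpM2l ?(ltW y0) //; qlra.
    rewrite mulrA ler_pM2r; [qlra|qlra].
  have h : 5 `^ (- beta) * (y / b%:R) `^ (- beta) <= 1.
    rewrite -powRM ?(ltW yb0) //; have h1 : 1 <= 5 * (y / b%:R).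
      by rewrite mulrA ler_pdivlMr // mul1r.
    by have := powRN_le beta0 (ltr01 : 0 < 1 :> R) h1; rewrite powR1.
  have h2 : 1 <= (y / b%:R) `^ (- alpha).
    have h1 : y / b%:R <= 1 by rewrite ler_pdivrMr // mul1r ltW.
    by have := powRN_le alpha0 yb0 h1; rewrite powR1.
  have -> : c' * (b%:R `^ (- alpha) * (y / b%:R) `^ (- beta)) =
     c * (b%:R `^ (- alpha) * (2 `^ (- beta) * (5 `^ (- beta) * (y / b%:R) `^ (- beta)))).
    by rewrite /c'; ring.
  rewrite ler_wpM2l ?(ltW c0) // ler_wpM2l //; apply: le_trans h2.
  by rewrite mulr_ile1 ?mulr_ge0 // ltW.
have [by_|yb] := leP b%:R y; first exact: hC2.
apply: le_trans (hC1 (ltW yb)) _; rewrite ler_wpM2l ?(ltW C0) // yab ler_wpM2l //.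
apply: ger_powR; rewrite ?lerN2 // yb0 ler_pdivrMr // mul1r ltW //.
Qed.

Lemma case_ia : q = u -> 0 < alpha -> exists2 C : R, 0 < C &
  forall b d k : nat, (0 < b)%N -> (0 < d)%N -> (0 < k)%N -> (k <= b * d)%N ->
  ln (b%:R * d%:R) <= k%:R :> R ->
  ((k <= d)%N -> equiv_with C^-1 C (ek b d k) 1) /\
  ((d <= k)%N -> equiv_with C^-1 C (ek b d k)
    (((ln (expR 1 * b%:R / k%:R) + d%:R) / k%:R) `^ alpha)).
Proof.
move=> equ al0; have be00 : beta = 0 by rewrite equ subrr.
have [c1 c10 hrow] := lower_row p0 pr q0 qu.
have [c2 c20 hcol] := lower_column p0 pr q0 qu.
have [c3 c30 hvol] := lower_volume p0 pr q0 qu.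
have [C C0 hC] := upper_ia p0 pr q0 qu equ al0.
have P2 : 0 < 2 `^ alpha :> R by rewrite powR_gt0.
have P21 : 1 <= 2 `^ alpha :> R by apply: powR_ge1 => //; qlra.
exists (c1^-1 + 1 + ((c2^-1 + c3^-1) * 2 `^ alpha + C * 2 `^ alpha)) => [|b d k b0 d0 k0 kbd hk].
  by rewrite !addr_gt0 ?mulr_gt0 ?addr_gt0 ?invr_gt0.
have i1 : 0 < c1^-1 by rewrite invr_gt0.
have i2 : 0 < c2^-1 by rewrite invr_gt0.
have i3 : 0 < c3^-1 by rewrite invr_gt0.
have CP : 0 < C * 2 `^ alpha by rewrite mulr_gt0.
have cP : 0 < (c2^-1 + c3^-1) * 2 `^ alpha by rewrite mulr_gt0 // addr_gt0.
have bR : 0 < b%:R :> R by rewrite ltr0n.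
have b1 : 1 <= b%:R :> R by rewrite ler1n.
have dR : 0 < d%:R :> R by rewrite ltr0n.
have d1 : 1 <= d%:R :> R by rewrite ler1n.
have kR : 0 < k%:R :> R by rewrite ltr0n.
have BD : k%:R <= b%:R * d%:R :> R by rewrite -natrM ler_nat.
have hkb : ln (b%:R) <= k%:R :> R.
  by apply: le_trans hk; apply: ln_le_ln => //; rewrite ler_peMr // ltW.
have hkd : ln (d%:R) <= k%:R :> R.
  by apply: le_trans hk; apply: ln_le_ln => //; rewrite ler_peMl // ltW.
split=> kd.
  apply: (@equiv_of_bounds c1 1) => //; first by qlra.
    by have := hrow b d k b0 k0 kd hkd; rewrite be00 powRr0.
  by rewrite mulr1; exact: entropy_le1.
set G := ln _ + d%:R.
have lnd := ln_le_half dR.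
(* For [k > b] the term [ln (e b / k)] may be negative, but [k <= b d] keeps it at least
   [1 - ln d >= 1 - d / 2], so [G] remains comparable to [1 + d]. *)
have hup : (row_log b k : R) + d%:R <= 2 * G.
  rewrite /G /row_log; have [kb|bk] := leqP k b.
    rewrite max_l ?ler_nat //.
    have := ln_e_ratio_ge1 kR (_ : k%:R <= b%:R :> R); rewrite ler_nat => /(_ kb); qlra.
  rewrite max_r ?ler_nat ?(ltnW bk) // mulfK ?gt_eqF // expRK.
  have -> : ln (expR 1 * b%:R / k%:R) = 1 + ln b%:R - ln k%:R :> R.
    by rewrite -mulrA ln_expR1M ?divr_gt0 // ln_div ?posrE //; ring.
  have : ln k%:R <= ln b%:R + ln d%:R :> R by rewrite -lnMg //; exact: ln_le_ln.
  qlra.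
have kA : k%:R <= Num.max b%:R k%:R :> R by rewrite le_max lexx orbT.
have L1 : 1 <= (row_log b k : R) by exact: ln_e_ratio_ge1.
have G0 : 0 < G by qlra.
have T0 := powR_ge0 (G / k%:R) alpha.
apply: (@equiv_of_bounds ((c2^-1 + c3^-1) * 2 `^ alpha)^-1 (C * 2 `^ alpha)) => //.
- by rewrite invr_gt0.
- by rewrite invrK; qlra.
- rewrite ler_pdivrMl //.
  have hvolk := hvol b d k d0 kd kbd; rewrite be00 oppr0 powRr0 mulr1 in hvolk.
  have hvolk' : (d%:R / k%:R) `^ alpha <= c3^-1 * ek b d k by rewrite ler_pdivlMl.
  have e0 := entropy_ge0 p0 pr q0 qu b d k.
  rewrite [leRHS]mulrAC [leRHS]mulrC.
  have X2 : 0 <= c2^-1 * ek b d k by rewrite mulr_ge0 // ltW.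
  have X3 : 0 <= c3^-1 * ek b d k by rewrite mulr_ge0 // ltW.
  have dom (X : R) : 0 <= X -> G <= 2 * X -> (X / k%:R) `^ alpha <= (c2^-1 + c3^-1) * ek b d k ->
      (G / k%:R) `^ alpha <= 2 `^ alpha * ((c2^-1 + c3^-1) * ek b d k).
    move=> x0 hG hX; apply: le_trans (_ : 2 `^ alpha * (X / k%:R) `^ alpha <= _).
      rewrite -powRM ?divr_ge0 //; apply: ler_powR_l; rewrite ?(ltW al0) ?divr_ge0 ?(ltW G0) //.
      by rewrite mulrA ler_pM2r ?invr_gt0.
    by rewrite ler_wpM2l // ltW.
  have [lG|lG] := leP (ln (expR 1 * b%:R / k%:R)) (d%:R : R).
    apply: (dom d%:R) => //; first by rewrite /G mulr_natl mulr2n lerD2r.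
    by apply: le_trans hvolk' _; rewrite mulrDl lerDr.
  (* The logarithm exceeds [d >= 1] here, which forces [k < b] and makes [lower_column]
     applicable. *)
  have kb : (k <= b)%N.
    rewrite leqNgt; apply/negP => bk.
    have : ln (expR 1 * b%:R / k%:R) <= 1 :> R.
      rewrite -[leRHS]expRK; apply: ln_le_ln; first by rewrite divr_gt0 // mulr_gt0 // expR_gt0.
      by rewrite ler_pdivrMr // ler_pM2l ?expR_gt0 // ler_nat ltnW.
    qlra.
  have hcolk := hcol b d k d0 k0 kb hkb.
  have hcolk' : (ln (expR 1 * b%:R / k%:R) / k%:R) `^ alpha <= c2^-1 * ek b d k by rewrite
      ler_pdivlMl.
  apply: (dom (ln (expR 1 * b%:R / k%:R))).
  - by apply: le_trans (ltW lG); exact: ltW.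
  - by rewrite /G mulr_natl mulr2n lerD2l ltW.
  - by apply: le_trans hcolk' _; rewrite mulrDl lerDl.
- apply: le_trans (hC b d k b0 d0 k0) _; rewrite -mulrA ler_wpM2l ?(ltW C0) //.
  rewrite -powRM ?divr_ge0 ?(ltW G0) //; apply: ler_powR_l; rewrite ?(ltW al0) ?divr_ge0 //;
      first by qlra.
  by rewrite mulrA ler_pM2r ?invr_gt0.
Qed.

Lemma row_logE_max (b k : nat) : (k <= b)%N -> row_log b k = ln (expR 1 * b%:R / k%:R) :> R.
Proof. by move=> kb; rewrite /row_log max_l ?ler_nat. Qed.

Lemma row_log1 (b k : nat) : (0 < k)%N -> (b <= k)%N -> row_log b k = 1 :> R.
Proof.
move=> k0 bk; rewrite /row_log max_r ?ler_nat // mulfK ?expRK //.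
by rewrite gt_eqF // ltr0n.
Qed.

(** The lower bounds [A], [B] and [V] come from one column, one row and a block of about [k]
    entries, and the upper bounds are maxima of the same terms. What remains is to see that a term
    omitted from a formula is dominated there. *)
Lemma case_ibc : 0 < beta -> beta < alpha -> exists2 C : R, 0 < C &
  forall b d k : nat, (0 < b)%N -> (0 < d)%N -> (0 < k)%N -> (k <= b * d)%N ->
  ln (b%:R * d%:R) <= k%:R :> R ->
  let A : R := (ln (expR 1 * b%:R / k%:R) / k%:R) `^ alpha in
  let B : R := (ln (expR 1 * d%:R / k%:R) / k%:R) `^ beta in
  let V : R := (d%:R / k%:R) `^ alpha * d%:R `^ (- beta) in
  [/\ (b <= d)%N -> (k <= d)%N -> equiv_with C^-1 C (ek b d k) B,
      (b <= k)%N -> (d <= k)%N -> equiv_with C^-1 C (ek b d k) V,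
      (d <= b)%N -> (k <= d)%N -> equiv_with C^-1 C (ek b d k) (Num.max A B) &
      (d <= k)%N -> (k <= b)%N -> equiv_with C^-1 C (ek b d k) (Num.max A V)].
Proof.
move=> be0 ab; have al0 : 0 < alpha by qlra.
have [c1 c10 hrow] := lower_row p0 pr q0 qu.
have [c2 c20 hcol] := lower_column p0 pr q0 qu.
have [c3 c30 hvol] := lower_volume p0 pr q0 qu.
have [C1 C10 hC1] := upper_i_small p0 pr q0 qu be0 ab.
have [C2 C20 hC2] := upper_i_large p0 pr q0 qu be0 ab.
have P2 : 0 < 2 `^ (alpha - beta) :> R by rewrite powR_gt0.
have P21 : 1 <= 2 `^ (alpha - beta) :> R by apply: powR_ge1; qlra.
set c := Num.min c1 (Num.min c2 c3).
have c0 : 0 < c by rewrite !lt_min c10 c20.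
have cc1 : c <= c1 by rewrite ge_min lexx.
have cc2 : c <= c2 by rewrite !ge_min lexx !orbT.
have cc3 : c <= c3 by rewrite !ge_min lexx !orbT.
set C := C1 * 2 `^ (alpha - beta) + C2.
have C1P : 0 < C1 * 2 `^ (alpha - beta) by rewrite mulr_gt0.
have C0 : 0 < C by rewrite /C; qlra.
have C1C : C1 <= C.
  have : C1 <= C1 * 2 `^ (alpha - beta) by rewrite ler_peMr // ltW.
  by rewrite /C; qlra.
exists (c^-1 + C) => [|b d k b0 d0 k0 kbd hk A B V]; first by rewrite addr_gt0 ?invr_gt0.
have bR : 0 < b%:R :> R by rewrite ltr0n.
have b1 : 1 <= b%:R :> R by rewrite ler1n.
have dR : 0 < d%:R :> R by rewrite ltr0n.
have d1 : 1 <= d%:R :> R by rewrite ler1n.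
have kR : 0 < k%:R :> R by rewrite ltr0n.
have k1 : 1 <= k%:R :> R by rewrite ler1n.
have hkb : ln (b%:R) <= k%:R :> R.
  by apply: le_trans hk; apply: ln_le_ln => //; rewrite ler_peMr // ltW.
have hkd : ln (d%:R) <= k%:R :> R.
  by apply: le_trans hk; apply: ln_le_ln => //; rewrite ler_peMl // ltW.
have A0 : 0 <= A by exact: powR_ge0.
have B0 : 0 <= B by exact: powR_ge0.
have V0 : 0 <= V by rewrite mulr_ge0 ?powR_ge0.
have lowB : (k <= d)%N -> c * B <= ek b d k.
  by move=> kd; apply: le_trans (hrow b d k b0 k0 kd hkd); exact: ler_wpM2r.
have lowA : (k <= b)%N -> c * A <= ek b d k.
  by move=> kb; apply: le_trans (hcol b d k d0 k0 kb hkb); exact: ler_wpM2r.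
have lowV : (d <= k)%N -> c * V <= ek b d k.
  by move=> dk; apply: le_trans (hvol b d k d0 dk kbd); exact: ler_wpM2r.
have lowM (X Y : R) : c * X <= ek b d k -> c * Y <= ek b d k -> c * Num.max X Y <= ek b d k.
  by move=> h1 h2; rewrite maxEle; case: ifP.
split.
- move=> bd kd; apply: (equiv_of_bounds B0 c0 C0 (lexx _)); first exact: lowB.
  apply: le_trans (hC1 b d k b0 d0 k0 kd) _.
  apply: le_trans (_ : C1 * (2 `^ (alpha - beta) * B) <= _); last first.
    by rewrite mulrA; apply: ler_wpM2r => //; rewrite /C; qlra.
  rewrite ler_wpM2l ?(ltW C10) // ge_max -/B; apply/andP; split; last by rewrite ler_peMl.
  (* For [b <= d] the level term is dominated: [x = ln (e d / k) / k] is at most 2 because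
     [ln d <= k], and then [x ^ alpha <= 2 ^ (alpha - beta) * x ^ beta]. *)
  have L1 : 1 <= row_log b k :> R.
    by apply: ln_e_ratio_ge1 => //; rewrite le_max lexx orbT.
  have LD : row_log b k <= ln (expR 1 * d%:R / k%:R) :> R.
    have mx : 0 < Num.max b%:R k%:R :> R by rewrite lt_max bR.
    apply: ln_le_ln; first by rewrite divr_gt0 // mulr_gt0 // expR_gt0.
    rewrite ler_pM2r ?invr_gt0 // ler_pM2l ?expR_gt0 //.
    by rewrite ge_max !ler_nat bd.
  have L2 : ln (expR 1 * d%:R / k%:R) <= 2 * k%:R :> R.
    rewrite -mulrA ln_expR1M ?divr_gt0 // ln_div ?posrE //.
    by have := ln_ge0 k1; qlra.
  have BE : B = (ln (expR 1 * d%:R / k%:R) / k%:R) `^ beta by [].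
  rewrite BE; set x := ln _ / k%:R; have x0 : 0 < x by rewrite divr_gt0 //; qlra.
  apply: le_trans (_ : x `^ alpha <= _).
    apply: ler_powR_l; rewrite ?(ltW al0) ?divr_ge0 //; first by qlra.
    by rewrite ler_pM2r ?invr_gt0.
  rewrite -[X in x `^ X](subrK beta alpha) (powRDg (alpha - beta) beta x0); apply: ler_wpM2r;
      first exact: powR_ge0.
  apply: ler_powR_l; rewrite ?(ltW x0) ?subr_ge0 ?(ltW ab) //.
  by rewrite ler_pdivrMr.
- move=> bk dk; apply: (equiv_of_bounds V0 c0 C0 (lexx _)); first exact: lowV.
  apply: le_trans (hC2 b d k b0 d0 k0) _; rewrite -/V.
  apply: ler_pM; rewrite ?(ltW C20) //; last 2 first.
  + by rewrite /C; qlra.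
  (* Here [row_log] is 1, and [k ^ - alpha] is below [V] since [d ^ (alpha - beta) >= 1]. *)
  + rewrite ge_max lexx andbT row_log1 // /V !powR_div // powR1 mul1r.
    rewrite mulrAC ler_peMl ?powR_ge0 // -powRDg //.
    by apply: powR_ge1 => //; qlra.
  by rewrite le_max V0 orbT.
- move=> db kd; have kb := leq_trans kd db.
  have M0 : 0 <= Num.max A B by rewrite le_max A0.
  apply: (equiv_of_bounds M0 c0 C0 (lexx _)); first by apply: lowM; [exact: lowA|exact: lowB].
  apply: le_trans (hC1 b d k b0 d0 k0 kd) _; rewrite row_logE_max // -/A -/B.
  exact: ler_wpM2r.
- move=> dk kb.
  have M0 : 0 <= Num.max A V by rewrite le_max A0.
  apply: (equiv_of_bounds M0 c0 C0 (lexx _)); first by apply: lowM; [exact: lowA|exact: lowV].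
  apply: le_trans (hC2 b d k b0 d0 k0) _; rewrite row_logE_max // -/A -/V.
  by apply: ler_wpM2r => //; rewrite /C; qlra.
Qed.

Lemma case_small_large : exists2 C : R, 0 < C &
  forall b d k : nat, (0 < b)%N -> (0 < d)%N -> (0 < k)%N ->
  (k%:R <= ln (b%:R * d%:R) :> R -> equiv_with C^-1 C (ek b d k) 1) /\
  ((b * d <= k)%N -> equiv_with C^-1 C (ek b d k)
    (b%:R `^ (- alpha) * d%:R `^ (- beta) * 2 `^ (- ((k%:R - 1) / (b%:R * d%:R))))).
Proof.
have [c1 c10 h1] := lower_small_k p0 pr q0 qu.
have [c2 c20 h2] := volume_lower_bound p0 pr q0 qu.
have [C C0 hC] := upper_large_k p0 pr q0 qu.
have i1 : 0 < c1^-1 by rewrite invr_gt0.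
have i2 : 0 < c2^-1 by rewrite invr_gt0.
exists (c1^-1 + c2^-1 + C + 1) => [|b d k b0 d0 k0]; first by qlra.
split=> hk.
  apply: (@equiv_of_bounds c1 1) => //; first by qlra.
    by rewrite mulr1; exact: h1.
  by rewrite mulr1; exact: entropy_le1.
apply: (@equiv_of_bounds c2 C) => //; last exact: hC.
- by qlra.
- by have := h2 b d k b0 d0; rewrite natrB.
Qed.

End Cases.

Unset Implicit Arguments.

Theorem theorem13 (R : realType) (p q r u : \bar R)
    (hp : (0 < p)%E) (hpr : (p <= r)%E) (hq : (0 < q)%E) (hqu : (q <= u)%E) :
  exists c1 c2 : R, 0 < c1 /\ 0 < c2 /\
  forall b d k : nat, (0 < b)%N -> (0 < d)%N -> (0 < k)%N ->
  let e := expR 1 : R in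
  let B := b%:R : R in
  let D := d%:R : R in
  let K := k%:R : R in
  let alpha := recip p - recip r in
  let beta := recip q - recip u in
  let ek_equiv := equiv_with c1 c2 (entropy_id p q r u b d k) in
  (* small and large k *)
  (K <= ln (B * D) -> ek_equiv 1) /\
  ((b * d <= k)%N ->
     ek_equiv (B `^ (- alpha) * D `^ (- beta) * 2 `^ (- ((K - 1) / (B * D))))) /\
  (* intermediate k *)
  (ln (B * D) <= K -> (k <= b * d)%N ->
    (* (i) *)
    (0 <= beta -> beta < alpha ->
      (* (i.a) *)
      (q = u ->
        ((k <= d)%N -> ek_equiv 1) /\
        ((d <= k)%N -> ek_equiv (((ln (e * B / K) + D) / K) `^ alpha))) /\
      (* (i.b) *)
      ((q < u)%E -> (b <= d)%N ->
        ((k <= d)%N -> ek_equiv ((ln (e * D / K) / K) `^ beta)) /\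
        ((d <= k)%N -> ek_equiv ((D / K) `^ alpha * D `^ (- beta)))) /\
      (* (i.c) *)
      ((q < u)%E -> (d <= b)%N ->
        ((k <= d)%N ->
           ek_equiv (Num.max ((ln (e * B / K) / K) `^ alpha)
                             ((ln (e * D / K) / K) `^ beta))) /\
        ((d <= k)%N -> (k <= b)%N ->
           ek_equiv (Num.max ((ln (e * B / K) / K) `^ alpha)
                             ((D / K) `^ alpha * D `^ (- beta)))) /\
        ((b <= k)%N -> ek_equiv ((D / K) `^ alpha * D `^ (- beta))))) /\
    (* (ii) *)
    (0 <= alpha -> alpha <= beta ->
      (K <= B * ln D -> ek_equiv ((ln (e * B * D / K) / K) `^ alpha)) /\
      (* for d = 1 and alpha < beta the formula below is false: it is unbounded
         in b at k close to ln b, whereas e_k <= 1 *)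
      ((1 < d)%N \/ alpha = beta -> B * ln D <= K ->
        ek_equiv (B `^ (- alpha) * (B * ln (e * B * D / K) / K) `^ beta)))).
Proof.
have r0 : (0 < r)%E := lt_le_trans hp hpr.
have u0 : (0 < u)%E := lt_le_trans hq hqu.
have a0 : 0 <= recip p - recip r by rewrite subr_ge0; exact: recip_le.
have b0 : 0 <= recip q - recip u by rewrite subr_ge0; exact: recip_le.
have [M0 M00 H0] := case_small_large hp hpr hq hqu.
have [ab|ba] := leP (recip p - recip r) (recip q - recip u).
  have [M M1 H] := case_ii hp hpr hq hqu ab.
  exists (M0 + M)^-1, (M0 + M); split; first by rewrite invr_gt0; qlra.
  split; first by qlra.
  move=> b d k bp dp kp /=; have e0 := entropy_ge0 hp hpr hq hqu b d k.
  have [H1 H2] := H0 b d k bp dp kp.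
  split; first by move=> /H1; apply: equiv_mono => //; qlra.
  split; first by move=> /H2; apply: equiv_mono => //; qlra.
  move=> hk1 hk2; split; first by rewrite ltNge ab.
  move=> _ _; have [G1 G2] := H b d k bp dp kp hk2 hk1.
  split; first by move=> /G1; apply: equiv_mono => //; qlra.
  by move=> hd /(G2 hd); apply: equiv_mono => //; qlra.
have al0 : 0 < recip p - recip r by qlra.
(* In case (i), [beta = 0] holds exactly when [q = u], so this split separates (i.a) from (i.b) and
   (i.c). *)
have [be0|bn0] := eqVneq (recip q - recip u) 0.
  have equ : q = u.
    apply/eqP; rewrite eq_le hqu leNgt /=; apply/negP => /(recip_lt hq); move: be0; qlra.
  have [M M1 H] := case_ia hp hpr hq hqu equ al0.
  exists (M0 + M)^-1, (M0 + M); split; first by rewrite invr_gt0; qlra.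
  split; first by qlra.
  move=> b d k bp dp kp /=; have e0 := entropy_ge0 hp hpr hq hqu b d k.
  have [H1 H2] := H0 b d k bp dp kp.
  split; first by move=> /H1; apply: equiv_mono => //; qlra.
  split; first by move=> /H2; apply: equiv_mono => //; qlra.
  move=> hk1 hk2; split; last by move=> _; rewrite leNgt ba.
  move=> _ _; have [G1 G2] := H b d k bp dp kp hk2 hk1.
  split.
    move=> _; split; first by move=> /G1; apply: equiv_mono => //; qlra.
    by move=> /G2; apply: equiv_mono => //; qlra.
  by rewrite equ ltxx.
have be1 : 0 < recip q - recip u by rewrite lt0r bn0.
have [M M1 H] := case_ibc hp hpr hq hqu be1 ba.
exists (M0 + M)^-1, (M0 + M); split; first by rewrite invr_gt0; qlra.
split; first by qlra.
move=> b d k bp dp kp /=; have e0 := entropy_ge0 hp hpr hq hqu b d k.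
have [H1 H2] := H0 b d k bp dp kp.
split; first by move=> /H1; apply: equiv_mono => //; qlra.
split; first by move=> /H2; apply: equiv_mono => //; qlra.
move=> hk1 hk2; split; last by move=> _; rewrite leNgt ba.
move=> _ _; have [G1 G2 G3 G4] := H b d k bp dp kp hk2 hk1.
have MM : M <= M0 + M by qlra.
split; first by move=> equ; move: be1; rewrite equ subrr ltxx.
split=> _ hbd.
  split; first by move=> kd; apply: equiv_mono (G1 hbd kd).
  by move=> dk; apply: equiv_mono (G2 (leq_trans hbd dk) dk).
split; first by move=> kd; apply: equiv_mono (G3 hbd kd).
split; first by move=> dk kb; apply: equiv_mono (G4 dk kb).
by move=> bk; apply: equiv_mono (G2 bk (leq_trans hbd bk)).
Qed.
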